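(* For every integer $t$ and every integer $j\ge a+d$ one has $$\mathrm{ann}_R([\omega]_{\le t}R)=\mathrm{ann}_R([\omega]_{t}R)=\bigoplus_i\,[\,J^{i+j-d+t+1}:\mathfrak m^{j}\,]_i .$$
   Context: $k$ is a field and $R$ is a standard graded Cohen-Macaulay $k$-algebra (so $[R]_0=k$ and $R$ is generated over $k$ by finitely many elements of degree $1$) of dimension $d\ge 1$, with homogeneous maximal ideal $\mathfrak m$ and graded canonical module $\omega=\omega_R$, normalized as usual (if $R=S/I$ with $S=k[X_1,\dots,X_n]$ a standard graded polynomial ring and $I$ a homogeneous ideal of height $g$, then $\omega_R\cong \mathrm{Ext}^g_S(R,S(-n))$). For a graded module $M$, $[M]_i$ is the degree $i$ component, $[M]_tR$ is the submodule generated by $[M]_t$, and $[M]_{\le t}R$ is the submodule generated by all homogeneous elements of degree $\le t$. The $a$-invariant is $a=a(R)=-\min\{i : [\omega]_i\ne 0\}$. The ideal $J=(y_1,\dots,y_d)$ is generated by a system of parameters $y_1,\dots,y_d$ of $R$ consisting of linear forms. Convention: powers of ideals with non-positive exponent are the unit ideal. Colons are taken in $R$. *)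

(* Defs.v *)
From HB Require Import structures.
From mathcomp Require Import all_boot all_order all_algebra.
From mathcomp Require Import mpoly.

Set Implicit Arguments.
Unset Strict Implicit.
Unset Printing Implicit Defensive.

Import Order.TTheory GRing.Theory Num.Theory.
Local Open Scope ring_scope.

(* Subsets (ideals, submodules, graded pieces, ...) are Prop-valued predicates;
   equality of subsets is pointwise equivalence. *)

Definition is_submodule (R : comNzRingType) (M : lmodType R)
    (N : M -> Prop) : Prop :=
  [/\ N 0, (forall u v, N u -> N v -> N (u + v))
    & (forall (r : R) u, N u -> N (r *: u))].

Definition submod_gen (R : comNzRingType) (M : lmodType R)
    (X : M -> Prop) : M -> Prop :=
  fun w => forall N : M -> Prop,
    is_submodule N -> (forall u, X u -> N u) -> N w.

Definition annihilator (R : comNzRingType) (M : lmodType R)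
    (N : M -> Prop) : R -> Prop :=
  fun r => forall w, N w -> r *: w = 0.

Definition is_ideal (R : comNzRingType) (I : R -> Prop) : Prop :=
  @is_submodule R R^o I.

Definition ideal_gen (R : comNzRingType) (X : R -> Prop) : R -> Prop :=
  @submod_gen R R^o X.

Definition ideal_mul (R : comNzRingType) (I J : R -> Prop) : R -> Prop :=
  ideal_gen (fun z => exists x y, [/\ I x, J y & z = x * y]).

Fixpoint ideal_pow (R : comNzRingType) (I : R -> Prop) (m : nat) : R -> Prop :=
  if m is m'.+1 then ideal_mul I (ideal_pow I m') else fun=> True.

(* Powers with non-positive exponent are the unit ideal. *)
Definition ideal_powz (R : comNzRingType) (I : R -> Prop) (e : int) : R -> Prop :=
  match e with
  | Posz m => ideal_pow I m
  | Negz _ => fun=> True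
  end.

Definition ideal_colon (R : comNzRingType) (I K : R -> Prop) : R -> Prop :=
  fun x => forall y, K y -> I (x * y).

Definition is_prime (R : comNzRingType) (P : R -> Prop) : Prop :=
  [/\ is_ideal P, ~ P 1 & forall x y, P (x * y) -> P x \/ P y].

(* P 0 < P 1 < ... < P m : a strictly increasing chain of primes of length m. *)
Definition prime_chain (R : comNzRingType) (m : nat)
    (P : nat -> R -> Prop) : Prop :=
  (forall i, (i <= m)%N -> is_prime (P i)) /\
  (forall i, (i < m)%N ->
     (forall x, P i x -> P i.+1 x) /\ (exists x, P i.+1 x /\ ~ P i x)).

Definition krull_dim (R : comNzRingType) (d : nat) : Prop :=
  (exists P : nat -> R -> Prop, prime_chain d P) /\
  (forall m (P : nat -> R -> Prop), prime_chain m P -> (m <= d)%N).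

Definition prime_height (R : comNzRingType) (Q : R -> Prop) (h : nat) : Prop :=
  (exists P : nat -> R -> Prop,
     prime_chain h P /\ (forall x, P h x <-> Q x)) /\
  (forall m (P : nat -> R -> Prop),
     prime_chain m P -> (forall x, P m x <-> Q x) -> (m <= h)%N).

Definition ideal_height (R : comNzRingType) (I : R -> Prop) (g : nat) : Prop :=
  (exists Q : R -> Prop,
     [/\ is_prime Q, (forall x, I x -> Q x) & prime_height Q g]) /\
  (forall (Q : R -> Prop) h,
     is_prime Q -> (forall x, I x -> Q x) -> prime_height Q h -> (g <= h)%N).

(* V is the internal direct sum of the additive subgroups G i, i : int. *)
Definition is_grading (V : zmodType) (G : int -> V -> Prop) : Prop :=
  [/\ (forall i, G i 0),
      (forall i u v, G i u -> G i v -> G i (u - v)),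
      (forall v, exists (s : seq int) (f : int -> V),
         [/\ uniq s, (forall i, G i (f i)) & v = \sum_(i <- s) f i])
    & (forall (s : seq int) (f : int -> V),
         uniq s -> (forall i, G i (f i)) -> \sum_(i <- s) f i = 0 ->
         forall i, i \in s -> f i = 0)].

(* For C i contained in the i-th piece of a grading: the direct sum of the C i. *)
Definition dsum (V : zmodType) (C : int -> V -> Prop) : V -> Prop :=
  fun v => exists (s : seq int) (f : int -> V),
    [/\ uniq s, (forall i, i \in s -> C i (f i)) & v = \sum_(i <- s) f i].

Section StandardGraded.
Variables (k : fieldType) (R : comAlgType k).

(* The k-algebra map k[X_1, ..., X_n] -> R sending X_i to z i. *)
Definition pres_map (n : nat) (z : 'I_n -> R) (p : {mpoly k[n]}) : R :=
  mmap (GRing.in_alg R) z p.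

Definition pres_ker (n : nat) (z : 'I_n -> R) : {mpoly k[n]} -> Prop :=
  fun p => pres_map z p = 0.

Variable gR : int -> R -> Prop.

(* R = S / I as graded algebras, with S = k[X_1, ..., X_n] standard graded
   and I = pres_ker z. *)
Definition is_presentation (n : nat) (z : 'I_n -> R) : Prop :=
  (forall i, gR 1 (z i)) /\ (forall r, exists p, pres_map z p = r).

Definition standard_graded : Prop :=
  [/\ is_grading gR,
      (forall i j x y, gR i x -> gR j y -> gR (i + j) (x * y)),
      (forall (i : int) x, i < 0 -> gR i x -> x = 0),
      (forall x, gR 0 x <-> exists c : k, x = c%:A)
    & (exists (n : nat) (z : 'I_n -> R), is_presentation z)].

Definition max_ideal : R -> Prop :=
  ideal_gen (fun x => exists i : int, 0 < i /\ gR i x).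

Definition regular_seq (s : seq R) : Prop :=
  let I i := ideal_gen (fun x => x \in take i s) in
  (forall i, (i < size s)%N -> forall x, I i (s`_i * x) -> I i x) /\
  ~ I (size s) 1.

Definition depth (e : nat) : Prop :=
  (exists s : seq R,
     [/\ regular_seq s, (forall x, x \in s -> max_ideal x) & size s = e]) /\
  (forall s : seq R,
     regular_seq s -> (forall x, x \in s -> max_ideal x) -> (size s <= e)%N).

Definition cohen_macaulay : Prop := exists e, krull_dim R e /\ depth e.

Definition is_graded_module (M : lmodType R) (gM : int -> M -> Prop) : Prop :=
  is_grading gM /\
  (forall i j r w, gR i r -> gM j w -> gM (i + j) (r *: w)).

Definition gen_by (d : nat) (y : 'I_d -> R) : R -> Prop :=
  ideal_gen (fun x => exists i, x = y i).

(* d = dim R linear forms whose ideal is primary to the maximal ideal, i.e.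
   has the maximal ideal as its radical. *)
Definition linear_sop (d : nat) (y : 'I_d -> R) : Prop :=
  [/\ krull_dim R d, (forall i, gR 1 (y i))
    & (forall x, (exists m : nat, gen_by y (x ^+ m)) <-> max_ideal x)].

(* p belongs to the degree e piece of k[X_1, ..., X_n], e an integer. *)
Definition mpoly_deg (n : nat) (e : int) (p : {mpoly k[n]}) : Prop :=
  match e with
  | Posz m => p \is m.-homog
  | Negz _ => p = 0
  end.

(* A resolution ... -> F_1 -> F_0 -> R -> 0 of R over S = k[X_1, ..., X_n] by
   finitely generated graded free modules F_i = \bigoplus_a S(- res_deg i a).
   Elements of F_i are row vectors, and F_(i+1) -> F_i is right multiplication
   by res_dif i; res_aug gives the images in R of the basis of F_0. *)
Record graded_resolution (n : nat) (z : 'I_n -> R) := GradedResolution {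
  res_rank : nat -> nat;
  res_deg : forall i, 'I_(res_rank i) -> int;
  res_dif : forall i, 'M[{mpoly k[n]}]_(res_rank i.+1, res_rank i);
  res_aug : 'I_(res_rank 0) -> R;
  res_dif_deg : forall i a b,
    mpoly_deg (res_deg a - res_deg b) (res_dif i a b);
  res_aug_deg : forall a, gR (res_deg a) (res_aug a);
  res_aug_surj : forall r, exists v : 'rV[{mpoly k[n]}]_(res_rank 0),
    r = \sum_a pres_map z (v 0 a) * res_aug a;
  res_exact0 : forall v : 'rV[{mpoly k[n]}]_(res_rank 0),
    \sum_a pres_map z (v 0 a) * res_aug a = 0 <->
    exists w, v = w *m res_dif 0;
  res_exact : forall i (v : 'rV[{mpoly k[n]}]_(res_rank i.+1)),
    v *m res_dif i = 0 <-> exists w, v = w *m res_dif i.+1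
}.

Arguments res_deg {n z} _ {i} _.

Section Ext.
Variables (n : nat) (z : 'I_n -> R) (F : graded_resolution z).

(* phi in Hom_S(F_i, S(-n)) is the column vector u of its values on the basis
   of F_i; its composite with F_(i+1) -> F_i is res_dif F i *m u. *)
Definition ext_cocycle (i : nat) (u : 'cV[{mpoly k[n]}]_(res_rank F i)) : Prop :=
  res_dif F i *m u = 0.

Definition ext_coboundary (i : nat) :
    'cV[{mpoly k[n]}]_(res_rank F i) -> Prop :=
  match i with
  | 0 => fun u => u = 0
  | i'.+1 => fun u => exists w, u = res_dif F i' *m w
  end.

(* phi has degree t: it maps the basis element of degree b = res_deg F a into
   [S(-n)]_(b + t) = [S]_(b + t - n). *)
Definition ext_deg (i : nat) (t : int)
    (u : 'cV[{mpoly k[n]}]_(res_rank F i)) : Prop :=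
  forall a, mpoly_deg (res_deg F a + t - n%:Z) (u a 0).

(* Theta induces an isomorphism of graded modules from
   Ext^g_S(R, S(-n)) = cocycles / coboundaries onto M. *)
Definition ext_iso (g : nat) (M : lmodType R) (gM : int -> M -> Prop)
    (Theta : 'cV[{mpoly k[n]}]_(res_rank F g) -> M) : Prop :=
  [/\ (forall p u v, ext_cocycle u -> ext_cocycle v ->
         Theta (p *: u + v) = pres_map z p *: Theta u + Theta v),
      (forall u, ext_cocycle u -> (Theta u = 0 <-> ext_coboundary u)),
      (forall w, exists u, ext_cocycle u /\ Theta u = w)
    & (forall t w, gM t w <->
         exists u, [/\ ext_cocycle u, ext_deg t u & Theta u = w])].

End Ext.

Definition is_canonical_module (M : lmodType R) (gM : int -> M -> Prop) : Prop :=
  is_graded_module gM /\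
  exists (n : nat) (z : 'I_n -> R) (g : nat) (F : graded_resolution z)
    (Theta : 'cV[{mpoly k[n]}]_(res_rank F g) -> M),
    [/\ is_presentation z, ideal_height (pres_ker z) g & ext_iso gM Theta].

End StandardGraded.

(* For M = omega_R: a = - min {i : [M]_i <> 0}. *)
Definition is_a_invariant (V : zmodType) (gM : int -> V -> Prop) (a : int) : Prop :=
  (exists w, gM (- a) w /\ w <> 0) /\
  (forall i : int, (exists w, gM i w /\ w <> 0) -> - a <= i).

Definition deg_sub (R : comNzRingType) (M : lmodType R)
    (gM : int -> M -> Prop) (t : int) : M -> Prop :=
  submod_gen (gM t).

Definition deg_le_sub (R : comNzRingType) (M : lmodType R)
    (gM : int -> M -> Prop) (t : int) : M -> Prop :=
  submod_gen (fun w => exists i : int, i <= t /\ gM i w).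

(* Main.v *)
Require Import Defs.
From HB Require Import structures.
From mathcomp Require Import all_boot all_order all_algebra.
From mathcomp Require Import ssrcomplements mpoly.
From mathcomp Require Import boolp.
From mathcomp Require Import zify ring.

Set Implicit Arguments.
Unset Strict Implicit.
Unset Printing Implicit Defensive.

Import Order.TTheory GRing.Theory Num.Theory.
Local Open Scope ring_scope.

(** The idea is graded duality over the polynomial ring [A = k[Y_1, ..., Y_d]] that
    the parameters [y] generate in [R].

    The ring [R] is a free graded [A]-module ([free_basis]): as [R] is
    Cohen-Macaulay, the parameters form a regular sequence ([sop_regular], by the
    Koszul complex), and homogeneous lifts [e_l], of degrees [b_l], of a basis of
    [R] modulo the parameters form a basis over [A].  The canonical module is then
    the graded dual [Hom_A(R, A(- d))] ([canonical_duality]).  Both sides of the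
    formula can be read off from the basis.  The dual of [e_l] has degree [d - b_l],
    so a homogeneous [x] kills the degree [t] part of the canonical module if and
    only if the [e_l]-coordinates of all the products [x e_l'] vanish for the [l]
    with [b_l >= d - t] ([annihilator_coord]); this condition does not change if all
    degrees [<= t] are allowed.  On the other hand [J^q] consists of the elements
    whose coordinates have order at least [q] ([param_pow]).  If [x] has degree [i],
    then the [e_l]-coordinate of an element of [x R_j] is homogeneous of degree
    [i + j - b_l], which is at least [i + j - d + t + 1] exactly when
    [b_l < d - t].  Hence [x m^j] lies in [J^(i + j - d + t + 1)] if and only if the
    coordinates with [b_l >= d - t] vanish.  The hypothesis [j >= a + d] makes
    [j] at least every [b_l], so that degree [j] sees all basis elements.

    Duality for [Ext] is proved by a tower of coefficient modules.  Choose
    coordinates of the presentation so that the parameters are the first [d]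
    variables and [m] variables remain ([canonical_coordinates]).  Functions on a
    convex region of the lattice of exponents form a module over
    [S = k[X_1, ..., X_(d + m)]].  Power series are the case of nonnegative exponents,
    and in each degree they agree with polynomials.  Reverse the sign of one of the
    last [m] exponents at a time.  The module with that exponent unrestricted lies
    between the modules with nonnegative and with negative exponent, and it has no
    cohomology: modulo the parameters a power of the variable vanishes in [R], which
    gives an element of the presentation ideal that is invertible on this module but
    acts on cohomology as zero ([box_step]).  So each step shifts cohomology by one.
    After [m] steps the coefficients are coinduced from [A] ([coinduced]); as [R] is
    free over [A], their cohomology is [Hom_A(R, k[[Y]])] in position zero and
    vanishes elsewhere ([coinduced_vanish]).  This also identifies the position [g]
    of the given [Ext], since the canonical module is not zero. *)

(** * Components with respect to a grading *)

Section Grading.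
Variables (V : zmodType) (G : int -> V -> Prop).
Hypothesis hG : is_grading G.

Lemma gr0 i : G i 0. Proof. by case: hG. Qed.

Lemma grB i u v : G i u -> G i v -> G i (u - v).
Proof. by case: hG => _ h _ _; apply: h. Qed.

Lemma grN i u : G i u -> G i (- u).
Proof. by move=> hu; rewrite -[- u]add0r; apply: grB => //; apply: gr0. Qed.

Lemma grD i u v : G i u -> G i v -> G i (u + v).
Proof. by move=> hu hv; rewrite -[v]opprK; apply: grB => //; apply: grN. Qed.

Lemma gr_sum i (I : Type) (r : seq I) (P : pred I) (F : I -> V) :
  (forall x, P x -> G i (F x)) -> G i (\sum_(x <- r | P x) F x).
Proof. by move=> h; elim/big_ind: _ => //; [apply: gr0 | apply: grD]. Qed.

Let decomp v : {sf : seq int * (int -> V) |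
  [/\ uniq sf.1, (forall i, G i (sf.2 i)) & v = \sum_(i <- sf.1) sf.2 i]}.
Proof.
by apply: cid; case: hG => _ _ /(_ v)[s [f [? ? ?]]] _; exists (s, f).
Qed.

(** The decomposition of [v] is picked by choice; by [gproj_eq] every other
    decomposition has the same components. *)
Definition gproj i v : V :=
  let sf := sval (decomp v) in if i \in sf.1 then sf.2 i else 0.

Lemma gproj_mem i v : G i (gproj i v).
Proof.
rewrite /gproj; case: (decomp v) => -[s f] [/= _ hf _].
by case: ifP => _ //; apply: gr0.
Qed.

Lemma big_extend (s S : seq int) (f : int -> V) :
  uniq s -> uniq S -> {subset s <= S} ->
  \sum_(i <- S) (if i \in s then f i else 0) = \sum_(i <- s) f i.
Proof.
move=> us uS sS; rewrite -big_mkcond -big_filter; apply: perm_big.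
apply: uniq_perm => //; first exact: filter_uniq.
by move=> i; rewrite mem_filter andb_idr // => /sS.
Qed.

Lemma gproj_eq (s : seq int) (f : int -> V) i :
  uniq s -> (forall j, G j (f j)) ->
  gproj i (\sum_(j <- s) f j) = if i \in s then f i else 0.
Proof.
move=> us hf; rewrite /gproj; case: (decomp _) => -[s' f'] [/= us' hf' E].
have ic (t : seq int) (g : int -> V) j :
    (forall j, G j (g j)) -> G j (if j \in t then g j else 0).
  by move=> hg; case: ifP => _ //; apply: gr0.
pose S := undup (s ++ s'); pose h j :=
  (if j \in s' then f' j else 0) - (if j \in s then f j else 0).
have uS : uniq S by apply: undup_uniq.
have hS : \sum_(j <- S) h j = 0.
  rewrite sumrB !big_extend //= ?E ?subrr // => j; rewrite mem_undup mem_cat => ->//.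
  by rewrite orbT.
have hh j : G j (h j) by apply: grB; apply: ic.
case: hG => _ _ _ /(_ S h uS hh hS i).
case: (boolP (i \in S)) => [_ /(_ isT)/subr0_eq // | ].
rewrite mem_undup mem_cat negb_or => /andP[/negbTE-> /negbTE->] //.
Qed.

Lemma gproj_sum v : exists2 s : seq int, uniq s & v = \sum_(i <- s) gproj i v.
Proof.
case: (decomp v) => -[s f] [/= us hf E]; exists s => //.
rewrite {1}E big_seq [RHS]big_seq; apply: eq_bigr => i si.
by rewrite E gproj_eq // si.
Qed.

Lemma gproj_sum_on v : exists2 s : seq int, uniq s &
  forall S : seq int, uniq S -> {subset s <= S} -> v = \sum_(i <- S) gproj i v.
Proof.
have [s us E] := gproj_sum v; exists s => // S uS sS.
rewrite {1}E -(big_extend _ us uS sS); apply: eq_bigr => i _.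
by rewrite [in RHS]E gproj_eq // => j; apply: gproj_mem.
Qed.

Lemma gprojB i : {morph gproj i : u v / u - v}.
Proof.
move=> u v; have [s us hs] := gproj_sum_on u; have [t ut ht] := gproj_sum_on v.
pose S := undup (i :: s ++ t).
have uS : uniq S by apply: undup_uniq.
have -> : u - v = \sum_(j <- S) (gproj j u - gproj j v).
  rewrite sumrB -hs -?ht // => j jS; rewrite mem_undup in_cons mem_cat jS //.
    by rewrite !orbT.
  by rewrite orbT.
rewrite gproj_eq ?mem_undup ?in_cons ?eqxx // => j.
by apply: grB; apply: gproj_mem.
Qed.

HB.instance Definition _ i := GRing.isZmodMorphism.Build V V (gproj i) (@gprojB i).

Lemma gproj_id i v : G i v -> gproj i v = v.
Proof.
move=> Gv; pose f j := if j == i then v else 0.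
have -> : v = \sum_(j <- [:: i]) f j by rewrite big_seq1 /f eqxx.
rewrite gproj_eq ?inE ?eqxx ?big_seq1 // => j; rewrite /f.
by case: eqP => [->|_] //; apply: gr0.
Qed.

Lemma gproj_neq i j v : G i v -> j != i -> gproj j v = 0.
Proof.
move=> Gv ne; pose f j := if j == i then v else 0.
have -> : v = \sum_(j <- [:: i]) f j by rewrite big_seq1 /f eqxx.
rewrite gproj_eq ?inE ?(negbTE ne) // => l; rewrite /f.
by case: eqP => [->|_] //; apply: gr0.
Qed.

End Grading.

Arguments gproj {V G} hG i v.

(** Applied to multiplication by a homogeneous element of the ring, and to the
    map [x |-> x *: w] for a homogeneous vector [w]. *)
Lemma gproj_act (V W : zmodType) (GV : int -> V -> Prop) (GW : int -> W -> Prop)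
    (hV : is_grading GV) (hW : is_grading GW) (i : int) (op : V -> W) j v :
  {morph op : u v / u + v} -> (forall j u, GV j u -> GW (i + j) (op u)) ->
  gproj hW (i + j) (op v) = op (gproj hV j v).
Proof.
move=> opD hop.
have op0 : op 0 = 0 by apply: (addrI (op 0)); rewrite -opD !addr0.
have [s us hs] := gproj_sum_on hV v.
pose S := undup (j :: s).
have uS : uniq S by apply: undup_uniq.
have E : v = \sum_(l <- S) gproj hV l v.
  by apply: hs => // l ls; rewrite mem_undup in_cons ls orbT.
have -> : op v = \sum_(l <- [seq i + l | l <- S]) op (gproj hV (l - i) v).
  rewrite big_map {1}E (big_morph op opD op0).
  by apply: eq_bigr => l _; rewrite addrC addKr.
rewrite gproj_eq.
- by rewrite mem_map ?mem_undup ?in_cons ?eqxx //= ?[i + j]addrC ?addrK //;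
    apply: addrI.
- by rewrite map_inj_uniq //; apply: addrI.
- by move=> l; have := hop (l - i) (gproj hV (l - i) v) (gproj_mem _ _ _);
    rewrite addrC subrK.
Qed.

(** * The Koszul complex and regular sequences *)

Section Submodules.
Variables (R : comNzRingType) (M : lmodType R).

Lemma gen_submodule (X : M -> Prop) : is_submodule (submod_gen X).
Proof.
split=> [N [] // | u v hu hv N hN hX | r u hu N hN hX].
  by case: (hN) => _ + _; apply; [apply: hu | apply: hv].
by case: (hN) => _ _; apply; apply: hu.
Qed.

Lemma gen_incl (X : M -> Prop) u : X u -> submod_gen X u.
Proof. by move=> Xu N _; apply. Qed.

Lemma submoduleB (N : M -> Prop) u v :
  is_submodule N -> N u -> N v -> N (u - v).
Proof.
by case=> _ hD hZ hu hv; apply: hD => //; rewrite -scaleN1r; apply: hZ.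
Qed.

Lemma submodule_sum (N : M -> Prop) (I : Type) (r : seq I) (P : pred I)
    (F : I -> M) :
  is_submodule N -> (forall i, P i -> N (F i)) -> N (\sum_(i <- r | P i) F i).
Proof. by case=> h0 hD _ h; elim/big_ind: _. Qed.

End Submodules.

Section Koszul.
Variables (R : comNzRingType) (y : nat -> R).

(** The Koszul complex of [y 0, ..., y l.-1], built as an iterated mapping cone,
    which keeps the signs implicit.  All its terms are packed into one module. *)
Fixpoint koszul (l : nat) : lmodType R :=
  if l is l'.+1 then (koszul l' * koszul l')%type else R^o.

Fixpoint kdiff (l : nat) : koszul l -> koszul l :=
  match l with
  | 0 => fun=> 0
  | l'.+1 => fun w => (kdiff w.1, y l' *: w.1 - kdiff w.2)
  end.

(** On the cone of [y j] the exchange of the two factors is a homotopy between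
    [y j] and zero; on the later cones it acts on both factors. *)
Fixpoint khomotopy (j : nat) (l : nat) : koszul l -> koszul l :=
  match l with
  | 0 => fun=> 0
  | l'.+1 => fun w => if j == l' then (w.2, 0) else (khomotopy j w.1, - khomotopy j w.2)
  end.

(** Cohomological degrees are integers, so that arguments which step down by one
    degree need no separate treatment of degree zero. *)
Fixpoint kdeg (l : nat) (i : int) : koszul l -> Prop :=
  match l with
  | 0 => fun w => i != 0 -> w = 0
  | l'.+1 => fun w => kdeg i w.1 /\ kdeg (i - 1) w.2
  end.

Fixpoint kin (I : R -> Prop) (l : nat) : koszul l -> Prop :=
  match l with
  | 0 => fun w => I w
  | l'.+1 => fun w => kin I w.1 /\ kin I w.2
  end.

Lemma pair_lin (U V : lmodType R) (a : R) (u u' : U) (v v' : V) :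
  a *: (u, v) + (u', v') = (a *: u + u', a *: v + v').
Proof. by []. Qed.

Lemma kdP l a (u v : koszul l) : kdiff (a *: u + v) = a *: kdiff u + kdiff v.
Proof.
elim: l u v => [|l IH] /= u v; first by rewrite scaler0 addr0.
rewrite pair_lin !IH; congr (_, _).
rewrite !scalerDr scalerN !scalerA [y l * a]mulrC opprD.
by rewrite addrACA.
Qed.
HB.instance Definition _ l :=
  GRing.isLinear.Build R (koszul l) (koszul l) _ (@kdiff l) (@kdP l).

Lemma khP j l a (u v : koszul l) : khomotopy j (a *: u + v) = a *: khomotopy j u + khomotopy j v.
Proof.
elim: l u v => [|l IH] /= u v; first by rewrite scaler0 addr0.
case: eqP => _; rewrite pair_lin ?scaler0 ?addr0 // !IH.
by rewrite opprD scalerN.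
Qed.
HB.instance Definition _ j l :=
  GRing.isLinear.Build R (koszul l) (koszul l) _ (@khomotopy j l) (@khP j l).

Lemma kdK l (w : koszul l) : kdiff (kdiff w) = 0.
Proof.
elim: l w => [|l IH] //= [u v] /=.
by rewrite IH linearB /= IH subr0 linearZ /= subrr.
Qed.

Lemma kh_homotopy j l (w : koszul l) :
  (j < l)%N -> kdiff (khomotopy j w) + khomotopy j (kdiff w) = y j *: w.
Proof.
elim: l w => [|l IH] //= [u v] /=; rewrite ltnS leq_eqVlt.
have padd (a a' b b' : koszul l) : (a, b) + (a', b') = (a + a', b + b') by [].
case: eqP => [->|_] /= lt.
  by rewrite raddf0 subr0 padd addr0 addrC subrK.
rewrite padd IH // linearN linearB linearZ /= !opprK opprB.
have -> : y j *: (u, v) = (y j *: u, y j *: v) by [].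
congr (_, _); rewrite -IH //.
by rewrite [LHS]addrC addrA subrK addrC.
Qed.

Lemma kdegP l i a (u v : koszul l) : kdeg i u -> kdeg i v -> kdeg i (a *: u + v).
Proof.
elim: l i u v => [|l IH] i u v /=.
  by move=> hu hv ne; rewrite hu // hv // scaler0 addr0.
by case=> ? ? [? ?]; split; apply: IH.
Qed.

Lemma kdeg0 l i : kdeg i (0 : koszul l).
Proof. by elim: l i => [|l IH] i //=; split; apply: IH. Qed.

Lemma kdegZ l i a (u : koszul l) : kdeg i u -> kdeg i (a *: u).
Proof. by move=> hu; rewrite -[a *: u]addr0; apply: kdegP => //; apply: kdeg0. Qed.

Lemma kdegD l i (u v : koszul l) : kdeg i u -> kdeg i v -> kdeg i (u + v).
Proof. by move=> hu hv; rewrite -[u]scale1r; apply: kdegP. Qed.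

Lemma kdegB l i (u v : koszul l) : kdeg i u -> kdeg i v -> kdeg i (u - v).
Proof. by move=> hu hv; rewrite addrC -scaleN1r; apply: kdegP. Qed.

Lemma kdeg_neg l i (u : koszul l) : i < 0 -> kdeg i u -> u = 0.
Proof.
elim: l i u => [|l IH] i /= u; first by move=> lt; apply; rewrite lt_eqF.
case: u => u v /= lt [/(IH _ _ lt)-> /IH ->] //; lia.
Qed.

Lemma kdeg_kd l i (u : koszul l) : kdeg i u -> kdeg (i + 1) (kdiff u).
Proof.
elim: l i u => [|l IH] i u //= [h1 h2]; split; first exact: IH.
rewrite addrK; apply: kdegB; first exact: kdegZ.
by rewrite -[i](subrK 1); apply: IH.
Qed.

Lemma kdeg_kh j l i (u : koszul l) : kdeg i u -> kdeg (i - 1) (khomotopy j u).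
Proof.
elim: l i u => [|l IH] i u //= [h1 h2].
case: eqP => _ /=; split => //; first exact: kdeg0; first exact: IH.
by rewrite -scaleN1r; apply: kdegZ; apply: IH.
Qed.

Section InIdeal.
Variable I : R -> Prop.
Hypothesis hI : is_ideal I.

Lemma kinP l a (u v : koszul l) : kin I u -> kin I v -> kin I (a *: u + v).
Proof.
elim: l u v => [|l IH] u v /=.
  by case: hI => _ hD hZ hu hv; apply: hD => //; apply: hZ.
by case=> ? ? [? ?]; split; apply: IH.
Qed.

Lemma kin0 l : kin I (0 : koszul l).
Proof. by elim: l => [|l IH] //=; case: hI. Qed.

Lemma kinD l (u v : koszul l) : kin I u -> kin I v -> kin I (u + v).
Proof. by move=> hu hv; rewrite -[u]scale1r; apply: kinP. Qed.

Lemma kinZ l a (u : koszul l) : kin I u -> kin I (a *: u).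
Proof. by move=> hu; rewrite -[a *: u]addr0; apply: kinP => //; apply: kin0. Qed.

Lemma kinB l (u v : koszul l) : kin I u -> kin I v -> kin I (u - v).
Proof. by move=> hu hv; rewrite addrC -scaleN1r; apply: kinP. Qed.

Lemma kin_kd l (u : koszul l) : kin I u -> kin I (kdiff u).
Proof.
elim: l u => [|l IH] u /=; first by move=> _; case: hI.
by case=> h1 h2; split; [apply: IH | apply: kinB; [apply: kinZ|apply: IH]].
Qed.

Lemma kin_kh j l (u : koszul l) : kin I u -> kin I (khomotopy j u).
Proof.
elim: l u => [|l IH] u /=; first by move=> _; case: hI.
case=> h1 h2; case: eqP => _ /=; split=> //; first exact: kin0; first exact: IH.
by rewrite -scaleN1r; apply: kinZ; apply: IH.
Qed.

End InIdeal.

(** The homotopies of the generators combine linearly.  That they act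
    componentwise makes them compatible with the reduction modulo any ideal. *)
Lemma ideal_homotopy l (x : R) :
  ideal_gen (fun x => exists2 i, (i < l)%N & x = y i) x ->
  exists h : koszul l -> koszul l,
    [/\ forall w, kdiff (h w) + h (kdiff w) = x *: w,
        forall i w, kdeg i w -> kdeg (i - 1) (h w)
      & forall I w, is_ideal I -> kin I w -> kin I (h w)].
Proof.
pose N x := exists h : koszul l -> koszul l,
    [/\ forall w, kdiff (h w) + h (kdiff w) = x *: w,
        forall i w, kdeg i w -> kdeg (i - 1) (h w)
      & forall I w, is_ideal I -> kin I w -> kin I (h w)].
move=> /(_ N) hx; apply: hx; last first.
  move=> _ [i lt ->]; exists (@khomotopy i l); split.
  - by move=> w; apply: kh_homotopy.
  - by move=> j w; apply: kdeg_kh.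
  - by move=> I w hI; apply: kin_kh.
split.
- exists (fun=> 0); split=> [w|i w _|I w hI _].
  + by rewrite linear0 addr0 scale0r.
  + exact: kdeg0.
  + exact: kin0.
- move=> u v [h [h1 h2 h3]] [h' [h1' h2' h3']]; exists (fun w => h w + h' w).
  split=> [w|i w hw|I w hI hw].
  + by rewrite linearD /= addrACA h1 h1' scalerDl.
  + by apply: kdegD; [apply: h2 | apply: h2'].
  + by apply: kinD => //; [apply: h3 | apply: h3'].
- move=> r u [h [h1 h2 h3]]; exists (fun w => r *: h w).
  split=> [w|i w hw|I w hI hw].
  + by rewrite linearZ /= -scalerDr h1 scalerA.
  + by apply: kdegZ; apply: h2.
  + by apply: kinZ => //; apply: h3.
Qed.

(** For [I' = I + (s)]: division by [s] modulo [I], componentwise and within one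
    cohomological degree. *)
Lemma kin_div (I I' : R -> Prop) (s : R) l i (w : koszul l) :
  is_ideal I -> (forall x, I' x -> exists x', I (x - s * x')) ->
  kdeg i w -> kin I' w -> exists2 w', kdeg i w' & kin I (w - s *: w').
Proof.
move=> hI h; elim: l i w => [|l IH] i w /=.
  move=> hw hin; case: (eqVneq i 0) => [i0 | ne].
    by have [x' hx'] := h w hin; exists x'.
  exists 0; first by [].
  by rewrite (hw ne) scaler0 subrr; case: hI.
case: w => u v /= [du dv] [iu iv].
have [u' ? ?] := IH _ _ du iu; have [v' ? ?] := IH _ _ dv iv.
by exists (u', v').
Qed.

Lemma kin_regular (I : R -> Prop) (s : R) l (w : koszul l) :
  (forall x, I (s * x) -> I x) -> kin I (s *: w) -> kin I w.
Proof.
move=> h; elim: l w => [|l IH] w /=; first exact: h.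
by case=> h1 h2; split; apply: IH.
Qed.

(** Depth sensitivity: every element of a regular sequence [s] acts nilpotently
    on the cohomology of the Koszul complex of [y]; as it also acts injectively
    below degree [size s], that cohomology vanishes there.  The induction runs
    through the quotients by the initial segments of [s]. *)
Lemma koszul_vanish l (s : seq R) :
  let Is c := ideal_gen (fun x => x \in take c s) in
  (forall c, (c < size s)%N -> forall x, Is c (s`_c * x) -> Is c x) ->
  (forall x, x \in s -> exists M,
     ideal_gen (fun x => exists2 i, (i < l)%N & x = y i) (x ^+ M)) ->
  forall c i (u : koszul l), (c <= size s)%N -> i < (size s)%:Z - c%:Z ->
    kdeg i u -> kin (Is c) (kdiff u) ->
    exists2 v, kdeg (i - 1) v & kin (Is c) (u - kdiff v).
Proof.
move=> Is hreg hnil c i u lec.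
have hI b : is_ideal (Is b) by apply: gen_submodule.
have [n hn] : exists n, n = (size s - c)%N by exists (size s - c)%N.
elim: n c lec hn i u => [|n IH] c lec hn i u lti du hu.
  (* The whole sequence has been divided out: only negative degrees remain. *)
  have i0 : i < 0 by move: lti hn; lia.
  rewrite (kdeg_neg i0 du); exists 0; first exact: kdeg0.
  by rewrite linear0 subr0; apply: kin0.
have ltc : (c < size s)%N by lia.
set a := s`_c.
have hdiv x : Is c.+1 x -> exists x', Is c (x - a * x').
  move=> /(_ (fun z => exists x', Is c (z - a * x'))); apply; first split.
  - by exists 0; rewrite mulr0 subr0; case: (hI c).
  - move=> z z' [x1 h1] [x2 h2]; exists (x1 + x2).
    have -> : z + z' - a * (x1 + x2) = (z - a * x1) + (z' - a * x2) by ring.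
    by case: (hI c) => _ + _; apply.
  - move=> r z [x1 h1]; exists (r * x1).
    have -> : r *: (z : R^o) - a * (r * x1) = r *: (z - a * x1 : R^o).
      by rewrite /GRing.scale /=; ring.
    by case: (hI c) => _ _; apply.
  - move=> z; rewrite (take_nth 0) // mem_rcons inE => /orP[/eqP ->|zc].
      by exists 1; rewrite mulr1 subrr; case: (hI c).
    by exists 0; rewrite mulr0 subr0; apply: gen_incl.
have hsub x : Is c x -> Is c.+1 x.
  move=> /(_ (Is c.+1)); apply; first exact: hI.
  move=> z zc; apply: gen_incl; rewrite (take_nth 0) // mem_rcons inE zc.
  by rewrite orbT.
(* s_c is injective on the cohomology modulo I_c in degree i, because the
   cohomology modulo I_(c+1) vanishes in degree i - 1. *)
have hinj (w : koszul l) : kdeg i w ->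
    (exists2 v, kdeg (i - 1) v & kin (Is c) (a *: w - kdiff v)) ->
    exists2 v, kdeg (i - 1) v & kin (Is c) (w - kdiff v).
  move=> dw [v dv hv].
  have hv' : kin (Is c.+1) (kdiff v).
    have -> : kdiff v = a *: w - (a *: w - kdiff v) by rewrite subKr.
    apply: kinB => //; last first.
      by elim: (l) (a *: w - kdiff v) hv => [|l' IHl] z /=; [apply: hsub|case; split; apply: IHl].
    elim: (l) w {dw hv} => [|l' IHl] z /=; last by split; apply: IHl.
    rewrite /GRing.scale /= mulrC.
    case: (hI c.+1) => _ _ /(_ z a); apply; apply: gen_incl.
    by rewrite (take_nth 0) // mem_rcons inE eqxx.
  have [||v1 dv1 hv1] := IH c.+1 ltc _ (i - 1) v _ dv hv'; try lia.
  have dv2 : kdeg (i - 1) (v - kdiff v1).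
    by apply: kdegB => //; rewrite -[i - 1](subrK 1); apply: kdeg_kd.
  have [v' dv' hv2] := kin_div (hI c) hdiv dv2 hv1.
  exists v' => //; apply: (@kin_regular _ a); first exact: hreg.
  have -> : a *: (w - kdiff v') = (a *: w - kdiff v) + kdiff (v - kdiff v1 - a *: v').
    by rewrite scalerBr !(raddfB (@kdiff l)) /= kdK subr0 (linearZ_LR (@kdiff l)) addrA subrK.
  by apply: kinD => //; apply: kin_kd.
have hpow M (w : koszul l) : kdeg i w ->
    (exists2 v, kdeg (i - 1) v & kin (Is c) (a ^+ M *: w - kdiff v)) ->
    exists2 v, kdeg (i - 1) v & kin (Is c) (w - kdiff v).
  elim: M w => [|M IHM] w dw; first by rewrite expr0 scale1r.
  rewrite exprS -scalerA => h; apply: IHM => //.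
  by apply: hinj => //; apply: kdegZ.
have [M hM] := hnil a (mem_nth 0 ltc).
have [h [h1 h2 h3]] := ideal_homotopy hM.
apply: (hpow M) => //; exists (h u); first exact: h2.
by rewrite -h1 addrC addKr; apply: h3.
Qed.

(** The cocycles of top degree [l] of the Koszul complex form the last factor
    of [koszul l]; modulo coboundaries they are the quotient by the ideal of
    [y 0, ..., y l.-1]. *)
Fixpoint ktop (l : nat) (x : R) : koszul l :=
  match l with 0 => x | l'.+1 => (0, ktop l' x) end.

Fixpoint kbot (l : nat) : koszul l -> R :=
  match l with 0 => fun w => w | l'.+1 => fun w => kbot w.2 end.

Lemma kbotP l a (u v : koszul l) : kbot (a *: u + v) = a * kbot u + kbot v.
Proof. by elim: l u v => [|l IH] //= u v; rewrite IH. Qed.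

Lemma ktopK l x : kbot (ktop l x) = x.
Proof. by elim: l => [|l IH]. Qed.

Lemma ktopZ l a x : ktop l (a * x) = a *: ktop l x.
Proof.
elim: l => [|l IH] //=; rewrite IH -{1}[0](scaler0 _ a); by [].
Qed.

Lemma ktop0 l : ktop l 0 = 0.
Proof. by elim: l => [|l IH] //=; rewrite IH. Qed.

Lemma ktopD l x z : ktop l (x + z) = ktop l x + ktop l z.
Proof.
elim: l => [|l IH] //=; rewrite IH -{1}[0]addr0; by [].
Qed.

Lemma kdeg_ktop (l : nat) x : kdeg l%:Z (ktop l x).
Proof.
elim: l => [|l IH] //=; split; first exact: kdeg0.
by have -> : l.+1%:Z - 1 = l by lia.
Qed.

Lemma kd_ktop l x : kdiff (ktop l x) = 0.
Proof. by elim: l => [|l IH] //=; rewrite IH linear0 scaler0 subrr. Qed.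

Definition below (l : nat) : R -> Prop :=
  ideal_gen (fun x => exists2 i, (i < l)%N & x = y i).

Lemma kbot_kd l (w : koszul l) : below l (kbot (kdiff w)).
Proof.
have h0 := @gen_submodule R R^o.
elim: l w => [|l IH] w /=; first by case: (h0 (fun x : R => exists2 i, (i < 0)%N & x = y i)).
have [_ hD hZ] := h0 (fun x : R => exists2 i, (i < l.+1)%N & x = y i).
have -> : y l *: w.1 - kdiff w.2 = (-1) *: kdiff w.2 + y l *: w.1.
  by rewrite scaleN1r addrC.
rewrite kbotP; apply: (hD).
  apply: (hZ (-1)); apply: (IH w.2) => //.
  by move=> z [i lt ->]; apply: gen_incl; exists i => //; rewrite ltnS ltnW.
rewrite -[_ *: _]addr0 kbotP mulrC; apply: hD.
  by apply: (hZ (kbot w.1)); apply: gen_incl; exists l.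
have -> : kbot (0 : koszul l) = 0 by elim: (l).
by case: (h0 (fun x : R => exists2 i, (i < l.+1)%N & x = y i)).
Qed.

Lemma below_ktop l x : below l x -> exists2 v, kdeg (l%:Z - 1) v & kdiff v = ktop l x.
Proof.
move=> /(_ (fun x => exists2 v, kdeg (l%:Z - 1) v & kdiff v = ktop l x)); apply.
  split=> [|u v [a da ha] [b db hb]|r u [a da ha]].
  - exists 0; first exact: kdeg0.
    by rewrite linear0 ktop0.
  - exists (a + b); first exact: kdegD.
    by rewrite linearD /= ha hb ktopD.
  - by exists (r *: a); [apply: kdegZ | rewrite linearZ /= ha -ktopZ].
move=> _ [i lt ->]; exists (khomotopy i (ktop l 1)).
  by apply: kdeg_kh; apply: kdeg_ktop.
rewrite -[LHS]addr0 -[0 in LHS](linear0 (@khomotopy i l)) -(kd_ktop l 1) kh_homotopy //.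
by rewrite -ktopZ mulr1.
Qed.

Definition koszul_acyclic (l : nat) : Prop :=
  forall i (u : koszul l), i < l%:Z -> kdeg i u -> kdiff u = 0 ->
  exists2 v, kdeg (i - 1) v & u = kdiff v.

(** If [y l * x] is a combination of the earlier elements, then [x] in top degree
    extends to a cocycle of the cone of [y l], which is a coboundary. *)
Lemma koszul_regular l x :
  koszul_acyclic l.+1 -> below l (y l * x) -> below l x.
Proof.
move=> hac /below_ktop [v dv hv].
have [|||[u' v'] _ [E _]] := hac l (ktop l x, v).
- by lia.
- by split => //=; apply: kdeg_ktop.
- by rewrite /= kd_ktop hv ktopZ subrr.
by rewrite -(ktopK l x) E; apply: kbot_kd.
Qed.

End Koszul.

Section KoszulGraded.
Variables (R : comNzRingType) (gR : int -> R -> Prop) (hg : is_grading gR).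
Variable y : nat -> R.
Hypothesis gRM : forall i j x z, gR i x -> gR j z -> gR (i + j) (x * z).
Hypothesis gR_neg : forall (i : int) x, i < 0 -> gR i x -> x = 0.
Hypothesis gy : forall i, gR 1 (y i).

Fixpoint kproj (l : nat) (t : int) : koszul R l -> koszul R l :=
  match l with
  | 0 => fun w => gproj hg t w
  | l'.+1 => fun w => (kproj t w.1, kproj t w.2)
  end.

Lemma kprojB l t (u v : koszul R l) : kproj t (u - v) = kproj t u - kproj t v.
Proof.
elim: l u v => [|l IH] u v /=; first exact: raddfB.
by rewrite !IH.
Qed.

Lemma kprojy l t (u : koszul R l) : kproj (1 + t) (y l *: u) = y l *: kproj t u.
Proof.
move: (y l) (gy l) => z gz; elim: l u => [|l IH] u /=; last first.
  by rewrite !IH.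
have := @gproj_act R R gR gR hg hg 1 (fun x => z * x) t u.
by apply => [a b|j x]; [rewrite mulrDr | apply: gRM].
Qed.

Lemma kproj_kd l t (u : koszul R l) : kproj (1 + t) (kdiff y u) = kdiff y (kproj t u).
Proof.
elim: l u => [|l IH] u /=; first exact: raddf0.
by rewrite IH kprojB IH kprojy.
Qed.

Lemma kdeg_kproj l i t (u : koszul R l) : kdeg i u -> kdeg i (kproj t u).
Proof.
elim: l i u => [|l IH] i u /=; first by move=> h /h ->; rewrite raddf0.
by case=> h1 h2; split; apply: IH.
Qed.

Lemma kproj_neg l (t : int) (u : koszul R l) : t < 0 -> kproj t u = 0.
Proof.
move=> lt; elim: l u => [|l IH] u /=; last by rewrite !IH.
by apply: (gR_neg lt); apply: gproj_mem.
Qed.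

Lemma kproj_id l t (u : koszul R l) : kproj t (kproj t u) = kproj t u.
Proof.
elim: l u => [|l IH] u /=; last by rewrite !IH.
by apply: gproj_id; apply: gproj_mem.
Qed.

Lemma kproj_sum l (u : koszul R l) : exists2 s : seq int, uniq s &
  forall S : seq int, uniq S -> {subset s <= S} ->
  u = \sum_(t <- S) kproj t u.
Proof.
elim: l u => [|l IH] u; first exact: gproj_sum_on.
have [s1 _ h1] := IH u.1; have [s2 _ h2] := IH u.2.
exists (undup (s1 ++ s2)); first exact: undup_uniq.
move=> S uS sS; have e1 : u.1 = \sum_(t <- S) kproj t u.1.
  by apply: h1 => // i h; apply: sS; rewrite mem_undup mem_cat h.
have e2 : u.2 = \sum_(t <- S) kproj t u.2.
  by apply: h2 => // i h; apply: sS; rewrite mem_undup mem_cat h orbT.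
rewrite [LHS]surjective_pairing {1}e1 {1}e2 /=.
by elim: (S) => [|t S' IHS]; rewrite ?big_nil // !big_cons -IHS.
Qed.

(** Graded Nakayama: on the cohomology of the shorter complex, [y l] is
    surjective and raises the internal degree, which is bounded below. *)
Lemma koszul_acyclic_pred l : koszul_acyclic y l.+1 -> koszul_acyclic y l.
Proof.
move=> hac i u lti du cu.
have hom (n : nat) t (w : koszul R l) : t < n%:Z -> kdeg i w -> kdiff y w = 0 ->
    kproj t w = w -> exists2 v, kdeg (i - 1) v & w = kdiff y v.
  elim: n t w => [|n IH] t w ltt dw cw ew.
    by exists 0; [apply: kdeg0 | rewrite linear0 -ew kproj_neg].
  have [|||[u' v'] /= [du' dv'] [cu' E]] := hac (i + 1) (0, w).
  - by lia.
  - by split => /=; [apply: kdeg0 | rewrite addrK].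
  - by rewrite /= linear0 scaler0 cw subrr.
  rewrite addrK in du' dv'.
  have [|||| b db hb] := IH (t - 1) (kproj (t - 1) u').
  - by lia.
  - exact: kdeg_kproj.
  - by rewrite -kproj_kd -cu'; have := kprojB (1 + (t - 1)) u' u'; rewrite !subrr.
  - exact: kproj_id.
  exists (y l *: b - kproj (t - 1) v').
    by apply: kdegB; [apply: kdegZ | apply: kdeg_kproj].
  have e1 : 1 + (t - 1) = t by rewrite addrC subrK.
  by rewrite linearB linearZ /= -hb -kprojy -kproj_kd e1 -kprojB -E ew.
have [s us hs] := kproj_sum u.
rewrite (hs s us) //; elim: (s) => [|t s' [v dv IH]].
  by exists 0; [apply: kdeg0 | rewrite linear0 big_nil].
have [||||v' dv' hv'] := hom `|t|.+1 t (kproj t u).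
- by lia.
- exact: kdeg_kproj.
- rewrite -kproj_kd cu; have := kprojB (1 + t) u u; rewrite !subrr //.
- exact: kproj_id.
exists (v' + v); first exact: kdegD.
by rewrite big_cons linearD /= -hv' -IH.
Qed.

Lemma koszul_acyclic_le l m : (m <= l)%N -> koszul_acyclic y l -> koszul_acyclic y m.
Proof.
move=> /subnKC <-; elim: (l - m)%N => [|n IH]; first by rewrite addn0.
by rewrite addnS => /koszul_acyclic_pred.
Qed.

End KoszulGraded.
(** * Freeness over the polynomial ring of a linear system of parameters *)

Section MpolyTools.
Variables (k : fieldType) (n : nat).

Lemma mpoly_additive_eq (W : zmodType) (f g : {additive {mpoly k[n]} -> W}) :
  (forall c m, f (c *: 'X_[m]) = g (c *: 'X_[m])) -> f =1 g.
Proof.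
by move=> h p; rewrite (mpolyE p) !raddf_sum; apply: eq_bigr => m _; apply: h.
Qed.

Definition mhom (t : int) (p : {mpoly k[n]}) : {mpoly k[n]} :=
  if t is Posz q then pihomog mdeg q p else 0.

Lemma mhom_deg t p : mpoly_deg t (mhom t p).
Proof. by case: t => q //=; apply: pihomogP. Qed.

Lemma mhom_id t p : mpoly_deg t p -> mhom t p = p.
Proof. by case: t => q /=; [apply: pihomog_dE | move->]. Qed.

Lemma mhomX t m : mhom t 'X_[m] = if (mdeg m)%:Z == t then 'X_[m] else 0.
Proof. by case: t => q //=; rewrite pihomogX. Qed.

Lemma mhomB t : {morph mhom t : p q / p - q}.
Proof. by case: t => q p p' /=; rewrite ?raddfB ?subr0. Qed.
HB.instance Definition _ t :=
  GRing.isZmodMorphism.Build {mpoly k[n]} {mpoly k[n]} (mhom t) (@mhomB t).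

Lemma mhomZ t c p : mhom t (c *: p) = c *: mhom t p.
Proof. by case: t => q /=; [rewrite linearZ | rewrite scaler0]. Qed.

Lemma mpoly_deg0 t : @mpoly_deg k n t 0.
Proof. by case: t => q //=; apply: rpred0. Qed.

Lemma mpoly_deg_coef t (p : {mpoly k[n]}) m : mpoly_deg t p -> p@_m != 0 -> (mdeg m)%:Z = t.
Proof.
case: t => q /= hp; last by rewrite hp mcoeff0 eqxx.
by rewrite -mcoeff_msupp => /(dhomog_mf hp) ->.
Qed.

Lemma mpoly_degM t t' (p q : {mpoly k[n]}) :
  mpoly_deg t p -> mpoly_deg t' q -> mpoly_deg (t + t') (p * q).
Proof.
case: t => [a|a] hp hq; last by rewrite [p]hp mul0r; apply: mpoly_deg0.
case: t' hq => [b|b] hq; last by rewrite [q]hq mulr0; apply: mpoly_deg0.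
exact: dhomogM hp hq.
Qed.

Lemma mpoly_degD t (p q : {mpoly k[n]}) : mpoly_deg t p -> mpoly_deg t q -> mpoly_deg t (p + q).
Proof. by case: t => a /= hp hq; [apply: rpredD | rewrite hp hq addr0]. Qed.

Lemma mpoly_degZ t c (p : {mpoly k[n]}) : mpoly_deg t p -> mpoly_deg t (c *: p).
Proof. by case: t => a /= hp; [apply: rpredZ | rewrite hp scaler0]. Qed.

Lemma mpoly_deg_sum t (I : Type) (r : seq I) (P : pred I) (F : I -> {mpoly k[n]}) :
  (forall i, P i -> mpoly_deg t (F i)) -> mpoly_deg t (\sum_(i <- r | P i) F i).
Proof. by move=> h; elim/big_ind: _ => //; [apply: mpoly_deg0 | apply: mpoly_degD]. Qed.

End MpolyTools.

Section PresMap.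
Variables (k : fieldType) (R : comAlgType k) (n : nat) (z : 'I_n -> R).

HB.instance Definition _ :=
  GRing.isZmodMorphism.Build {mpoly k[n]} R (pres_map z)
    (raddfB (mmap (GRing.in_alg R) z)).
Lemma pres_map_monoid : GRing.monoid_morphism (pres_map z).
Proof.
by split=> [|p q]; rewrite /pres_map ?(rmorph1 (mmap (GRing.in_alg R) z)) //
  (rmorphM (mmap (GRing.in_alg R) z)).
Qed.
HB.instance Definition _ :=
  GRing.isMonoidMorphism.Build {mpoly k[n]} R (pres_map z) pres_map_monoid.

Lemma pres_mapC c : pres_map z c%:MP = c%:A.
Proof. exact: mmapC. Qed.

Lemma pres_mapZ c p : pres_map z (c *: p) = c *: pres_map z p.
Proof. by rewrite -mul_mpolyC rmorphM /= pres_mapC -scalerAl mul1r. Qed.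

Lemma pres_mapU i : pres_map z 'X_i = z i.
Proof. by rewrite /pres_map mmapX mmap1U. Qed.

Lemma pres_mapX m : pres_map z 'X_[m] = \prod_i z i ^+ m i.
Proof. exact: mmapX. Qed.

Lemma pres_mapXU i (m : 'X_{1..n}) : m i != 0%N ->
  pres_map z 'X_[m] = z i * pres_map z 'X_[m - U_(i)].
Proof.
move=> h; rewrite -pres_mapU -rmorphM /= -mpolyXD addmC submK //.
by rewrite lep1mP.
Qed.

End PresMap.

Lemma mpoly_rmorph_eq (k : fieldType) (n : nat) (A : comNzRingType)
    (f g : {rmorphism {mpoly k[n]} -> A}) :
  (forall c, f c%:MP = g c%:MP) -> (forall i, f 'X_i = g 'X_i) -> f =1 g.
Proof.
move=> hC hX; apply: (mpoly_additive_eq (f := f) (g := g)) => c m /=.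
rewrite -mul_mpolyC (rmorphM f) (rmorphM g) hC; congr (_ * _).
rewrite mpolyXE_id (rmorph_prod f) (rmorph_prod g); apply: eq_bigr => i _.
by rewrite (rmorphXn f) (rmorphXn g) hX.
Qed.

Section GradedPres.
Variables (k : fieldType) (R : comAlgType k) (gR : int -> R -> Prop).
Hypothesis hR : standard_graded gR.
Variables (n : nat) (z : 'I_n -> R).
Hypothesis z1 : forall i, gR 1 (z i).

Let hg : is_grading gR. Proof. by case: hR. Qed.
Let gRM : forall i j x z, gR i x -> gR j z -> gR (i + j) (x * z).
Proof. by case: hR. Qed.

Lemma gr_alg (c : k) : gR 0 c%:A.
Proof. by case: hR => _ _ _ h _; apply/h; exists c. Qed.

Lemma gr_scale t (c : k) x : gR t x -> gR t (c *: x).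
Proof.
by move=> h; rewrite -[x]mul1r scalerAl -[t]add0r; apply: gRM h; apply: gr_alg.
Qed.

Lemma gr_pres_mapX m : gR (mdeg m) (pres_map z 'X_[m]).
Proof.
rewrite pres_mapX mdegE; elim/big_rec2: _ => [|i a b _ IH].
  by rewrite -(scale1r 1); apply: gr_alg.
rewrite PoszD; apply: gRM => //; elim: (m i) => [|q IHq].
  by rewrite expr0 -(scale1r 1); apply: gr_alg.
by rewrite exprS -addn1 addnC PoszD; apply: gRM.
Qed.

Lemma gproj_pres (hg' : is_grading gR) t p : gproj hg' t (pres_map z p) = pres_map z (mhom t p).
Proof.
pose f := gproj hg' t \o pres_map z; pose g := pres_map z \o mhom t.
apply: (mpoly_additive_eq (f := f) (g := g)) => c m; rewrite /f /g /=.
rewrite mhomZ mhomX pres_mapZ.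
have h : gR (mdeg m) (c *: pres_map z 'X_[m]).
  by apply: gr_scale; apply: gr_pres_mapX.
case: eqP => [<-|/eqP ne]; first by rewrite pres_mapZ; apply: gproj_id.
by rewrite scaler0 raddf0; apply: (gproj_neq hg' h); rewrite eq_sym.
Qed.

Lemma gr_lift t x : is_presentation gR z -> gR t x ->
  exists2 p, mpoly_deg t p & pres_map z p = x.
Proof.
move=> [_ /(_ x) [p <-]] h; exists (mhom t p); first exact: mhom_deg.
by rewrite -(gproj_pres hg) gproj_id.
Qed.

End GradedPres.

Lemma gen_by_sum (k : fieldType) (R : comAlgType k) (d : nat) (y : 'I_d -> R) x :
  gen_by y x -> exists r : 'I_d -> R, x = \sum_i y i * r i.
Proof.
move=> /(_ (fun x => exists r : 'I_d -> R, x = \sum_i y i * r i)); apply.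
  split=> [|u v [r ->] [r' ->]|c u [r ->]].
  - by exists (fun=> 0); rewrite big1 // => i _; rewrite mulr0.
  - by exists (fun i => r i + r' i); rewrite -big_split; apply: eq_bigr => i _;
      rewrite mulrDr.
  - exists (fun i => c * r i); rewrite /GRing.scale /= mulr_sumr.
    by apply: eq_bigr => i _; rewrite mulrCA.
move=> _ [i ->]; exists (fun j => (j == i)%:R).
by rewrite (bigD1 i) //= eqxx mulr1 big1 ?addr0 // => j /negbTE ->; rewrite mulr0.
Qed.

(** Indexing by all of [nat] lets the Koszul complex of an initial segment of [y]
    be defined by recursion on its length. *)
Definition extend0 (R : zmodType) (d : nat) (y : 'I_d -> R) (i : nat) : R :=
  oapp y 0 (insub i).

Lemma extend0_ord (R : zmodType) (d : nat) (y : 'I_d -> R) (i : 'I_d) :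
  extend0 y i = y i.
Proof. by rewrite /extend0 valK. Qed.

Lemma gen_by_below (k : fieldType) (R : comAlgType k) (d : nat) (y : 'I_d -> R) x :
  gen_by y x <-> below (extend0 y) d x.
Proof.
split=> h N hN hX; apply: h => // u [i].
- by move=> ->; apply: hX; exists i; rewrite ?extend0_ord.
- by move=> lt ->; apply: hX; exists (Ordinal lt); rewrite -extend0_ord.
Qed.

Section Free.
Variables (k : fieldType) (R : comAlgType k) (gR : int -> R -> Prop).
Hypothesis hR : standard_graded gR.
Variables (d : nat) (y : 'I_d -> R).

Let hg : is_grading gR. Proof. by case: hR. Qed.
Let gRM : forall i j x z, gR i x -> gR j z -> gR (i + j) (x * z).
Proof. by case: hR. Qed.
Let gR_neg : forall (i : int) x, i < 0 -> gR i x -> x = 0.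
Proof. by case: hR. Qed.

(** A regular sequence of length [d] inside the maximal ideal is nilpotent modulo
    the [d] parameters, so [koszul_vanish] makes their Koszul complex acyclic
    below the top degree, and the graded Nakayama argument of
    [koszul_acyclic_pred] turns this into regularity. *)
Lemma sop_regular : cohen_macaulay gR -> linear_sop gR y ->
  forall c x, (c < d)%N -> below (extend0 y) c (extend0 y c * x) ->
    below (extend0 y) c x.
Proof.
move=> [e [[he1 he2] [[s [[hreg _] sm se] _]]]] [[hd1 hd2] y1 hrad] c x ltc.
have ed : e = d.
  apply/eqP; rewrite eqn_leq; apply/andP; split.
    by case: he1 => P; apply: hd2.
  by case: hd1 => P; apply: he2.
have {}se : size s = d by rewrite se.
apply: koszul_regular.
apply: (koszul_acyclic_le hg (y := extend0 y) gRM gR_neg _ ltc).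
  by move=> i; rewrite /extend0; case: insubP => [j _ _|_] /=; [apply: y1 | apply: gr0 hg _].
move=> i u lti du cu.
have h0 w : ideal_gen (fun x : R => x \in take 0 s) w -> w = 0.
  move=> /(_ (fun w => w = 0)); apply; last by rewrite take0.
  by split=> [|_ _ -> ->|r _ ->] //; rewrite ?addr0 ?scaler0.
have k0 l (w : koszul R l) : kin (ideal_gen (fun x : R => x \in take 0 s)) w -> w = 0.
  by elim: l w => [|l IH] w /=; [apply: h0 | case: w => a b /= [/IH -> /IH ->]].
have [|||||| v dv hv] := @koszul_vanish R (extend0 y) d s _ _ 0%N i u.
- by move=> b ltb z; apply: hreg.
- move=> z zs; have [M hM] := (hrad z).2 (sm z zs); exists M.
  by apply/gen_by_below.
- by [].
- by rewrite se subr0.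
- by [].
- by rewrite cu; apply: kin0; apply: gen_submodule.
by exists v => //; apply: subr0_eq; apply: k0.
Qed.

Hypothesis y1 : forall i, gR 1 (y i).
Local Notation J := (gen_by y).
Local Notation evA := (pres_map y).

Let hJ : is_ideal J. Proof. exact: gen_submodule. Qed.
Let JD u v : J u -> J v -> J (u + v). Proof. by case: hJ => _ h _; apply: h. Qed.
Let JM r u : J u -> J (r * u). Proof. by case: hJ => _ _ h; apply: h. Qed.
Let JZ (c : k) u : J u -> J (c *: u).
Proof. by move=> h; rewrite -[u]mul1r scalerAl; apply: JM. Qed.
Let JB u v : J u -> J v -> J (u - v).
Proof. by move=> hu hv; rewrite -mulN1r; apply: JD => //; apply: JM. Qed.
Let J0 : J 0. Proof. by case: hJ. Qed.
Let Jsum (I : Type) (r : seq I) (P : pred I) (F : I -> R) :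
  (forall i, P i -> J (F i)) -> J (\sum_(i <- r | P i) F i).
Proof. by move=> h; elim/big_ind: _. Qed.

Lemma evA_mod (p : {mpoly k[d]}) : J (evA p - (p@_0)%:A).
Proof.
rewrite [in evA p](mpolyE p) raddf_sum /=.
have -> : \sum_(m <- msupp p) evA (p@_m *: 'X_[m]) - (p@_0)%:A =
    \sum_(m <- msupp p | m != 0%MM) evA (p@_m *: 'X_[m]).
  apply/eqP; rewrite subr_eq addrC; apply/eqP.
  case: (boolP (0%MM \in msupp p)) => h0.
    rewrite (bigD1_seq 0%MM) ?msupp_uniq //=; congr (_ + _).
    by rewrite mpolyX0 pres_mapZ rmorph1.
  rewrite (memN_msupp_eq0 h0) scale0r add0r [in RHS]big_seq_cond [LHS]big_seq.
  by apply: eq_bigl => m; case: eqVneq => [->|_]; rewrite ?(negbTE h0) ?andbT.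
apply: Jsum => m ne; rewrite pres_mapZ; apply: JZ.
have [i hi] : exists i, m i != 0%N.
  apply/existsP; apply: contra_neqT ne; rewrite negb_exists => /forallP h.
  by apply/mnmP => i; rewrite mnm0E; apply/eqP; have := h i; rewrite negbK.
rewrite (pres_mapXU _ hi) mulrC; apply: JM.
by apply: gen_incl; exists i.
Qed.

(** The argument that a regular sequence is quasi-regular: a relation is divided
    by one parameter at a time. *)
Lemma regular_independent (s : nat) (e : 'I_s -> R) :
  (forall c x, (c < d)%N -> below (extend0 y) c (extend0 y c * x) ->
    below (extend0 y) c x) ->
  (forall c : 'I_s -> k, J (\sum_l c l *: e l) -> forall l, c l = 0) ->
  forall a : 'I_s -> {mpoly k[d]}, \sum_l evA (a l) * e l = 0 ->
  forall l, a l = 0.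
Proof.
move=> hreg hind.
set I := below (extend0 y) in hreg *.
have hI c : is_ideal (I c) by apply: gen_submodule.
have ID c u v : I c u -> I c v -> I c (u + v) by case: (hI c) => _ h _; apply: h.
have IB c u v : I c u -> I c v -> I c (u - v).
  by move=> hu hv; apply: (@submoduleB R R^o (I c) u v (hI c)).
have IM c r u : I c u -> I c (r * u) by case: (hI c) => _ _ h; apply: h.
have IZ c (b : k) u : I c u -> I c (b *: u).
  by move=> h; rewrite -[u]mul1r scalerAl; apply: IM.
have Isum c (F : 'I_s -> R) : (forall i, I c (F i)) -> I c (\sum_i F i).
  by move=> h; apply: (@submodule_sum R R^o (I c) _ _ _ F (hI c)).
have Isums c (r : seq 'X_{1..d}) (P : pred 'X_{1..d}) (F : 'X_{1..d} -> R) :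
    (forall i, P i -> I c (F i)) -> I c (\sum_(i <- r | P i) F i).
  by move=> h; apply: (@submodule_sum R R^o (I c) _ _ _ F (hI c)).
(* Every monomial of a relation modulo the first c parameters involves one
   of these parameters; for c = 0 no monomial is left. *)
pose hits c (m : 'X_{1..d}) := [exists i : 'I_d, (i < c)%N && (m i != 0%N)].
have claim (w : nat) c (a : 'I_s -> {mpoly k[d]}) : (c + w)%N = d ->
    I c (\sum_l evA (a l) * e l) ->
    forall l m, m \in msupp (a l) -> hits c m.
  (* Induction on the number w of the remaining parameters; the inner induction
     on the degree divides a relation by the parameter number c. *)
  elim: w c a => [|w IH] c a ed.
    rewrite addn0 in ed; subst c => /gen_by_below h l m.
    have {}h : J (\sum_l (a l)@_0 *: e l).
      have -> : \sum_l (a l)@_0 *: e l =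
          \sum_l evA (a l) * e l - \sum_l (evA (a l) - ((a l)@_0)%:A) * e l.
        by rewrite -sumrB; apply: eq_bigr => j _; rewrite mulrBl subKr -scalerAl mul1r.
      apply: (JB h); apply: Jsum => j _.
      by rewrite mulrC; apply: JM; apply: evA_mod.
    have a0 := hind _ h l; rewrite mcoeff_msupp => hm.
    have /eqP ne : m != 0%MM by apply: contraNneq hm => ->; apply/eqP.
    apply/existsP; apply: contrapT => /forallNP hn; apply: ne; apply/mnmP => i.
    by rewrite mnm0E; apply/eqP; have := hn i; rewrite ltn_ord /= => /negP; rewrite negbK.
  have ltc : (c < d)%N by rewrite -ed addnS ltnS leq_addr.
  pose ic := Ordinal ltc.
  have yc : extend0 y c = y ic by rewrite -extend0_ord.
  have [N hN] : exists N, forall l, (msize (a l) <= N)%N.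
    by exists (\max_l msize (a l)) => l; apply: leq_bigmax.
  elim: N a hN => [|N IHN] a hN ha l m hm.
    by have := msize_mdeg_lt hm; have := hN l; case: (msize _).
  have sub : forall j m, m \in msupp (a j) -> ~~ hits c m -> m ic != 0%N.
    have hs : I c.+1 (\sum_l evA (a l) * e l).
      move: ha => /(_ (I c.+1)); apply; first exact: hI.
      move=> _ [i lt ->].
      by apply: gen_incl; exists i => //; rewrite ltnS ltnW.
    have h1 := IH c.+1 a; rewrite addSnnS in h1; have {}h1 := h1 ed hs.
    move=> j m' /h1 /existsP[i /andP[+ mi]]; rewrite ltnS leq_eqVlt.
    case/orP => [/eqP ei _|lti]; last by move=> /existsPn /(_ i); rewrite lti mi.
    by have <- : i = ic by apply: val_inj.
  pose b j := \sum_(m <- msupp (a j) | ~~ hits c m) (a j)@_m *: 'X_[m - U_(ic)].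
  have eb j : I c (evA (a j) - y ic * evA (b j)).
    rewrite [X in evA X](mpolyE (a j)) raddf_sum /= (bigID (hits c)) /=.
    have -> : \sum_(m <- msupp (a j) | ~~ hits c m) evA ((a j)@_m *: 'X_[m]) =
        y ic * evA (b j).
      rewrite raddf_sum mulr_sumr [LHS]big_seq_cond [RHS]big_seq_cond.
      apply: eq_bigr => m' /andP[hm' nh] /=.
      by rewrite !pres_mapZ (pres_mapXU _ (sub _ _ hm' nh)) -scalerAr.
    rewrite addrK; apply: Isums => m' /existsP[i /andP[lti mi]].
    rewrite pres_mapZ (pres_mapXU _ mi) mulrC; apply: IZ; apply: IM.
    by apply: gen_incl; exists i => //; rewrite extend0_ord.
  have sb j : (msize (b j) <= N)%N.
    apply: leq_trans (msize_sum _ _ _) _; apply/bigmax_leqP_seq => m' hm' nh.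
    apply: leq_trans (msizeZ_le _ _) _; rewrite msizeX.
    have := leq_trans (msize_mdeg_lt hm') (hN j); rewrite ltnS; apply: leq_trans.
    have := sub _ _ hm' nh; rewrite -lep1mP => /submK {2}<-.
    by rewrite mdegD mdeg1 addn1.
  have hb : I c (\sum_j evA (b j) * e j).
    apply: hreg => //; rewrite yc mulr_sumr.
    have -> : \sum_j y ic * (evA (b j) * e j) = \sum_j evA (a j) * e j -
        \sum_j (evA (a j) - y ic * evA (b j)) * e j.
      by rewrite -sumrB; apply: eq_bigr => j _; rewrite mulrBl subKr mulrA.
    by apply: IB => //; apply: Isum => j; rewrite mulrC; apply: IM.
  apply: contrapT => /negP nh.
  have lem m' : m' \in msupp (a l) -> ~~ hits c m' -> (U_(ic) <= m')%MM.
    by move=> h1 h2; rewrite lep1mP; apply: sub h1 h2.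
  have : (m - U_(ic))%MM \in msupp (b l).
    have hf : m \in [seq i <- msupp (a l) | ~~ hits c i].
      by rewrite mem_filter hm andbT.
    rewrite mcoeff_msupp raddf_sum /= -big_filter (bigD1_seq m) ?filter_uniq
      ?msupp_uniq //=.
    rewrite mcoeffZ mcoeffX eqxx mulr1 big_seq_cond big1 ?addr0 -?mcoeff_msupp //.
    move=> m' /andP[]; rewrite mem_filter => /andP[nh' hm'] ne.
    rewrite mcoeffZ mcoeffX; case: eqP => [E|_]; last by rewrite mulr0.
    case/eqP: ne; rewrite -(submK (lem _ hm' nh')) E submK //.
    exact: lem.
  move=> /(IHN b sb hb) /existsP[i /andP[lti]]; rewrite mnmBE => hi.
  by case/negP: nh; apply/existsP; exists i; rewrite lti; case: (m i) hi; rewrite ?sub0n.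
move=> a ha l; apply/eqP; rewrite -msupp_eq0; apply/eqP.
case E : (msupp (a l)) => [|m r] //.
have : hits 0%N m; last by case/existsP.
have h0 : I 0%N (\sum_l evA (a l) * e l) by rewrite ha; case: (hI 0%N).
by apply: (claim d 0%N a (add0n d) h0 l); rewrite E mem_head.
Qed.

Definition jspan (es : seq R) (x : R) : Prop :=
  exists c : nat -> k, J (x - \sum_(l < size es) c l *: es`_l).

Lemma jspanD es u v : jspan es u -> jspan es v -> jspan es (u + v).
Proof.
move=> [c hc] [c' hc']; exists (fun l => c l + c' l).
have -> : \sum_(l < size es) (c l + c' l) *: es`_l =
    \sum_(l < size es) c l *: es`_l + \sum_(l < size es) c' l *: es`_l.
  by rewrite -big_split; apply: eq_bigr => l _; rewrite scalerDl.
by rewrite opprD addrACA; apply: JD.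
Qed.

Lemma jspanZ es (b : k) u : jspan es u -> jspan es (b *: u).
Proof.
move=> [c hc]; exists (fun l => b * c l).
have -> : \sum_(l < size es) (b * c l) *: es`_l = b *: \sum_(l < size es) c l *: es`_l.
  by rewrite scaler_sumr; apply: eq_bigr => l _; rewrite scalerA.
by rewrite -scalerBr; apply: JZ.
Qed.

Lemma jspanJ es u : J u -> jspan es u.
Proof.
by move=> h; exists (fun=> 0); rewrite big1 ?subr0 // => l _; rewrite scale0r.
Qed.

Definition jfree (es : seq R) : Prop := forall c : nat -> k,
  J (\sum_(l < size es) c l *: es`_l) -> forall l, (l < size es)%N -> c l = 0.

Lemma jbasis (E : seq R) : exists es : seq R,
  [/\ {subset es <= E}, jfree es & forall x, x \in E -> jspan es x].
Proof.
elim: E => [|x E [es [sub ind sp]]]; first by exists [::]; split=> // c _ [].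
case: (pselect (jspan es x)) => [hx | nx].
  exists es; split=> // [z /sub|z].
    by rewrite in_cons => ->; rewrite orbT.
  by rewrite in_cons => /orP[/eqP->|/sp].
have sumE (c : nat -> k) :
    \sum_(l < size (rcons es x)) c l *: (rcons es x)`_l =
    \sum_(l < size es) c l *: es`_l + c (size es) *: x.
  rewrite size_rcons big_ord_recr /= nth_rcons ltnn eqxx; congr (_ + _).
  by apply: eq_bigr => l _; rewrite nth_rcons ltn_ord.
exists (rcons es x); split.
- move=> z; rewrite mem_rcons !in_cons => /orP[->//|/sub ->]; by rewrite orbT.
- move=> c; rewrite sumE => hc.
  case: (eqVneq (c (size es)) 0) => [c0|cn].
    rewrite c0 scale0r addr0 in hc => l.
    by rewrite size_rcons ltnS leq_eqVlt => /orP[/eqP ->|/(ind _ hc)].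
  case: nx; exists (fun l => - ((c (size es))^-1 * c l)).
  have -> : x - \sum_(l < size es) - ((c (size es))^-1 * c l) *: es`_l =
      (c (size es))^-1 *: (\sum_(l < size es) c l *: es`_l + c (size es) *: x).
    rewrite scalerDr scalerA mulVf // scale1r addrC scaler_sumr -sumrN.
    by congr (_ + _); apply: eq_bigr => l _; rewrite scaleNr opprK scalerA.
  exact: JZ.
- move=> z; rewrite in_cons => /orP[/eqP ->|/sp [c hc]].
    exists (fun l => (l == size es)%:R).
    rewrite (sumE (fun l => (l == size es)%:R)) eqxx scale1r big1 ?add0r ?subrr //.
    by move=> l _; rewrite ltn_eqF ?scale0r.
  exists (fun l => if l == size es then 0 else c l).
  rewrite (sumE (fun l => if l == size es then 0 else c l)) eqxx scale0r addr0.
  rewrite (eq_bigr (fun l : 'I_(size es) => c l *: es`_l)) // => l _.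
  by rewrite ltn_eqF.
Qed.

Variables (n : nat) (z : 'I_n -> R).
Hypothesis hz : is_presentation gR z.
Hypothesis hnil : forall i, exists M : nat, J (z i ^+ M).

(** Since a power of each generator lies in the ideal of the parameters, the
    finitely many monomials with small exponents span modulo that ideal. *)
Lemma jspan_monomials : exists E : seq R,
  (forall x, x \in E -> exists i, gR i x) /\
  forall es, (forall x, x \in E -> jspan es x) -> forall x, jspan es x.
Proof.
have [M hM] : exists M : nat, forall i, J (z i ^+ M).
  have [M hM] := choice hnil; exists (\max_i M i) => i.
  by rewrite -(subnK (leq_bigmax i)) exprD; apply: JM.
pose mon (f : {ffun 'I_n -> 'I_M}) := pres_map z 'X_[[multinom (f i : nat) | i < n]].
exists [seq mon f | f <- enum {: {ffun 'I_n -> 'I_M}}]; split.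
  move=> _ /mapP[f _ ->]; rewrite /mon; exists (mdeg [multinom (f i : nat) | i < n]).
  by apply: (gr_pres_mapX hR); case: hz.
move=> es hes x; have [p <-] := hz.2 x.
rewrite (mpolyE p) raddf_sum; elim/big_ind: _ => [||m _].
- by apply: jspanJ.
- exact: jspanD.
rewrite /= pres_mapZ; apply: jspanZ.
case: (boolP [forall i, m i < M]%N) => [/forallP h|].
  apply: hes; apply/mapP; exists [ffun i => Ordinal (h i)]; first by rewrite mem_enum.
  by congr pres_map; congr mpolyX; apply/mnmP => i; rewrite mnmE ffunE.
rewrite negb_forall => /existsP[i]; rewrite -leqNgt => hi.
apply: jspanJ; rewrite pres_mapX (bigD1 i) //= -(subnK hi) exprD mulrC mulrA.
exact: JM.
Qed.

(** Homogeneous lifts of a basis modulo the parameters span by graded Nakayama, and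
    they are independent because the parameters form a regular sequence. *)
Lemma free_basis :
  (forall c x, (c < d)%N -> below (extend0 y) c (extend0 y c * x) ->
    below (extend0 y) c x) ->
  exists (s : nat) (e : 'I_s -> R) (b : 'I_s -> int),
    [/\ forall l, gR (b l) (e l),
        forall r, exists a : 'I_s -> {mpoly k[d]}, r = \sum_l evA (a l) * e l
      & forall a : 'I_s -> {mpoly k[d]}, \sum_l evA (a l) * e l = 0 ->
          forall l, a l = 0].
Proof.
move=> hreg; have [E [hE spE]] := jspan_monomials.
have [es [sub ind sp]] := jbasis E.
have {spE sp} spR := spE es sp.
pose s := size es; pose e (l : 'I_s) := es`_l.
have he l : exists i, gR i (e l) by apply: hE; apply: sub; apply: mem_nth.
have [b hb] := choice he.
exists s, e, b; split=> //; last first.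
  apply: regular_independent => // c hc l.
  have := ind (fun i => oapp c 0 (insub i)); rewrite -/s => h.
  have /(_ _ l (ltn_ord l)) := h; rewrite valK; apply.
  by rewrite (eq_bigr (fun l => c l *: e l)) // => i _; rewrite valK.
have hom (q : nat) t x : t < q%:Z -> gR t x ->
    exists a : 'I_s -> {mpoly k[d]}, x = \sum_l evA (a l) * e l.
  elim: q t x => [|q IH] t x ltt gx.
    exists (fun=> 0); rewrite (gR_neg ltt gx) big1 // => l _.
    by rewrite raddf0 mul0r.
  have [c /gen_by_sum [r hr]] := spR x.
  have IH' i : exists a : 'I_s -> {mpoly k[d]},
      gproj hg (t - 1) (r i) = \sum_l evA (a l) * e l.
    by apply: IH (gproj_mem _ _ _); lia.
  have [a ha] := choice IH'.
  exists (fun l => (if b l == t then c l else 0)%:MP + \sum_i 'X_i * a i l).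
  have E' : x = \sum_(l < s) c l *: e l + \sum_i y i * r i.
    by rewrite -hr addrC subrK.
  rewrite -[LHS](gproj_id hg gx) {1}E' raddfD /= !raddf_sum.
  transitivity (\sum_l (if b l == t then c l else 0) *: e l +
      \sum_i y i * gproj hg (t - 1) (r i)).
    congr (_ + _); apply: eq_bigr => l _ /=.
      have gc : gR (b l) (c l *: e l) by apply: gr_scale (hb l).
      case: eqP => [<-|/eqP ne]; first exact: gproj_id.
      by rewrite scale0r; apply: (gproj_neq hg gc); rewrite eq_sym.
    have -> : t = 1 + (t - 1) by rewrite addrC subrK.
    rewrite (@gproj_act R R gR gR hg hg 1 (fun x => y l * x)) => [|u v|j u].
    - by rewrite [1 + _]addrC addrK.
    - exact: mulrDr.
    - exact: gRM.
  under [RHS]eq_bigr => l _ do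
    rewrite rmorphD /= pres_mapC mulrDl -scalerAl mul1r raddf_sum /= mulr_suml.
  rewrite big_split /=; congr (_ + _); rewrite exchange_big /=.
  apply: eq_bigr => i _; rewrite ha mulr_sumr; apply: eq_bigr => l _.
  by rewrite rmorphM /= pres_mapU mulrA.
move=> r; have [S _ ->] := gproj_sum hg r.
elim: S => [|t S [a IH]].
  by exists (fun=> 0); rewrite big_nil big1 // => l _; rewrite raddf0 mul0r.
have [|a' ha'] := hom `|t|.+1 t (gproj hg t r) _ (gproj_mem _ _ _); first by lia.
exists (fun l => a' l + a l); rewrite big_cons IH ha' -big_split.
by apply: eq_bigr => l _; rewrite raddfD mulrDl.
Qed.

End Free.
(** * Linear changes of coordinates of the presentation *)

Section LinearSubst.
Variables (k : fieldType) (n : nat).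

Definition lsub (P : 'M[k]_n) (p : {mpoly k[n]}) : {mpoly k[n]} :=
  p \mPo [tuple \sum_j P i j *: 'X_j | i < n].

HB.instance Definition _ P := GRing.RMorphism.copy (lsub P)
  (@comp_mpoly n k n [tuple \sum_j P i j *: 'X_j | i < n]).

Lemma lsubX P i : lsub P 'X_i = \sum_j P i j *: 'X_j.
Proof. by rewrite /lsub comp_mpolyXU -tnth_nth tnth_mktuple. Qed.

Lemma lsubC P c : lsub P c%:MP = c%:MP.
Proof. exact: comp_mpolyC. Qed.

Lemma lsubZ P c p : lsub P (c *: p) = c *: lsub P p.
Proof. exact: comp_mpolyZ. Qed.

(** Invertible matrices give automorphisms, contravariantly in the matrix. *)
Lemma lsubK P Q : Q *m P = 1%:M -> cancel (lsub Q) (lsub P).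
Proof.
move=> h p; apply: (mpoly_rmorph_eq (f := lsub P \o lsub Q) (g := idfun)) => /= [c|i].
  by rewrite !lsubC.
rewrite lsubX raddf_sum /=.
under eq_bigr => j _ do rewrite lsubZ lsubX scaler_sumr.
rewrite exchange_big /= (eq_bigr (fun l => (i == l)%:R *: 'X_l)) => [|l _].
  rewrite (bigD1 i) //= eqxx scale1r big1 ?addr0 // => l.
  by rewrite eq_sym => /negbTE ->; rewrite scale0r.
under eq_bigr => j _ do rewrite scalerA.
by rewrite -scaler_suml; have /matrixP/(_ i l) := h; rewrite !mxE => ->.
Qed.

Lemma lsub_deg P t p : mpoly_deg t p -> mpoly_deg t (lsub P p).
Proof.
move=> h; rewrite (mpolyE p) raddf_sum /= big_seq.
apply: mpoly_deg_sum => m hm; rewrite lsubZ; apply: mpoly_degZ.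
have <- : (mdeg m)%:Z = t by apply: mpoly_deg_coef h _; rewrite -mcoeff_msupp.
rewrite /lsub comp_mpolyX mdegE; elim/big_rec2: _ => [|i a b _ IH].
  by rewrite /=; apply: dhomog1.
rewrite PoszD; apply: mpoly_degM => //; rewrite tnth_mktuple /=.
have hlin : \sum_j P i j *: 'X_j \is [in k[n], 1.-homog].
  by apply: rpred_sum => j _; apply: rpredZ; rewrite dhomogX /= mdeg1.
by have := dhomogMn (m i) hlin; rewrite mul1n.
Qed.

End LinearSubst.

Section Coordinates.
Variables (k : fieldType) (R : comAlgType k) (gR : int -> R -> Prop).
Hypothesis hR : standard_graded gR.

Section Transport.
Variables (n : nat) (z0 z : 'I_n -> R) (P Q : 'M[k]_n).
Hypothesis PQ : P *m Q = 1%:M.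
Hypothesis QP : Q *m P = 1%:M.
Hypothesis zE : forall i, z i = \sum_j P i j *: z0 j.

Lemma pres_map_lsub p : pres_map z p = pres_map z0 (lsub P p).
Proof.
apply: (mpoly_rmorph_eq (f := pres_map z) (g := pres_map z0 \o lsub P)) => /= [c|i].
  by rewrite lsubC !pres_mapC.
rewrite pres_mapU zE lsubX raddf_sum; apply: eq_bigr => j _ /=.
by rewrite pres_mapZ pres_mapU.
Qed.

Lemma lsubPK p : lsub P (lsub Q p) = p. Proof. exact: lsubK. Qed.
Lemma lsubQK p : lsub Q (lsub P p) = p. Proof. exact: lsubK. Qed.
Lemma map_lsubPK a b (M : 'M_(a, b)) : map_mx (lsub P) (map_mx (lsub Q) M) = M.
Proof. by apply/matrixP => i j; rewrite !mxE lsubPK. Qed.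
Lemma map_lsubQK a b (M : 'M_(a, b)) : map_mx (lsub Q) (map_mx (lsub P) M) = M.
Proof. by apply/matrixP => i j; rewrite !mxE lsubQK. Qed.

Lemma pres_map_lsubQ p : pres_map z (lsub Q p) = pres_map z0 p.
Proof. by rewrite pres_map_lsub lsubPK. Qed.

Lemma transport_presentation : is_presentation gR z0 -> is_presentation gR z.
Proof.
move=> [h1 h2]; split=> [i|r].
  rewrite zE; have hg : is_grading gR by case: hR.
  by apply: (gr_sum hg) => j _; apply: (gr_scale hR).
by have [p <-] := h2 r; exists (lsub Q p); rewrite pres_map_lsubQ.
Qed.

Variable F : graded_resolution gR z0.

Definition transport_resolution : graded_resolution gR z.
refine (@GradedResolution k R gR n z (res_rank F) (@res_deg _ _ _ _ _ F)
  (fun i => map_mx (lsub Q) (res_dif F i)) (@res_aug _ _ _ _ _ F) _ _ _ _ _).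
- by move=> i a b; rewrite mxE; apply: lsub_deg; apply: res_dif_deg.
- exact: res_aug_deg.
- move=> r; have [v ->] := res_aug_surj F r; exists (map_mx (lsub Q) v).
  by apply: eq_bigr => a _; rewrite mxE pres_map_lsubQ.
- move=> v.
  have -> : \sum_a pres_map z (v 0 a) * @res_aug k R gR n z0 F a =
      \sum_a pres_map z0 ((map_mx (lsub P) v) 0 a) * @res_aug k R gR n z0 F a.
    by apply: eq_bigr => a _; rewrite mxE pres_map_lsub.
  split=> [/res_exact0 [w hw]|[w hw]].
    exists (map_mx (lsub Q) w); rewrite -map_mxM -hw map_lsubQK //.
  by apply/res_exact0; exists (map_mx (lsub P) w); rewrite hw map_mxM map_lsubPK.
- move=> i v; split=> [h|[w ->]].
    have : map_mx (lsub P) v *m res_dif F i = 0.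
      by rewrite -[res_dif F i]map_lsubPK -map_mxM h map_mx0.
    case/res_exact => w hw; exists (map_mx (lsub Q) w).
    by rewrite -map_mxM -hw map_lsubQK.
  have /res_exact h : exists w', map_mx (lsub P) w *m res_dif F i.+1 = w' *m res_dif F i.+1.
    by exists (map_mx (lsub P) w).
  by rewrite -[w]map_lsubQK -!map_mxM h map_mx0.
Defined.

(** The automorphism acts on cochains as well, so the cohomology in the new
    coordinates is the old one read through [lsub P]. *)
Lemma transport_ext_iso g (M : lmodType R) (gM : int -> M -> Prop)
    (Theta : 'cV[{mpoly k[n]}]_(res_rank F g) -> M) :
  ext_iso gM Theta ->
  @ext_iso k R gR n z transport_resolution g M gM
    (fun u => Theta (map_mx (lsub P) u)).
Proof.
have coc u : ext_cocycle (F := transport_resolution) u <->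
    ext_cocycle (F := F) (i := g) (map_mx (lsub P) u).
  rewrite /ext_cocycle /=; split=> h.
    by rewrite -[res_dif F g]map_lsubPK -map_mxM h map_mx0.
  by rewrite -[u]map_lsubQK -map_mxM h map_mx0.
move=> [h1 h2 h3 h4]; split.
- move=> p u v /coc hu /coc hv; rewrite pres_map_lsub -h1 //; congr Theta.
  by apply/matrixP => i j; rewrite !mxE rmorphD rmorphM.
- move=> u /coc hu; rewrite h2 //.
  case: (g) u {h1 h2 h3 h4 coc hu} => [|g'] u /=; split.
  + by move=> h; rewrite -[u]map_lsubQK h map_mx0.
  + by move=> ->; rewrite map_mx0.
  + case=> w h; exists (map_mx (lsub Q) w).
    by rewrite -map_mxM -h map_lsubQK.
  + by case=> w ->; exists (map_mx (lsub P) w); rewrite map_mxM map_lsubPK.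
- move=> w; have [u [hu <-]] := h3 w; exists (map_mx (lsub Q) u).
  by split; [apply/coc; rewrite map_lsubPK | rewrite map_lsubPK].
- move=> t w; rewrite h4; split=> -[u [hu du <-]].
    exists (map_mx (lsub Q) u); split; last by rewrite map_lsubPK.
      by apply/coc; rewrite map_lsubPK.
    by move=> a; rewrite mxE; apply: lsub_deg; apply: du.
  exists (map_mx (lsub P) u); split=> //; first exact/coc.
  by move=> a; rewrite mxE; apply: lsub_deg; apply: du.
Qed.

End Transport.

(** Independent linear forms are the first coordinates of some presentation,
    so the canonical module can be computed in such coordinates. *)
Lemma canonical_coordinates (d : nat) (y : 'I_d -> R)
    (M : lmodType R) (gM : int -> M -> Prop) :
  (forall i, gR 1 (y i)) ->
  (forall c : 'I_d -> k, \sum_i c i *: y i = 0 -> forall i, c i = 0) ->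
  is_canonical_module gR gM ->
  exists (m : nat) (z : 'I_(d + m) -> R) (g : nat) (F : graded_resolution gR z)
    (Theta : 'cV[{mpoly k[d + m]}]_(res_rank F g) -> M),
    [/\ is_presentation gR z, forall i, z (lshift m i) = y i & ext_iso gM Theta].
Proof.
move=> y1 yfree [_ [n [z0 [g [F [Theta [hz _ hT]]]]]]].
have hL i : exists L : 'rV[k]_n, y i = \sum_j L 0 j *: z0 j.
  have [p hp <-] := gr_lift hR hz.1 hz (y1 i).
  rewrite /= in hp.
  exists (\row_j p@_U_(j)).
  have pE : p = \sum_j p@_U_(j) *: 'X_j.
    apply/mpolyP => m; rewrite raddf_sum /=.
    case: (boolP (mdeg m == 1%N)) => [/mdeg1P[j /eqP ->]|ne].
      rewrite (bigD1 j) //= mcoeffZ mcoeffX eqxx mulr1 big1 ?addr0 // => l nl.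
      by rewrite mcoeffZ mcoeffX eq_mnm1 (negbTE nl) mulr0.
    rewrite (dhomog_nemf_coeff hp ne) big1 // => j _.
    rewrite mcoeffZ mcoeffX; case: eqP => [E|_]; last by rewrite mulr0.
    by rewrite -E mdeg1 in ne.
  rewrite {1}pE raddf_sum; apply: eq_bigr => j _ /=.
  by rewrite pres_mapZ pres_mapU mxE.
have [L hL'] := choice hL.
pose A := \matrix_(i < d, j < n) L i 0 j.
have rA : \rank A = d.
  apply/eqP; apply: inj_row_free => u hu; apply/rowP => i; rewrite mxE.
  apply: yfree i; under eq_bigr => i _ do rewrite hL' scaler_sumr.
  rewrite exchange_big big1 // => j _ /=.
  under eq_bigr => i _ do rewrite scalerA.
  rewrite -scaler_suml; have /rowP/(_ j) := hu; rewrite !mxE => E.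
  suff -> : \sum_l u 0 l * L l 0 j = 0 by rewrite scale0r.
  by rewrite -[RHS]E; apply: eq_bigr => l _; rewrite mxE.
have [m en] : exists m, n = (d + m)%N.
  by exists (n - d)%N; rewrite subnKC // -rA; apply: rank_leq_col.
subst n; pose U : 'M[k]_(d, d + m) := row_mx 1%:M 0.
have [|G Gu EG] := @complete_unitmx k d (d + m) U (col_mx A 0).
  by rewrite mul_row_col mul1mx mul0mx addr0 rA rank_row_mx0 mxrank1.
pose z i := \sum_j G i j *: z0 j.
have GV : G *m invmx G = 1%:M by apply: mulmxV.
have VG : invmx G *m G = 1%:M by apply: mulVmx.
exists m, z, g, (transport_resolution GV VG (z := z) (fun=> erefl) F).
exists (fun u => Theta (map_mx (lsub G) u)); split.
- exact: (transport_presentation VG (fun=> erefl) hz).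
- move=> i; rewrite /z hL'; apply: eq_bigr => j _; congr (_ *: _).
  rewrite -[G in RHS]vsubmxK !mul_row_col !mul1mx !mul0mx !addr0 in EG.
  by have /matrixP/(_ i j) := EG; rewrite !mxE.
- exact: transport_ext_iso.
Qed.

End Coordinates.

(** * Cohomology of a free complex with coefficients in a module *)

Section Cochains.
Variable S : comNzRingType.

(** A cochain with coefficients in [N] is the column of the values of a linear map
    on a basis; composition with a differential is the action of its matrix. *)
Definition mact (N : lmodType S) p q (M : 'M[S]_(p, q))
    (c : {ffun 'I_q -> N}) : {ffun 'I_p -> N} :=
  [ffun a => \sum_b M a b *: c b].

Definition mapc (N N' : lmodType S) (f : N -> N') q (c : {ffun 'I_q -> N}) :
    {ffun 'I_q -> N'} := [ffun a => f (c a)].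

Section OneModule.
Variable N : lmodType S.

Lemma mactP p q (M : 'M[S]_(p, q)) s (c c' : {ffun 'I_q -> N}) :
  mact M (s *: c + c') = s *: mact M c + mact M c'.
Proof.
apply/ffunP => a; rewrite !ffunE scaler_sumr -big_split /=.
by apply: eq_bigr => b _; rewrite !ffunE scalerDr !scalerA mulrC.
Qed.
HB.instance Definition _ p q M :=
  GRing.isLinear.Build S {ffun 'I_q -> N} {ffun 'I_p -> N} _ (@mact N p q M)
    (@mactP p q M).

Lemma mactM p q r (M : 'M[S]_(p, q)) (M' : 'M[S]_(q, r)) (c : {ffun 'I_r -> N}) :
  mact (M *m M') c = mact M (mact M' c).
Proof.
apply/ffunP => a; rewrite !ffunE.
under eq_bigr => b _ do rewrite mxE scaler_suml.
rewrite exchange_big; apply: eq_bigr => b _; rewrite ffunE scaler_sumr.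
by apply: eq_bigr => l _; rewrite scalerA.
Qed.

Lemma mactD p q (M M' : 'M[S]_(p, q)) (c : {ffun 'I_q -> N}) :
  mact (M + M') c = mact M c + mact M' c.
Proof.
apply/ffunP => a; rewrite !ffunE -big_split /=.
by apply: eq_bigr => b _; rewrite mxE scalerDl.
Qed.

Lemma mact_scalar p (s : S) (c : {ffun 'I_p -> N}) : mact s%:M c = s *: c.
Proof.
apply/ffunP => a; rewrite !ffunE (bigD1 a) //= mxE eqxx mulr1n big1 ?addr0 //.
by move=> b ne; rewrite mxE eq_sym (negbTE ne) mulr0n scale0r.
Qed.

End OneModule.

Lemma mapc_mact (N N' : lmodType S) (f : {linear N -> N'}) p q
    (M : 'M[S]_(p, q)) c : mapc f (mact M c) = mact M (mapc f c).
Proof.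
apply/ffunP => a; rewrite !ffunE raddf_sum; apply: eq_bigr => b _ /=.
by rewrite linearZ ffunE.
Qed.

Section Complex.
Variables (r : nat -> nat) (dif : forall i, 'M[S]_(r i.+1, r i)).

Definition cocycle (N : lmodType S) i (c : {ffun 'I_(r i) -> N}) : Prop :=
  mact (dif i) c = 0.

Definition coboundary (N : lmodType S) i : {ffun 'I_(r i) -> N} -> Prop :=
  match i with
  | 0 => fun c => c = 0
  | i'.+1 => fun c => exists b, c = mact (dif i') b
  end.

Hypothesis dif_exact : forall i (v : 'rV_(r i.+1)),
  v *m dif i = 0 <-> exists w, v = w *m dif i.+1.

Lemma dif_exact_mx i p (M : 'M_(p, r i.+1)) :
  M *m dif i = 0 -> exists H, M = H *m dif i.+1.
Proof.
move=> h.
have hrow a : exists w, row a M = w *m dif i.+1.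
  by apply/dif_exact; rewrite -row_mul h row0.
have [w hw] := choice hrow; exists (\matrix_a w a).
by apply/row_matrixP => a; rewrite row_mul rowK.
Qed.

Lemma difK i : dif i.+1 *m dif i = 0.
Proof.
apply/row_matrixP => a; rewrite row_mul row0; apply/dif_exact.
by exists (delta_mx 0 a); rewrite -rowE.
Qed.

Lemma coboundary_cocycle (N : lmodType S) i (c : {ffun 'I_(r i) -> N}) :
  coboundary c -> cocycle c.
Proof.
case: i c => [|i] c /=; first by move=> ->; rewrite /cocycle linear0.
case=> b ->; rewrite /cocycle -mactM difK.
by apply/ffunP => a; rewrite !ffunE big1 // => l _; rewrite mxE scale0r.
Qed.

Section NullHomotopy.
Variable f : S.
Hypothesis f_null : exists h : 'M_(r 0, r 1), f%:M = h *m dif 0.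

(** The homotopy equation, composed with [dif i]: in this form a homotopy can be
    chosen at each position from the one at the previous position. *)
Lemma null_homotopy i : exists h : 'M_(r i, r i.+1),
  dif i *m h *m dif i = f *: dif i.
Proof.
elim: i => [|i [h hh]].
  by have [h hh] := f_null; exists h; rewrite -mulmxA -hh mul_mx_scalar.
have [|h' hh'] := @dif_exact_mx i _ (f%:M - dif i *m h).
  by rewrite mulmxBl hh mul_scalar_mx subrr.
exists h'; rewrite -mulmxA -hh' mulmxBr mulmxA difK mul0mx subr0.
by rewrite mul_mx_scalar.
Qed.

(** Multiplication by [f] is zero on the resolved module, hence null-homotopic on
    the resolution. *)
Lemma null_coboundary (N : lmodType S) i (c : {ffun 'I_(r i) -> N}) :
  cocycle c -> coboundary (f *: c).
Proof.
case: i c => [|i] c hc /=.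
  by have [h hh] := f_null; rewrite -mact_scalar hh mactM hc linear0.
have [h hh] := null_homotopy i.
have [|h' hh'] := @dif_exact_mx i _ (f%:M - dif i *m h).
  by rewrite mulmxBl hh mul_scalar_mx subrr.
exists (mact h c); rewrite -mact_scalar -[f%:M](subrK (dif i *m h)).
by rewrite mactD hh' !mactM hc linear0 add0r.
Qed.

End NullHomotopy.
End Complex.
End Cochains.

Section GradedCohomology.
Variables (k : fieldType) (n : nat).
Local Notation S := {mpoly k[n]}.
Variables (r : nat -> nat) (dif : forall i, 'M[S]_(r i.+1, r i)).
Variable dg : forall i, 'I_(r i) -> int.
Hypothesis dif_exact : forall i (v : 'rV_(r i.+1)),
  v *m dif i = 0 <-> exists w, v = w *m dif i.+1.
Hypothesis dif_deg : forall i a b, mpoly_deg (dg a - dg b) (dif i a b).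

(** A compatible family of projections [pi e] onto the elements of degree [e]
    of a module whose elements may have infinitely many components. *)
Definition graded_proj (N : lmodType S) (pi : int -> N -> N) : Prop :=
  [/\ forall e u v, pi e (u + v) = pi e u + pi e v,
      forall e u, pi e (pi e u) = pi e u
    & forall q e p u, mpoly_deg q p -> p *: pi e u = pi (q + e) (p *: u)].

(** The twist by [n] is that of the dualizing module [S(- n)]. *)
Definition cproj (N : lmodType S) (pi : int -> N -> N) i t
    (c : {ffun 'I_(r i) -> N}) : {ffun 'I_(r i) -> N} :=
  [ffun a => pi (dg a + t - n%:Z) (c a)].

Definition chom (N : lmodType S) (pi : int -> N -> N) i t
    (c : {ffun 'I_(r i) -> N}) : Prop := cproj pi t c = c.

Section Proj.
Variables (N : lmodType S) (pi : int -> N -> N).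
Hypothesis hpi : graded_proj pi.

Lemma gp_sum e (I : Type) (s : seq I) (F : I -> N) :
  pi e (\sum_(x <- s) F x) = \sum_(x <- s) pi e (F x).
Proof.
have [piD _ _] := hpi; apply: (big_morph _ (piD e)).
by apply: (addrI (pi e 0)); rewrite -piD !addr0.
Qed.

Lemma cproj_mact i t (c : {ffun 'I_(r i) -> N}) :
  cproj pi t (mact (dif i) c) = mact (dif i) (cproj pi t c).
Proof.
apply/ffunP => a; rewrite !ffunE gp_sum; apply: eq_bigr => b _.
have [_ _ hZ] := hpi; rewrite ffunE (hZ (dg a - dg b)) //.
by congr pi; rewrite !addrA subrK.
Qed.

Lemma chom_proj i t (c : {ffun 'I_(r i) -> N}) : chom pi t (cproj pi t c).
Proof. by case: hpi => _ hK _; apply/ffunP => a; rewrite !ffunE hK. Qed.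

Lemma chomZ i t q p (c : {ffun 'I_(r i) -> N}) :
  mpoly_deg q p -> chom pi t c -> chom pi (q + t) (p *: c).
Proof.
have [_ _ hZ] := hpi; move=> hp hc; apply/ffunP => a; rewrite !ffunE.
have /ffunP/(_ a) := hc; rewrite ffunE => {2}<-.
by rewrite (hZ q) //; congr pi; rewrite -!addrA addrCA !addrA.
Qed.

End Proj.

(** [ext_corr T] says that the relation [T] induces, in each degree [t], an
    isomorphism between the cohomology in position [i] with coefficients in [N]
    and the cohomology in position [j] with coefficients in [N']; the relation
    commutes with homogeneous scalars. *)
Definition ext_corr (N N' : lmodType S) (pi : int -> N -> N)
    (pi' : int -> N' -> N') i j
    (T : int -> {ffun 'I_(r i) -> N} -> {ffun 'I_(r j) -> N'} -> Prop) : Prop :=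
  [/\ forall t c u, T t c u ->
        [/\ cocycle dif c, chom pi t c, cocycle dif u & chom pi' t u],
      forall t q p c u, mpoly_deg q p -> T t c u -> T (q + t) (p *: c) (p *: u),
      forall t c, cocycle dif c -> chom pi t c -> exists u, T t c u,
      forall t u, cocycle dif u -> chom pi' t u -> exists c, T t c u
    & forall t c u, T t c u -> (coboundary dif c <-> coboundary dif u)].

Lemma ext_corr_id (N : lmodType S) (pi : int -> N -> N) i :
  graded_proj pi ->
  ext_corr (i := i) (j := i) pi pi
    (fun t c u => [/\ c = u, cocycle dif c & chom pi t c]).
Proof.
move=> hpi; split.
- by move=> t c _ [<-].
- move=> t q p c _ hp [<- h1 h2]; split=> //; last exact: chomZ.
  by rewrite /cocycle linearZ /= h1 scaler0.
- by move=> t c h1 h2; exists c.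
- by move=> t c h1 h2; exists c.
- by move=> t c _ [<-].
Qed.

Lemma ext_corr_trans (N N' N'' : lmodType S) pi pi' pi'' i j l
    (T : int -> {ffun 'I_(r i) -> N} -> {ffun 'I_(r j) -> N'} -> Prop)
    (T' : int -> {ffun 'I_(r j) -> N'} -> {ffun 'I_(r l) -> N''} -> Prop) :
  ext_corr pi pi' T -> ext_corr pi' pi'' T' ->
  ext_corr pi pi'' (fun t c u => exists2 b, T t c b & T' t b u).
Proof.
move=> [a1 a2 a3 a4 a5] [b1 b2 b3 b4 b5]; split.
- by move=> t c u [b /a1[? ? _ _] /b1[]].
- move=> t q p c u hp [b h h']; exists (p *: b); first exact: a2.
  exact: b2.
- move=> t c hc h; have [b hb] := a3 t c hc h.
  have [_ _ zb db] := a1 _ _ _ hb; have [u hu] := b3 t b zb db.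
  by exists u, b.
- move=> t u hu h; have [b hb] := b4 t u hu h.
  have [zb db _ _] := b1 _ _ _ hb; have [c hc] := a4 t b zb db.
  by exists c, b.
- by move=> t c u [b /a5 h /b5 h']; rewrite h h'.
Qed.

Section Connecting.
Variables (N L N' : lmodType S).
Variables (io : {linear N -> L}) (pr : {linear L -> N'}).
Variables (piN : int -> N -> N) (piL : int -> L -> L) (piN' : int -> N' -> N').
Hypotheses (hN : graded_proj piN) (hL : graded_proj piL) (hN' : graded_proj piN').
Hypothesis io_pi : forall e u, io (piN e u) = piL e (io u).
Hypothesis pr_pi : forall e u, pr (piL e u) = piN' e (pr u).
Hypothesis io_inj : injective io.
Hypothesis pr_surj : forall v, exists u, pr u = v.
Hypothesis io_pr : forall u, pr u = 0 <-> exists v, u = io v.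
Variable f : S.
Hypothesis f_null : exists h : 'M_(r 0, r 1), f%:M = h *m dif 0.
Hypothesis f_inj : forall u : L, f *: u = 0 -> u = 0.
Hypothesis f_surj : forall v : L, exists u, f *: u = v.

Let mapc_inj i (c c' : {ffun 'I_(r i) -> N}) : mapc io c = mapc io c' -> c = c'.
Proof.
by move=> /ffunP h; apply/ffunP => a; have := h a; rewrite !ffunE => /io_inj.
Qed.

Let mapc_lift i (c : {ffun 'I_(r i) -> N'}) : exists b, mapc pr b = c.
Proof.
have [g hg] := choice pr_surj; exists [ffun a => g (c a)].
by apply/ffunP => a; rewrite !ffunE hg.
Qed.

Let mapc_ker i (b : {ffun 'I_(r i) -> L}) : mapc pr b = 0 ->
  exists c, b = mapc io c.
Proof.
move=> /ffunP h; have hb a : exists v, b a = io v.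
  by apply/io_pr; have := h a; rewrite !ffunE.
have [g hg] := choice hb; exists [ffun a => g a].
by apply/ffunP => a; rewrite !ffunE.
Qed.

Let mapc_io i (c : {ffun 'I_(r i) -> N}) : mapc pr (mapc io c) = 0.
Proof. by apply/ffunP => a; rewrite !ffunE; apply/io_pr; exists (c a). Qed.

Let mapc_lin (V W : lmodType S) (g : {linear V -> W}) i (u v : {ffun 'I_(r i) -> V}) :
  mapc g (u - v) = mapc g u - mapc g v.
Proof. by apply/ffunP => a; rewrite !ffunE raddfB. Qed.

(* On the middle term f acts invertibly and null-homotopically at once. *)
Let cocycle_L i (c : {ffun 'I_(r i) -> L}) : cocycle dif c -> coboundary dif c.
Proof.
move=> hc; have := null_coboundary dif_exact f_null hc.
have finj j (b : {ffun 'I_(r j) -> L}) : f *: b = 0 -> b = 0.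
  move=> /ffunP h; apply/ffunP => a; rewrite ffunE; apply: f_inj.
  by have := h a; rewrite !ffunE.
case: i c hc => [|i] c hc /=; first exact: finj.
case=> b hb; have [g hg] := choice f_surj; exists [ffun a => g (b a)].
apply/subr0_eq; apply: finj; rewrite scalerBr hb -linearZ -linearB /=.
have -> : b - f *: [ffun a => g (b a)] = 0; last by rewrite linear0.
by apply/ffunP => a; rewrite !ffunE hg subrr.
Qed.

(** The sequence also gives the vanishing of the cohomology of the left term in
    position zero, where no connecting map arrives. *)
Lemma coefficient_injective_cocycle0 (c : {ffun 'I_(r 0) -> N}) :
  cocycle dif c -> c = 0.
Proof.
move=> hc; apply: mapc_inj.
have -> : mapc io (0 : {ffun 'I_(r 0) -> N}) = 0.
  by apply/ffunP => a; rewrite !ffunE raddf0.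
apply: (@cocycle_L 0%N); rewrite /cocycle -mapc_mact hc.
by apply/ffunP => a; rewrite !ffunE raddf0.
Qed.

Definition connecting i t (c' : {ffun 'I_(r i) -> N'}) (c : {ffun 'I_(r i.+1) -> N}) :=
  [/\ cocycle dif c', chom piN' t c', cocycle dif c, chom piN t c &
      exists2 b, mapc pr b = c' & mact (dif i) b = mapc io c].

(** The long exact sequence: a short exact sequence of coefficients whose middle
    term has no cohomology, since [f] acts on it both as an isomorphism and
    null-homotopically, shifts cohomology by one. *)
Lemma connecting_corr i : ext_corr piN' piN (@connecting i).
Proof.
have mapc0 (V W : lmodType S) (g : {linear V -> W}) j : mapc g (0 : {ffun 'I_(r j) -> V}) = 0.
  by apply/ffunP => a; rewrite !ffunE raddf0.
have mapcZ (V W : lmodType S) (g : {linear V -> W}) j p (c : {ffun 'I_(r j) -> V}) :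
    mapc g (p *: c) = p *: mapc g c.
  by apply/ffunP => a; rewrite !ffunE linearZ.
have lifted t (b : {ffun 'I_(r i) -> L}) : chom piL t b ->
    cocycle dif (mapc pr b) -> exists2 c, connecting t (mapc pr b) c &
      mact (dif i) b = mapc io c.
  move=> hb zb; have [|c hc] := @mapc_ker _ (mact (dif i) b).
    by rewrite mapc_mact zb.
  exists c => //; split=> //; last by exists b.
  - by apply/ffunP => a; rewrite !ffunE -pr_pi; have /ffunP/(_ a) := hb; rewrite ffunE => ->.
  - apply: mapc_inj; rewrite mapc_mact -hc mapc0.
    by apply: (coboundary_cocycle dif_exact (i := i.+1)); exists b.
  - apply: mapc_inj; rewrite -hc -[in RHS]hb -cproj_mact // hc.
    by apply/ffunP => a; rewrite !ffunE io_pi.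
split.
- by move=> t c u [].
- move=> t q p c u hp [h1 h2 h3 h4 [b hb1 hb2]]; split.
  + by rewrite /cocycle linearZ /= h1 scaler0.
  + exact: chomZ.
  + by rewrite /cocycle linearZ /= h3 scaler0.
  + exact: chomZ.
  + by exists (p *: b); rewrite ?mapcZ ?hb1 // linearZ /= hb2.
- move=> t c zc hc; have [b hb] := mapc_lift c.
  have E : mapc pr (cproj piL t b) = c.
    by rewrite -hc -hb; apply/ffunP => a; rewrite !ffunE pr_pi.
  have [||u hu _] := lifted t (cproj piL t b).
  + exact: chom_proj.
  + by rewrite E.
  by exists u; rewrite -E.
- move=> t u zu hu.
  have [|b hb] := @cocycle_L i.+1 (mapc io u).
    by rewrite /cocycle -mapc_mact zu mapc0.
  have E : mact (dif i) (cproj piL t b) = mapc io u.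
    rewrite -cproj_mact // -hb -[in RHS]hu.
    by apply/ffunP => a; rewrite !ffunE io_pi.
  have [||u' hu' E'] := lifted t (cproj piL t b).
  + exact: chom_proj.
  + by rewrite /cocycle -mapc_mact E mapc_io.
  exists (mapc pr (cproj piL t b)).
  by have -> : u = u' by apply: mapc_inj; rewrite -E -E'.
- move=> t c u [zc hc zu hu [b hb1 hb2]]; split.
  + move=> cb; have [b1 zb1 pb1] : exists2 b1, cocycle dif b1 & mapc pr b1 = c.
      case: (i) c cb {zc hc zu hu hb1 hb2 b u} => [|j] c /=.
        by move=> ->; exists 0; [rewrite /cocycle linear0 | rewrite mapc0].
      case=> b' ->; have [b'' <-] := mapc_lift b'; exists (mact (dif j) b'').
        by apply: (coboundary_cocycle dif_exact (i := j.+1)); exists b''.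
      exact: mapc_mact.
    have [|v hv] := @mapc_ker _ (b - b1); first by rewrite mapc_lin hb1 pb1 subrr.
    exists v; apply: mapc_inj; rewrite mapc_mact -hv linearB /= zb1 subr0 //.
  + move=> /= [v hv]; rewrite -hb1.
    have : coboundary dif (b - mapc io v).
      apply: cocycle_L; rewrite /cocycle linearB /= hb2 hv mapc_mact subrr //.
    have -> : mapc pr b = mapc pr (b - mapc io v) by rewrite mapc_lin mapc_io subr0.
    move: (b - mapc io v); case: (i) => [|j] w /=; first by move=> ->; rewrite mapc0.
    by case=> x ->; exists (mapc pr x); rewrite mapc_mact.
Qed.

End Connecting.
End GradedCohomology.
(** * Modules of functions on regions of the exponent lattice *)

Section AdditiveFromMonomials.
Variables (k : fieldType) (n : nat) (W : zmodType).

Lemma mpoly_morph_eq (f g : {mpoly k[n]} -> W) :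
  {morph f : p q / p - q} -> {morph g : p q / p - q} ->
  (forall c m, f (c *: 'X_[m]) = g (c *: 'X_[m])) -> f =1 g.
Proof.
move=> hf hg h p.
pose fA := HB.pack_for {additive {mpoly k[n]} -> W} f
  (GRing.isZmodMorphism.Build _ _ f hf).
pose gA := HB.pack_for {additive {mpoly k[n]} -> W} g
  (GRing.isZmodMorphism.Build _ _ g hg).
exact: (mpoly_additive_eq (f := fA) (g := gA)).
Qed.

(** The module structure on functions and the lifts of linear maps below are
    defined termwise by this formula. *)
Definition mfun (h : 'X_{1..n} -> k -> W) (p : {mpoly k[n]}) : W :=
  \sum_(m <- msupp p) h m p@_m.

Variable h : 'X_{1..n} -> k -> W.
Hypothesis hB : forall m, {morph h m : b c / b - c}.

Let h0 m : h m 0 = 0. Proof. by have := hB m 0 0; rewrite !subrr. Qed.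

Lemma mfunwE b p : (msize p <= b)%N ->
  mfun h p = \sum_(m : 'X_{1..n < b}) h m p@_m.
Proof.
move=> le_pb; set I : subFinType _ := 'X_{1..n < b}.
rewrite /mfun (big_mksub I) ?msupp_uniq //=; first last.
  by move=> x /msize_mdeg_lt /leq_trans; apply.
by rewrite big_rmcond //= => j /memN_msupp_eq0 ->.
Qed.

Lemma mfunB : {morph mfun h : p q / p - q}.
Proof.
move=> p q; have [b [h1 h2 h3]] : exists b : nat,
    [/\ msize (p - q) <= b, msize p <= b & msize q <= b]%N.
  by exists (maxn (msize (p - q)) (maxn (msize p) (msize q))); split;
    rewrite !leq_max leqnn ?orbT.
rewrite (mfunwE h1) (mfunwE h2) (mfunwE h3) -sumrB.
by apply: eq_bigr => m _; rewrite mcoeffB hB.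
Qed.

Lemma mfunX c m : mfun h (c *: 'X_[m]) = h m c.
Proof.
have [->|ne] := eqVneq c 0; first by rewrite scale0r /mfun msupp0 big_nil h0.
by rewrite /mfun msuppMCX // big_seq1 mcoeffZ mcoeffX eqxx mulr1.
Qed.

End AdditiveFromMonomials.

Notation expo n := {ffun 'I_n -> int}.

Definition mexpo n (m : 'X_{1..n}) : expo n := [ffun i => (m i)%:Z].

Definition weight n (x : expo n) : int := \sum_i x i.

Lemma weight_mexpo n (m : 'X_{1..n}) : weight (mexpo m) = mdeg m.
Proof.
rewrite mdegE PoszD_sum || rewrite /weight mdegE.
by rewrite (big_morph Posz PoszD (erefl _)); apply: eq_bigr => i _; rewrite ffunE.
Qed.

Lemma weightB n (x z : expo n) : weight (x - z) = weight x - weight z.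
Proof. by rewrite /weight -sumrB; apply: eq_bigr => i _; rewrite !ffunE. Qed.

Lemma mexpoD n (m m' : 'X_{1..n}) : mexpo (m + m')%MM = mexpo m + mexpo m'.
Proof. by apply/ffunP => i; rewrite !ffunE mnmDE PoszD. Qed.

Lemma mexpo0 n : mexpo (0%MM : 'X_{1..n}) = 0.
Proof. by apply/ffunP => i; rewrite !ffunE mnm0E. Qed.

(** Convexity for the shifts by monomials makes the functions supported on a
    region a subquotient of the module of all functions on the lattice. *)
Record region (n : nat) := Region {
  in_region :> pred (expo n);
  region_convex : forall x m m', in_region x ->
    in_region (x - mexpo m - mexpo m') -> in_region (x - mexpo m) }.

Definition rfun (k : fieldType) (n : nat) (Q : region n) : Type := {x | Q x} -> k.

Section RegionModule.
Variables (k : fieldType) (n : nat) (Q : region n).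
Local Notation S := {mpoly k[n]}.
Local Notation N := (rfun k Q).

HB.instance Definition _ := gen_eqMixin N.
HB.instance Definition _ := gen_choiceMixin N.

Let addf (u v : N) : N := fun x => u x + v x.
Let oppf (u : N) : N := fun x => - u x.
Let zerof : N := fun=> 0.

Let addfA : associative addf.
Proof. by move=> u v w; apply: funext => x; rewrite /addf addrA. Qed.
Let addfC : commutative addf.
Proof. by move=> u v; apply: funext => x; rewrite /addf addrC. Qed.
Let add0f : left_id zerof addf.
Proof. by move=> u; apply: funext => x; rewrite /addf add0r. Qed.
Let addNf : left_inverse zerof oppf addf.
Proof. by move=> u; apply: funext => x; rewrite /addf addNr. Qed.

HB.instance Definition _ := GRing.isZmodule.Build N addfA addfC add0f addNf.

Definition ext0 (u : N) (x : expo n) : k := oapp u 0 (insub x).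

Lemma ext0_val u (x : {x | Q x}) : ext0 u (val x) = u x.
Proof. by rewrite /ext0 valK. Qed.

Lemma ext0_out u x : ~~ Q x -> ext0 u x = 0.
Proof. by move=> h; rewrite /ext0 insubN. Qed.

Lemma ext0D u v x : ext0 (u + v) x = ext0 u x + ext0 v x.
Proof. by rewrite /ext0; case: insubP => //= _; rewrite addr0. Qed.

Lemma ext0N u x : ext0 (- u) x = - ext0 u x.
Proof. by rewrite /ext0; case: insubP => //= _; rewrite oppr0. Qed.

Lemma ext0B u v x : ext0 (u - v) x = ext0 u x - ext0 v x.
Proof. by rewrite ext0D ext0N. Qed.

Lemma ext00 x : ext0 0 x = 0.
Proof. by rewrite /ext0; case: insubP. Qed.

Lemma rfunP u v : (forall x, Q x -> ext0 u x = ext0 v x) -> u = v.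
Proof.
by move=> h; apply: funext => x; rewrite -!ext0_val; apply: h; apply: valP.
Qed.

Definition rfun_of (g : expo n -> k) : N := fun x => g (val x).

Lemma ext0_of g x : Q x -> ext0 (rfun_of g) x = g x.
Proof. by move=> Qx; rewrite /ext0 insubT. Qed.

Definition rscale (p : S) (u : N) : N :=
  rfun_of (fun x => mfun (fun m c => c * ext0 u (x - mexpo m)) p).

Let hB u x m : {morph (fun c => c * ext0 u (x - mexpo m)) : b c / b - c}.
Proof. by move=> b c /=; rewrite mulrBl. Qed.

Let rscaleBl u : {morph rscale^~ u : p q / p - q}.
Proof.
by move=> p q /=; apply: rfunP => x Qx; rewrite ext0B !ext0_of // mfunB.
Qed.

Let rscaleDr p u v : rscale p (u + v) = rscale p u + rscale p v.
Proof.
apply: rfunP => x Qx; rewrite ext0D !ext0_of // /mfun -big_split /=.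
by apply: eq_bigr => m _; rewrite ext0D mulrDr.
Qed.

Let rscaleBr p u v : rscale p (u - v) = rscale p u - rscale p v.
Proof.
apply: rfunP => x Qx; rewrite ext0B !ext0_of // /mfun -sumrB /=.
by apply: eq_bigr => m _; rewrite ext0B mulrBr.
Qed.

Let ext0_rscaleX c m u x : Q x -> ext0 (rscale (c *: 'X_[m]) u) x = c * ext0 u (x - mexpo m).
Proof. by move=> Qx; rewrite ext0_of // mfunX //; apply: hB. Qed.

Let rscaleA p q u : rscale p (rscale q u) = rscale (p * q) u.
Proof.
move: p; apply: mpoly_morph_eq => [p p' /=|p p' /=|c m]; rewrite ?mulrBl ?rscaleBl //.
move: q; apply: mpoly_morph_eq => [q q' /=|q q' /=|c' m'].
- by rewrite rscaleBl rscaleBr.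
- by rewrite mulrBr rscaleBl.
apply: rfunP => x Qx; rewrite ext0_rscaleX //.
have -> : c *: 'X_[m] * (c' *: 'X_[m']) = (c * c') *: 'X_[m + m'] :> S.
  by rewrite -scalerAl -scalerAr scalerA mpolyXD.
rewrite [RHS]ext0_rscaleX // mexpoD opprD addrA.
case: (boolP (Q (x - mexpo m))) => h; first by rewrite ext0_rscaleX // mulrA.
rewrite ext0_out // mulr0 ext0_out ?mulr0 //.
by apply: contra h; apply: region_convex.
Qed.

Let rscale1 : left_id 1 rscale.
Proof.
move=> u; apply: rfunP => x Qx.
by rewrite -mpolyX0 -['X_[0]]scale1r ext0_rscaleX // mexpo0 subr0 mul1r.
Qed.

Let rscaleDl u : {morph rscale^~ u : p q / p + q}.
Proof.
move=> p q /=; have h0 : rscale 0 u = 0 by have /= := rscaleBl u 0 0; rewrite !subrr.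
have hN r : rscale (- r) u = - rscale r u.
  by have /= := rscaleBl u 0 r; rewrite h0 !sub0r.
by have /= := rscaleBl u p (- q); rewrite hN !opprK.
Qed.

HB.instance Definition _ :=
  GRing.Zmodule_isLmodule.Build S N rscaleA rscale1 rscaleDr rscaleDl.

Lemma ext0_scale p u x : Q x ->
  ext0 (p *: u) x = \sum_(m <- msupp p) p@_m * ext0 u (x - mexpo m).
Proof. by move=> Qx; rewrite ext0_of. Qed.

Lemma ext0_scaleX c m u x : Q x ->
  ext0 ((c *: 'X_[m]) *: u) x = c * ext0 u (x - mexpo m).
Proof. exact: ext0_rscaleX. Qed.

Definition rproj (e : int) (u : N) : N :=
  rfun_of (fun x => if weight x == e then ext0 u x else 0).

Lemma ext0_rproj e u x : ext0 (rproj e u) x = if weight x == e then ext0 u x else 0.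
Proof.
case: (boolP (Q x)) => Qx; first by rewrite ext0_of.
by rewrite !ext0_out //; case: ifP.
Qed.

Lemma rproj_graded : graded_proj rproj.
Proof.
split=> [e u v|e u|q e p u hp]; apply: rfunP => x Qx.
- by rewrite ext0D !ext0_rproj ext0D; case: ifP; rewrite ?addr0.
- by rewrite !ext0_rproj; case: (_ == _).
rewrite ext0_rproj !ext0_scale // [LHS]big_seq.
have E m : m \in msupp p -> (weight (x - mexpo m) == e) = (weight x == q + e).
  move=> hm; rewrite weightB weight_mexpo.
  rewrite (mpoly_deg_coef hp) -?mcoeff_msupp //; lia.
under eq_bigr => m hm do rewrite ext0_rproj E //.
case: ifP => _; first by rewrite -big_seq.
by rewrite big1 // => m _; rewrite mulr0.
Qed.

End RegionModule.

(** Moving functions from one region to another by restriction and extension by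
    zero.  The hypothesis covers the inclusion of an upper part of a region and
    the projection onto a lower part. *)
Section Transfer.
Variables (k : fieldType) (n : nat) (Q Q' : region n).
Hypothesis hQ : forall x m, Q' x -> Q (x - mexpo m) -> Q x && Q' (x - mexpo m).

Definition transfer (u : rfun k Q) : rfun k Q' := @rfun_of k n Q' (ext0 u).

Lemma transfer_linear : linear transfer.
Proof.
move=> p u v; apply: rfunP => x Qx.
rewrite ext0D ext0_scale // !ext0_of // ext0D; congr (_ + _).
case: (boolP (Q x)) => h.
  rewrite ext0_scale //; apply: eq_bigr => m _; congr (_ * _).
  case: (boolP (Q (x - mexpo m))) => h'.
    by have /andP[_ h''] := hQ Qx h'; rewrite ext0_of.
  rewrite ext0_out //; case: (boolP (Q' (x - mexpo m))) => h''.
    by rewrite ext0_of // ext0_out.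
  by rewrite ext0_out.
rewrite ext0_out // big1 // => m _.
case: (boolP (Q (x - mexpo m))) => h'.
  by have /andP[] := hQ Qx h'; rewrite (negbTE h).
case: (boolP (Q' (x - mexpo m))) => h''; last by rewrite ext0_out ?mulr0.
by rewrite ext0_of // ext0_out ?mulr0.
Qed.

Lemma transfer_rproj e u : transfer (rproj e u) = rproj e (transfer u).
Proof.
apply: rfunP => x Qx; have T v : ext0 (transfer v) x = ext0 v x by rewrite ext0_of.
by rewrite ext0_rproj !T ext0_rproj.
Qed.

End Transfer.
(** * Reversing the sign of one exponent at a time *)

(** [Some true], [Some false] and [None] stand for nonnegative, negative and
    arbitrary exponents. *)
Definition in_side (s : option bool) (e : int) : bool :=
  match s with Some true => 0 <= e | Some false => e < 0 | None => true end.

Lemma box_convex n (si : 'I_n -> option bool) (x : expo n) m m' :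
  [forall i, in_side (si i) (x i)] ->
  [forall i, in_side (si i) ((x - mexpo m - mexpo m') i)] ->
  [forall i, in_side (si i) ((x - mexpo m) i)].
Proof.
move=> /forallP h /forallP h'; apply/forallP => i; move: (h i) (h' i).
rewrite !ffunE; case: (si i) => [[]|] //=; lia.
Qed.

Definition box n (si : 'I_n -> option bool) : region n :=
  Region (@box_convex n si).

Lemma boxP n (si : 'I_n -> option bool) (x : expo n) :
  reflect (forall i, in_side (si i) (x i)) (box si x).
Proof. exact: forallP. Qed.

Section Invertible.
Variables (k : fieldType) (n : nat) (si : 'I_n -> option bool).
Variables (Y : pred 'I_n) (i0 : 'I_n) (M : nat) (p : 'I_n -> {mpoly k[n]}).
Hypothesis si_Y : forall j, Y j -> si j = Some true.
Hypothesis si_i0 : si i0 = None.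
Local Notation L := (rfun k (box si)).

Let eps : {mpoly k[n]} := \sum_(j | Y j) 'X_j * p j.
Let ydeg (x : expo n) : int := \sum_(j | Y j) x j.

(** The functions of order [q] form a complete and separated filtration. *)
Let order (q : int) (u : L) : Prop :=
  forall x, box si x -> ydeg x < q -> ext0 u x = 0.

Let ydeg_ge0 x : box si x -> 0 <= ydeg x.
Proof. by move=> /boxP h; apply: sumr_ge0 => j /si_Y e; have := h j; rewrite e. Qed.

Let ydeg_sub x m : ydeg (x - mexpo m) <= ydeg x.
Proof. by apply: ler_sum => j _; rewrite !ffunE lerBlDr lerDl. Qed.

Let ydeg_subU x j : Y j -> ydeg (x - mexpo U_(j)%MM) = ydeg x - 1.
Proof.
move=> Yj; rewrite /ydeg (bigD1 j) //= [in RHS](bigD1 j) //= !ffunE mnm1E eqxx.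
rewrite [RHS]addrAC; congr (_ + _); apply: eq_bigr => l /andP[_ ne].
by rewrite !ffunE mnm1E eq_sym (negbTE ne) subr0.
Qed.

Let order_scale q s u : order q u -> order q (s *: u).
Proof.
move=> h x hx lt; rewrite ext0_scale // big1 // => m _.
case: (boolP (box si (x - mexpo m))) => hb; last by rewrite ext0_out ?mulr0.
by rewrite h ?mulr0 //; apply: le_lt_trans (ydeg_sub _ _) lt.
Qed.

Let order_X q j u : Y j -> order q u -> order (q + 1) ('X_j *: u).
Proof.
move=> Yj h x hx lt; rewrite -['X_j]scale1r ext0_scaleX // mul1r.
case: (boolP (box si (x - mexpo U_(j)%MM))) => hb; last by rewrite ext0_out.
by rewrite h // ydeg_subU //; lia.
Qed.

Let orderD q u v : order q u -> order q v -> order q (u + v).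
Proof. by move=> h h' x hx lt; rewrite ext0D h // h' // addr0. Qed.

Let order_eps q u : order q u -> order (q + 1) (eps *: u).
Proof.
move=> h; rewrite /eps scaler_suml; elim/big_ind: _ => [x hx _|u1 u2 h1 h2|j Yj].
- by rewrite ext00.
- exact: orderD.
- rewrite -scalerA; apply: order_X => //; exact: order_scale.
Qed.

Let shift : expo n := mexpo (U_(i0) *+ M)%MM.

Let box_shift x : box si (x + shift) = box si x.
Proof.
apply/boxP/boxP => h i; move: (h i); rewrite !ffunE mulmnE mnm1E;
  by case: eqP => [<-|_]; rewrite ?si_i0 // mul0n addr0.
Qed.

Let unshift (u : L) : L := @rfun_of k n (box si) (fun x => ext0 u (x + shift)).

Let ext0_unshift u x : box si x -> ext0 (unshift u) x = ext0 u (x + shift).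
Proof. by move=> hx; rewrite ext0_of. Qed.

Let unshiftK u : 'X_i0 ^+ M *: unshift u = u.
Proof.
apply: rfunP => x hx; rewrite mpolyXn -['X_[_]]scale1r ext0_scaleX // mul1r.
have hx' : box si (x - mexpo (U_(i0) *+ M)%MM) by rewrite -box_shift subrK.
by rewrite ext0_unshift // subrK.
Qed.

Let shiftK u : unshift ('X_i0 ^+ M *: u) = u.
Proof.
apply: rfunP => x hx; rewrite ext0_unshift // mpolyXn -['X_[_]]scale1r.
by rewrite ext0_scaleX ?box_shift // mul1r addrK.
Qed.

Let unshiftB u v : unshift (u - v) = unshift u - unshift v.
Proof.
by apply: rfunP => x hx; rewrite ext0B !ext0_unshift // ext0B.
Qed.

Let order_unshift q u : Y i0 = false -> order q u -> order q (unshift u).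
Proof.
move=> nY h x hx lt; rewrite ext0_unshift // h ?box_shift //.
suff -> : ydeg (x + shift) = ydeg x by [].
apply: eq_bigr => j Yj; rewrite !ffunE mulmnE mnm1E.
by case: eqP => [e|_]; [rewrite e Yj in nY | rewrite mul0n addr0].
Qed.

Let nY0 : Y i0 = false.
Proof. by apply/negP => /si_Y; rewrite si_i0. Qed.

Let order_all u : (forall q : nat, order q u) -> u = 0.
Proof.
move=> h; apply: rfunP => x hx; rewrite ext00 (h (`|ydeg x|.+1)%N) //; lia.
Qed.

Let f : {mpoly k[n]} := 'X_i0 ^+ M - eps.

(** Up to the invertible factor [X_i0 ^ M], the element [f] is the identity minus
    an operator that raises the [Y]-degree; as that degree is bounded below on
    the box and series are unrestricted, the geometric series inverts it. *)
Lemma box_unit_inj (u : L) : f *: u = 0 -> u = 0.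
Proof.
rewrite scalerBl => /subr0_eq E; apply: order_all; elim=> [|q IH].
  by move=> x hx; have := ydeg_ge0 hx; rewrite leNgt => /negbTE ->.
rewrite -(shiftK u) E; apply: order_unshift => //.
by rewrite -addn1 PoszD; apply: order_eps.
Qed.

Lemma box_unit_surj (v : L) : exists u, f *: u = v.
Proof.
pose T u := unshift (v + eps *: u).
have TB u u' : T u - T u' = unshift (eps *: (u - u')).
  by rewrite -unshiftB opprD addrACA subrr add0r scalerBr.
have orderT (q : nat) u u' : order q (u - u') -> order q.+1 (T u - T u').
  move=> h; rewrite TB; apply: order_unshift => //.
  by rewrite -addn1 PoszD; apply: order_eps.
have order0 u : order 0 u.
  by move=> x hx; have := ydeg_ge0 hx; rewrite leNgt => /negbTE ->.
(* The fixed point of T, as the limit of its iterates: the value at x is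
   stationary once the number of iterations exceeds the Y-degree of x. *)
pose w q := iter q T 0.
have ww (q : nat) : order q (w q.+1 - w q) by elim: q => [|q IH] //; apply: orderT.
have ws (q e : nat) : order q (w (e + q)%N - w q).
  elim: e => [|e IH]; first by rewrite subrr => x hx lt; rewrite ext00.
  have -> : w (e.+1 + q)%N - w q = (w (e + q).+1 - w (e + q)%N) + (w (e + q)%N - w q).
    by rewrite addrA subrK.
  apply: orderD => // x hx lt; apply: ww => //; lia.
pose u : L := @rfun_of k n (box si) (fun x => ext0 (w (`|ydeg x|.+1)) x).
have uw (q : nat) : order (q : nat) (u - w q).
  move=> x hx lt; rewrite ext0B ext0_of //; have := ydeg_ge0 hx => ge0.
  have [e ->] : exists e, q = (e + `|ydeg x|.+1)%N.
    by exists (q - `|ydeg x|.+1)%N; lia.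
  apply/eqP; rewrite subr_eq0 eq_sym -subr_eq0 -ext0B; apply/eqP.
  by apply: ws => //; lia.
have Tu : T u = u.
  apply/subr0_eq/order_all => q.
  have -> : T u - u = (T u - T (w q)) - (u - w q.+1) by rewrite opprB addrA subrK.
  apply: orderD => x hx lt; first by apply: (orderT q u) => //; lia.
  by rewrite ext0N uw ?oppr0 //; lia.
by exists u; rewrite scalerBl -{1}Tu unshiftK addrK.
Qed.

End Invertible.

Section Tower.
Variables (k : fieldType) (n : nat).
Variables (r : nat -> nat) (dif : forall i, 'M[{mpoly k[n]}]_(r i.+1, r i)).
Variable dg : forall i, 'I_(r i) -> int.
Hypothesis dif_exact : forall i (v : 'rV_(r i.+1)),
  v *m dif i = 0 <-> exists w, v = w *m dif i.+1.
Hypothesis dif_deg : forall i a b, mpoly_deg (dg a - dg b) (dif i a b).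

Section Step.
Variables (sp sl sn : 'I_n -> option bool) (i0 : 'I_n).
Hypothesis sp0 : sp i0 = Some true.
Hypothesis sl0 : sl i0 = None.
Hypothesis sn0 : sn i0 = Some false.
Hypothesis spE : forall j, j != i0 -> sp j = sl j.
Hypothesis snE : forall j, j != i0 -> sn j = sl j.

Let io_ok x m : box sl x -> box sp (x - mexpo m) ->
  box sp x && box sl (x - mexpo m).
Proof.
move=> /boxP h /boxP h'; apply/andP; split; apply/boxP => i;
  move: (h i) (h' i); rewrite ?ffunE; case: (eqVneq i i0) => [->|ne];
  rewrite ?sp0 ?sl0 ?spE //=; lia.
Qed.

Let pr_ok x m : box sn x -> box sl (x - mexpo m) ->
  box sl x && box sn (x - mexpo m).
Proof.
move=> /boxP h /boxP h'; apply/andP; split; apply/boxP => i;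
  move: (h i) (h' i); rewrite ?ffunE; case: (eqVneq i i0) => [->|ne];
  rewrite ?sn0 ?sl0 ?snE //=; lia.
Qed.

Let box_sl x : box sl x = box sp x || box sn x.
Proof.
apply/idP/orP => [/boxP h|].
  have H s : (forall j, j != i0 -> s j = sl j) -> in_side (s i0) (x i0) -> box s x.
    move=> hs h0; apply/boxP => i; case: (eqVneq i i0) => [->//|ne].
    by rewrite hs.
  case: (lerP 0 (x i0)) => lt; [left | right]; apply: H => //.
    by rewrite sp0.
  by rewrite sn0.
case=> /boxP h; apply/boxP => i; move: (h i);
  by case: (eqVneq i i0) => [->|ne]; rewrite ?sl0 // ?(spE ne) ?(snE ne).
Qed.

Let box_disj x : box sp x -> box sn x -> False.
Proof.
by move=> /boxP/(_ i0) + /boxP/(_ i0); rewrite sp0 sn0 /=; lia.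
Qed.

Let io := @transfer k n (box sp) (box sl).
Let pr := @transfer k n (box sl) (box sn).
HB.instance Definition _ := GRing.isLinear.Build _ _ _ _ io (@transfer_linear k n _ _ io_ok).
HB.instance Definition _ := GRing.isLinear.Build _ _ _ _ pr (@transfer_linear k n _ _ pr_ok).

Variables (Y : pred 'I_n) (M : nat) (p : 'I_n -> {mpoly k[n]}).
Hypothesis sl_Y : forall j, Y j -> sl j = Some true.
Let f := 'X_i0 ^+ M - \sum_(j | Y j) 'X_j * p j.
Hypothesis f_null : exists h : 'M_(r 0, r 1), f%:M = h *m dif 0.

Let io_inj : injective io.
Proof.
move=> u v E; apply: rfunP => x hx.
have hx' : box sl x by rewrite box_sl hx.
have T w : ext0 (io w) x = ext0 w x by rewrite /io ext0_of.
by rewrite -!T E.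
Qed.

Let pr_surj v : exists u, pr u = v.
Proof.
exists (@transfer k n (box sn) (box sl) v); apply: rfunP => x hx.
have hx' : box sl x by rewrite box_sl hx orbT.
by rewrite /pr !ext0_of.
Qed.

Let io_pr u : pr u = 0 <-> exists v, u = io v.
Proof.
split=> [E|[v ->]]; last first.
  apply: rfunP => x hx; have hx' : box sl x by rewrite box_sl hx orbT.
  rewrite /pr ext0_of // ext0_of // ext00 ext0_out //.
  by apply/negP => /box_disj; apply.
exists (@transfer k n (box sl) (box sp) u); apply: rfunP => x hx.
rewrite /io ext0_of //; case: (boolP (box sp x)) => hp; first by rewrite ext0_of.
rewrite [RHS]ext0_out //; move: hx; rewrite box_sl (negbTE hp) orFb => hn.
have hx' : box sl x by rewrite box_sl hn orbT.
have : ext0 (pr u) x = 0 by rewrite E ext00.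
by rewrite /pr ext0_of.
Qed.

Let f_inj u : f *: u = 0 :> rfun k (box sl) -> u = 0.
Proof. exact: box_unit_inj. Qed.

Let f_surj v : exists u : rfun k (box sl), f *: u = v.
Proof. exact: box_unit_surj. Qed.

Lemma box_cocycle0 (c : {ffun 'I_(r 0) -> rfun k (box sp)}) :
  cocycle dif c -> c = 0.
Proof.
by apply: (coefficient_injective_cocycle0 (io := io) dif_exact io_inj f_null f_inj).
Qed.

(** The exponent [i0] is nonnegative, arbitrary and negative in the three terms of
    the exact sequence to which [connecting_corr] is applied. *)
Lemma box_step i : exists T, ext_corr dif dg (i := i) (j := i.+1)
  (@rproj k n (box sn)) (@rproj k n (box sp)) T.
Proof.
have io_pi e u : io (rproj e u) = rproj e (io u) by apply: transfer_rproj.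
have pr_pi e u : pr (rproj e u) = rproj e (pr u) by apply: transfer_rproj.
exists (connecting dif dg io pr (@rproj k n (box sp)) (@rproj k n (box sn)) (i := i)).
exact: (connecting_corr (io := io) (pr := pr) dif_exact dif_deg
  (@rproj_graded k n (box sp)) (@rproj_graded k n (box sl))
  (@rproj_graded k n (box sn)) io_pi pr_pi io_inj pr_surj io_pr f_null f_inj f_surj i).
Qed.

End Step.
End Tower.

(** This is addition; the recursion moves the successor to the second argument,
    as each step of the tower does, so that the types of cochains agree by
    conversion. *)
Fixpoint shift_pos (l i : nat) : nat :=
  if l is l'.+1 then shift_pos l' i.+1 else i.

Lemma shift_posE l i : shift_pos l i = (l + i)%N.
Proof. by elim: l i => [|l IH] i //=; rewrite IH addnS. Qed.

Section FullTower.
Variables (k : fieldType) (d m : nat).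
Local Notation n := (d + m)%N.
Variables (r : nat -> nat) (dif : forall i, 'M[{mpoly k[n]}]_(r i.+1, r i)).
Variable dg : forall i, 'I_(r i) -> int.
Hypothesis dif_exact : forall i (v : 'rV_(r i.+1)),
  v *m dif i = 0 <-> exists w, v = w *m dif i.+1.
Hypothesis dif_deg : forall i a b, mpoly_deg (dg a - dg b) (dif i a b).

(** The last [m] variables, made integral over the first [d] ones by elements
    of the annihilator of the resolved module. *)
Variables (M : 'I_m -> nat) (p : 'I_m -> 'I_n -> {mpoly k[n]}).
Let Y : pred 'I_n := fun i => (i < d)%N.
Let f (j : 'I_m) := 'X_(rshift d j) ^+ M j - \sum_(i | Y i) 'X_i * p j i.
Hypothesis f_null : forall j, exists h : 'M_(r 0, r 1), (f j)%:M = h *m dif 0.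

(** The signs of the exponents after [l] steps of the tower. *)
Definition tower_side (l : nat) (i : 'I_n) : option bool :=
  Some ((i < d) || (d + l <= i))%N.

Local Notation N l := (rfun k (box (tower_side l))).

Section AtLevel.
Variables (l : nat) (ltl : (l < m)%N).
Let i0 : 'I_n := rshift d (Ordinal ltl).
Let sl (i : 'I_n) : option bool := if i == i0 then None else tower_side l i.

Let sp0 : tower_side l i0 = Some true.
Proof. by rewrite /tower_side /= leqnn orbT. Qed.
Let sl0 : sl i0 = None. Proof. by rewrite /sl eqxx. Qed.
Let sn0 : tower_side l.+1 i0 = Some false.
Proof. by rewrite /tower_side /= addnS ltnn orbF; congr Some; lia. Qed.
Let spE j : j != i0 -> tower_side l j = sl j.
Proof. by rewrite /sl => /negbTE ->. Qed.
Let snE j : j != i0 -> tower_side l.+1 j = sl j.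
Proof.
rewrite /sl => ne; rewrite (negbTE ne) /tower_side; congr Some.
have : (j != d + l :> nat)%N by apply: contra ne => /eqP e; apply/eqP/val_inj.
lia.
Qed.
Let slY j : Y j -> sl j = Some true.
Proof.
rewrite /Y /sl /tower_side => h; rewrite h; case: eqP => // e.
by move: h; rewrite e /=; lia.
Qed.

Lemma tower_step i : exists T, ext_corr dif dg (i := i) (j := i.+1)
  (@rproj k n (box (tower_side l.+1))) (@rproj k n (box (tower_side l))) T.
Proof.
exact: (box_step dif_exact dif_deg sp0 sl0 sn0 spE snE slY (f_null (Ordinal ltl))).
Qed.

Lemma tower_cocycle0 (c : {ffun 'I_(r 0) -> N l}) : cocycle dif c -> c = 0.
Proof.
exact: (box_cocycle0 dif_exact sp0 sl0 sn0 spE snE slY (f_null (Ordinal ltl))).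
Qed.

End AtLevel.

(** Local duality in disguise: power series in all variables, and series in the
    first [d] variables with [l] of the other exponents negative, have the same
    cohomology up to a shift of position by [l]. *)
Lemma tower_corr l i : (l <= m)%N -> exists T,
  ext_corr dif dg (i := i) (j := shift_pos l i)
    (@rproj k n (box (tower_side l))) (@rproj k n (box (tower_side 0))) T.
Proof.
elim: l i => [|l IH] i lem.
  by eexists; apply: ext_corr_id; apply: rproj_graded.
have [T hT] := tower_step lem i; have [T' hT'] := IH i.+1 (ltnW lem).
by eexists; apply: ext_corr_trans hT hT'.
Qed.

End FullTower.
(** * Coefficients coinduced from the parameters *)

Section PowerSeries.
Variables (k : fieldType) (n : nat).

Definition nonneg : region n := box (fun=> Some true).

Definition rone (Q : region n) : rfun k Q := @rfun_of k n Q (fun x => (x == 0)%:R).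

Lemma nonnegP (x : expo n) : reflect (forall i, 0 <= x i) (nonneg x).
Proof. exact: (@boxP n (fun=> Some true) x). Qed.

Lemma nonneg_mexpo (m : 'X_{1..n}) : nonneg (mexpo m).
Proof. by apply/nonnegP => i; rewrite ffunE. Qed.

Lemma nonneg_is_mexpo (x : expo n) : nonneg x -> exists m, x = mexpo m.
Proof.
move=> /nonnegP h; exists [multinom `|x i|%N | i < n].
by apply/ffunP => i; rewrite ffunE mnmE gez0_abs.
Qed.

Lemma mexpo_inj : injective (@mexpo n).
Proof.
by move=> m m' /ffunP h; apply/mnmP => i; have := h i; rewrite !ffunE => -[].
Qed.

Section Ring.
Variable Q : region n.
Hypothesis hQ : forall x, Q x = nonneg x.
Local Notation one := (@rone Q).

Lemma ext0_scale_one (p : {mpoly k[n]}) m : ext0 (p *: one) (mexpo m) = p@_m.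
Proof.
move: p; apply: mpoly_morph_eq => [p q|p q|c m'].
- by rewrite scalerBl ext0B.
- by rewrite mcoeffB.
rewrite ext0_scaleX ?hQ ?nonneg_mexpo // mcoeffZ mcoeffX; congr (_ * _).
case: (boolP (Q (mexpo m - mexpo m'))) => h.
  by rewrite ext0_of // subr_eq0 (inj_eq mexpo_inj) eq_sym.
rewrite ext0_out //; case: eqP => // e; case/negP: h; rewrite e subrr hQ.
by rewrite -(mexpo0 n) nonneg_mexpo.
Qed.

Lemma scale_one_inj (p : {mpoly k[n]}) : p *: one = 0 -> p = 0.
Proof.
by move=> h; apply/mpolyP => m; rewrite -ext0_scale_one h ext00 mcoeff0.
Qed.

Lemma rproj_one e (p : {mpoly k[n]}) : rproj e (p *: one) = mhom e p *: one.
Proof.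
move: p; apply: mpoly_morph_eq => [p q|p q|c m].
- rewrite scalerBl; have [piD _ _] := rproj_graded k Q.
  have h0 : rproj e (0 : rfun k Q) = 0.
    by apply: (addrI (rproj e (0 : rfun k Q))); rewrite -piD !addr0.
  apply/eqP; rewrite eq_sym subr_eq -piD subrK; exact: eqxx.
- by rewrite raddfB /= scalerBl.
apply: rfunP => x; rewrite hQ => /nonneg_is_mexpo [m' ->].
rewrite ext0_rproj !ext0_scale_one mhomZ mhomX weight_mexpo !mcoeffZ.
case: (eqVneq m m') => [<-|ne].
  by case: eqP => _; rewrite // mcoeff0 mulr0.
rewrite mcoeffX (negbTE ne) mulr0.
by case: ifP; case: ifP; rewrite ?mcoeffX ?(negbTE ne) ?mcoeff0 ?mulr0.
Qed.

(** Only finitely many nonnegative exponents have a given weight. *)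
Lemma homogeneous_poly e (u : rfun k Q) : rproj e u = u ->
  exists2 p : {mpoly k[n]}, mpoly_deg e p & u = p *: one.
Proof.
move=> hu; case: e hu => [q|q] hu; last first.
  exists 0; rewrite ?scale0r //; apply: rfunP => x; rewrite -hu ext0_rproj.
  rewrite hQ => /nonneg_is_mexpo [m ->]; rewrite weight_mexpo ext00.
  by case: eqP.
pose p : {mpoly k[n]} :=
  \sum_(m : 'X_{1..n < q.+1}) ext0 u (mexpo m) *: 'X_[m].
have hu' m : ext0 u (mexpo m) = if (mdeg m)%:Z == q then ext0 u (mexpo m) else 0.
  by rewrite -{1}hu ext0_rproj weight_mexpo.
have up : u = p *: one.
  apply: rfunP => x; rewrite hQ => /nonneg_is_mexpo [m ->].
  rewrite ext0_scale_one; case: (eqVneq (mdeg m) q) => [em|ne].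
    by rewrite /p (mcoeff_mpoly (fun m => ext0 u (mexpo m))) // em.
  have u0 : ext0 u (mexpo m) = 0 by rewrite hu' eqz_nat (negbTE ne).
  rewrite u0 raddf_sum big1 // => m' _ /=; rewrite mcoeffZ mcoeffX.
  by case: eqP => [->|_]; rewrite ?u0 ?mul0r ?mulr0.
exists p => //.
have : mhom q p *: one = p *: one by rewrite -rproj_one -up.
move/eqP; rewrite -subr_eq0 -scalerBl => /eqP /scale_one_inj /subr0_eq h.
by rewrite -h; apply: mhom_deg.
Qed.

End Ring.
End PowerSeries.

Section Coinduced.
Variables (k : fieldType) (d m : nat).
Local Notation n := (d + m)%N.
Local Notation S := {mpoly k[n]}.
Local Notation A := {mpoly k[d]}.
Local Notation D := (rfun k (box (@tower_side d m m))).
Local Notation Ah := (rfun k (nonneg d)).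

(** Polynomials in the first [d] variables act on everything through [iota]. *)
Definition iota : A -> S := pres_map (fun i => 'X_(lshift m i)).
HB.instance Definition _ := GRing.RMorphism.on iota.

Definition mleft (mu : 'X_{1..n}) : 'X_{1..d} := [multinom mu (lshift m i) | i < d].
Definition mright (mu : 'X_{1..n}) : 'X_{1..m} := [multinom mu (rshift d i) | i < m].
Definition mjoin (al : 'X_{1..d}) (be : 'X_{1..m}) : 'X_{1..n} :=
  [multinom (match split i with inl j => al j | inr j => be j end) | i < n].
Definition ejoin (x : expo d) (w : expo m) : expo n :=
  [ffun i => match split i with inl j => x j | inr j => w j end].

Let splitL i : split (lshift m i) = inl i :> 'I_d + 'I_m.
Proof. exact: (unsplitK (inl i)). Qed.
Let splitR i : split (rshift d i) = inr i :> 'I_d + 'I_m.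
Proof. exact: (unsplitK (inr i)). Qed.

Lemma ejoinL x w i : ejoin x w (lshift m i) = x i.
Proof. by rewrite ffunE splitL. Qed.
Lemma ejoinR x w i : ejoin x w (rshift d i) = w i.
Proof. by rewrite ffunE splitR. Qed.
Lemma mjoinL al be i : mjoin al be (lshift m i) = al i.
Proof. by rewrite mnmE splitL. Qed.
Lemma mjoinR al be i : mjoin al be (rshift d i) = be i.
Proof. by rewrite mnmE splitR. Qed.

Lemma splitE (P : 'I_n -> Prop) :
  (forall i, P (lshift m i)) -> (forall i, P (rshift d i)) -> forall i, P i.
Proof. by move=> hl hr i; rewrite -(splitK i); case: (split i). Qed.

Lemma mjoin_parts mu : mjoin (mleft mu) (mright mu) = mu.
Proof. by apply/mnmP; apply: splitE => i; rewrite ?mjoinL ?mjoinR mnmE. Qed.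

Lemma mleft_join al be : mleft (mjoin al be) = al.
Proof. by apply/mnmP => i; rewrite mnmE mjoinL. Qed.
Lemma mright_join al be : mright (mjoin al be) = be.
Proof. by apply/mnmP => i; rewrite mnmE mjoinR. Qed.
Lemma mleftD mu nu : mleft (mu + nu)%MM = (mleft mu + mleft nu)%MM.
Proof. by apply/mnmP => i; rewrite !(mnmE, mnmDE). Qed.
Lemma mrightD mu nu : mright (mu + nu)%MM = (mright mu + mright nu)%MM.
Proof. by apply/mnmP => i; rewrite !(mnmE, mnmDE). Qed.

Lemma mjoin_split al be : mjoin al be = (mjoin al 0 + mjoin 0 be)%MM.
Proof.
by apply/mnmP; apply: splitE => i; rewrite mnmDE ?mjoinL ?mjoinR mnm0E ?addn0.
Qed.

Lemma iotaX c al : iota (c *: 'X_[al]) = c *: 'X_[mjoin al 0].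
Proof.
rewrite /iota pres_mapZ pres_mapX; congr (_ *: _).
rewrite mpolyXE_id big_split_ord /= [X in _ = _ * X]big1 ?mulr1 => [|i _].
  by apply: eq_bigr => i _; rewrite mjoinL.
by rewrite mjoinR mnm0E expr0.
Qed.

Lemma term_split c mu :
  c *: 'X_[mu] = iota (c *: 'X_[mleft mu]) * 'X_[mjoin 0 (mright mu)] :> S.
Proof. by rewrite iotaX -scalerAl -mpolyXD -mjoin_split mjoin_parts. Qed.

Definition eneg : expo m := [ffun=> -1].

(** The residue in the last [m] variables: the coefficient of the monomial all of
    whose exponents are [-1]. *)
Definition ev (u : D) : Ah := @rfun_of k d (nonneg d) (fun x => ext0 u (ejoin x eneg)).

Lemma top_side (i : 'I_m) : @tower_side d m m (rshift d i) = Some false.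
Proof. by rewrite /tower_side /=; congr Some; have := ltn_ord i; lia. Qed.

Lemma box_top x w : box (@tower_side d m m) (ejoin x w) =
  nonneg d x && [forall i, w i < 0].
Proof.
apply/boxP/andP => [h|[/nonnegP h /forallP h']].
  split; [apply/nonnegP => i | apply/forallP => i].
    by have := h (lshift m i); rewrite /tower_side /= ltn_ord ejoinL.
  by have := h (rshift d i); rewrite top_side ejoinR.
apply: splitE => i; last by rewrite top_side ejoinR /= h'.
by rewrite /tower_side /= ltn_ord ejoinL h.
Qed.

Lemma ext0_ev u x : ext0 (ev u) x = ext0 u (ejoin x eneg).
Proof.
case: (boolP (nonneg d x)) => hx; first by rewrite ext0_of.
by rewrite !ext0_out // box_top (negbTE hx).
Qed.

Lemma evB : {morph ev : u v / u - v}.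
Proof. by move=> u v; apply: rfunP => x _; rewrite ext0B !ext0_ev ext0B. Qed.
HB.instance Definition _ := GRing.isZmodMorphism.Build D Ah ev evB.

Lemma ejoin_sub x w mu : ejoin x w - mexpo mu =
  ejoin (x - mexpo (mleft mu)) (w - mexpo (mright mu)).
Proof.
have eB q (a b : expo q) i : (a - b) i = a i - b i by rewrite !ffunE.
have eM q (nu : 'X_{1..q}) i : mexpo nu i = (nu i)%:Z by rewrite ffunE.
by apply/ffunP; apply: splitE => i; rewrite eB eM ?ejoinL ?ejoinR eB eM mnmE.
Qed.

Lemma box_eneg x : box (@tower_side d m m) (ejoin x eneg) = nonneg d x.
Proof.
by rewrite box_top; case: (nonneg d x) => //; apply/forallP => i; rewrite ffunE.
Qed.

Lemma ev_iota a u : ev (iota a *: u) = a *: ev u.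
Proof.
move: a; apply: mpoly_morph_eq => [a b|a b|c al].
- by rewrite raddfB /= scalerBl raddfB.
- by rewrite scalerBl.
apply: rfunP => x hx; rewrite iotaX ext0_ev !ext0_scaleX ?box_eneg //.
rewrite ejoin_sub mleft_join mright_join mexpo0 subr0.
by rewrite ext0_ev.
Qed.

Lemma ext0_ev_right u x be :
  nonneg d x -> ext0 (ev ('X_[mjoin 0 be] *: u)) x = ext0 u (ejoin x (eneg - mexpo be)).
Proof.
move=> hx; rewrite ext0_ev -['X_[_]]scale1r ext0_scaleX ?box_eneg // mul1r.
by rewrite ejoin_sub mleft_join mright_join mexpo0 subr0.
Qed.

Definition eleft (x : expo n) : expo d := [ffun i => x (lshift m i)].
Definition eright (x : expo n) : expo m := [ffun i => x (rshift d i)].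
Lemma ejoin_parts x : ejoin (eleft x) (eright x) = x.
Proof. by apply/ffunP; apply: splitE => i; rewrite ?ejoinL ?ejoinR ffunE. Qed.

Lemma neg_part (w : expo m) : [forall i, w i < 0] ->
  exists be, w = eneg - mexpo be.
Proof.
move=> /forallP h; exists [multinom absz (w i + 1)%R | i < m].
by apply/ffunP => i; rewrite !ffunE mnmE; have := h i; move: (w i) => e; lia.
Qed.

(** Multiplying by a monomial moves any coefficient to the residue position. *)
Lemma ev_faithful u : (forall p : S, ev (p *: u) = 0) -> u = 0.
Proof.
move=> h; apply: rfunP => x; rewrite -(ejoin_parts x) box_top ext00.
case/andP => hx /neg_part [be ->].
by rewrite -ext0_ev_right // h ext00.
Qed.

(** [ev] exhibits these coefficients as the linear maps, over the polynomial
    ring in the first variables, from the whole polynomial ring to power series. *)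
Lemma coinduced (phi : S -> Ah) :
  {morph phi : p q / p - q} -> (forall a p, phi (iota a * p) = a *: phi p) ->
  exists u : D, forall p, ev (p *: u) = phi p.
Proof.
move=> phiB phiA.
pose be (x : expo n) : 'X_{1..m} := [multinom absz (eright x i + 1)%R | i < m].
pose u : D := @rfun_of k n _ (fun x => ext0 (phi 'X_[mjoin 0 (be x)]) (eleft x)).
exists u; apply: mpoly_morph_eq => [p q|p q|c mu].
- by rewrite scalerBl raddfB.
- exact: phiB.
rewrite [in RHS]term_split phiA; apply: rfunP => x hx.
rewrite ext0_ev !ext0_scaleX ?box_eneg //; congr (_ * _); rewrite ejoin_sub.
set w := eneg - _; set x' := x - _.
have hw : [forall i, w i < 0] by apply/forallP => i; rewrite !ffunE; lia.
case: (boolP (nonneg d x')) => hx'; last first.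
  by rewrite !ext0_out // box_top (negbTE hx').
rewrite ext0_of ?box_top ?hx' //.
have -> : eleft (ejoin x' w) = x' by apply/ffunP => i; rewrite ffunE ejoinL.
congr (ext0 (phi 'X_[mjoin 0 _]) _).
by apply/mnmP => i; rewrite mnmE ffunE ejoinR !ffunE; lia.
Qed.

Lemma weight_ejoin x : weight (ejoin x eneg) = weight x - m%:Z.
Proof.
rewrite /weight big_split_ord /=; congr (_ + _).
  by apply: eq_bigr => i _; rewrite ejoinL.
under eq_bigr => i _ do rewrite ejoinR ffunE.
by rewrite sumr_const card_ord; lia.
Qed.

Lemma ev_rproj e u : ev (rproj e u) = rproj (e + m%:Z) (ev u).
Proof.
apply: rfunP => x hx; rewrite ext0_ev !ext0_rproj ext0_ev weight_ejoin.
by rewrite subr_eq.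
Qed.

(** ** Cochains as linear maps to power series *)

Definition pairing q (c : {ffun 'I_q -> D}) (v : 'rV[S]_q) : Ah :=
  ev (\sum_a v 0 a *: c a).

Lemma pairingB q c : {morph @pairing q c : u v / u - v}.
Proof.
move=> u v; rewrite /pairing -raddfB -sumrB; congr ev.
by apply: eq_bigr => a _; rewrite !mxE scalerBl.
Qed.
HB.instance Definition _ q c :=
  GRing.isZmodMorphism.Build 'rV[S]_q Ah (pairing c) (@pairingB q c).

Lemma pairing0l q v : pairing (0 : {ffun 'I_q -> D}) v = 0.
Proof. by rewrite /pairing big1 ?raddf0 // => a _; rewrite ffunE scaler0. Qed.

Lemma pairing_iota q c a (v : 'rV_q) : pairing c (iota a *: v) = a *: pairing c v.
Proof.
rewrite /pairing -ev_iota scaler_sumr; congr ev.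
by apply: eq_bigr => b _; rewrite mxE scalerA.
Qed.

Lemma pairing_mact p q (M : 'M[S]_(p, q)) c v :
  pairing (mact M c) v = pairing c (v *m M).
Proof.
rewrite /pairing; congr ev.
under eq_bigr => a _ do rewrite ffunE scaler_sumr.
rewrite exchange_big; apply: eq_bigr => b _.
by rewrite mxE scaler_suml; apply: eq_bigr => a _; rewrite scalerA.
Qed.

Lemma pairingZ q (c : {ffun 'I_q -> D}) p v : pairing (p *: c) v = pairing c (p *: v).
Proof.
rewrite /pairing; congr ev; apply: eq_bigr => a _.
by rewrite ffunE mxE !scalerA mulrC.
Qed.

Lemma pairing_faithful q (c : {ffun 'I_q -> D}) :
  (forall v, pairing c v = 0) -> c = 0.
Proof.
move=> h; apply/ffunP => a; rewrite ffunE; apply: ev_faithful => p.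
rewrite -(h (p *: delta_mx 0 a)) /pairing (bigD1 a) //= !mxE !eqxx mulr1.
rewrite big1 ?addr0 // => b ne; rewrite !mxE (negbTE ne) andbF mulr0 scale0r //.
Qed.

(** Together with [pairing_faithful]: cochains are the same as linear maps, over
    the first variables, from row vectors to power series. *)
Lemma pairing_complete q (phi : 'rV[S]_q -> Ah) :
  {morph phi : u v / u - v} -> (forall a v, phi (iota a *: v) = a *: phi v) ->
  exists c, forall v, pairing c v = phi v.
Proof.
move=> phiB phiA.
have H a : exists u : D, forall p, ev (p *: u) = phi (p *: delta_mx 0 a).
  apply: coinduced => [p p'|b p]; first by rewrite scalerBl phiB.
  by rewrite -scalerA phiA.
have [c hc] := choice H; exists [ffun a => c a] => v.
pose phi' := HB.pack_for {additive 'rV[S]_q -> Ah} phi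
  (GRing.isZmodMorphism.Build _ _ phi phiB).
rewrite /pairing raddf_sum [in RHS](row_sum_delta v).
rewrite -[RHS]/(phi' _) raddf_sum; apply: eq_bigr => a _ /=.
by rewrite ffunE hc.
Qed.

(** The polynomial ring is free over the first variables, on the monomials in the
    other ones, so a lift can be chosen on that basis. *)
Lemma projective_lift p q q' (M : 'M[S]_(q, q')) (psi : 'rV[S]_p -> 'rV[S]_q') :
  {morph psi : u v / u - v} -> (forall a v, psi (iota a *: v) = iota a *: psi v) ->
  (forall x, exists w, w *m M = psi x) ->
  exists s : 'rV[S]_p -> 'rV[S]_q,
    [/\ {morph s : u v / u - v}, forall a v, s (iota a *: v) = iota a *: s v
      & forall x, s x *m M = psi x].
Proof.
move=> psiB psiA hM.
have H (aB : 'I_p * 'X_{1..m}) :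
    exists w, w *m M = psi ('X_[mjoin 0 aB.2] *: delta_mx 0 aB.1) by apply: hM.
have [B hB] := choice H.
pose h a mu c := iota (c *: 'X_[mleft mu]) *: B (a, mright mu).
have hhB a mu : {morph h a mu : b c / b - c}.
  by move=> b c; rewrite /h scalerBl raddfB /= scalerBl.
pose s (v : 'rV[S]_p) := \sum_a mfun (h a) (v 0 a).
have sA a b (u : S) : mfun (h a) (iota b * u) = iota b *: mfun (h a) u.
  move: b; apply: mpoly_morph_eq => [b b'|b b'|c al].
  - by rewrite raddfB /= mulrBl mfunB.
  - by rewrite raddfB /= scalerBl.
  move: u; apply: mpoly_morph_eq => [u u'|u u'|c' mu].
  - by rewrite mulrBr mfunB.
  - by rewrite mfunB // scalerBr.
  rewrite iotaX -scalerAl -scalerAr scalerA -mpolyXD !mfunX // /h.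
  rewrite scalerA -iotaX -rmorphM; congr (iota _ *: B (_, _)).
    by rewrite mleftD mleft_join mpolyXD -scalerAl -scalerAr scalerA.
  by rewrite mrightD mright_join add0m.
exists s; split.
- move=> u v; rewrite /s -sumrB; apply: eq_bigr => a _.
  by rewrite !mxE mfunB.
- move=> b v; rewrite /s scaler_sumr; apply: eq_bigr => a _.
  by rewrite mxE sA.
move=> x; pose psi' := HB.pack_for {additive 'rV[S]_p -> 'rV[S]_q'} psi
  (GRing.isZmodMorphism.Build _ _ psi psiB).
rewrite [in RHS](row_sum_delta x) -[RHS]/(psi' _) raddf_sum mulmx_suml.
apply: eq_bigr => a _ /=; move: (x 0 a).
apply: mpoly_morph_eq => [u u'|u u'|c mu].
- by rewrite mfunB // mulmxBl.
- by rewrite scalerBl psiB.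
by rewrite mfunX // /h -scalemxAl hB /= -psiA scalerA -term_split.
Qed.

End Coinduced.
(** * Duality over the polynomial ring of the parameters *)

Section Duality.
Variables (k : fieldType) (R : comAlgType k) (gR : int -> R -> Prop).
Hypothesis hR : standard_graded gR.
Variables (d m : nat) (y : 'I_d -> R) (z : 'I_(d + m) -> R).
Hypothesis zy : forall i, z (lshift m i) = y i.
Hypothesis hz : is_presentation gR z.
Hypothesis hnil : forall i, exists M : nat, gen_by y (z i ^+ M).
Variables (s : nat) (e : 'I_s -> R) (b : 'I_s -> int).
Hypothesis e_deg : forall l, gR (b l) (e l).
Hypothesis e_span : forall r, exists a : 'I_s -> {mpoly k[d]},
  r = \sum_l pres_map y (a l) * e l.
Hypothesis e_free : forall a : 'I_s -> {mpoly k[d]},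
  \sum_l pres_map y (a l) * e l = 0 -> forall l, a l = 0.
Variable F : graded_resolution gR z.

Local Notation n := (d + m)%N.
Local Notation S := {mpoly k[n]}.
Local Notation A := {mpoly k[d]}.
Local Notation D := (rfun k (box (@tower_side d m m))).
Local Notation Ah := (rfun k (nonneg d)).
Local Notation P := (pres_map z).
Local Notation evA := (pres_map y).
Local Notation dif := (res_dif F).
Local Notation r := (res_rank F).

Let dg i (a : 'I_(r i)) : int := @res_deg k R gR n z F i a.
Let dif_exact : forall i (v : 'rV_(r i.+1)),
  v *m dif i = 0 <-> exists w, v = w *m dif i.+1.
Proof. exact: res_exact. Qed.
Let dif_deg : forall i a c, mpoly_deg (dg a - dg c) (dif i a c).
Proof. exact: res_dif_deg. Qed.

Lemma pres_iota (a : A) : P (iota m a) = evA a.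
Proof.
apply: (mpoly_rmorph_eq (f := P \o iota m) (g := evA)) => [c|i] /=.
  by rewrite /iota pres_mapC alg_mpolyC !pres_mapC.
by rewrite /iota !pres_mapU zy.
Qed.

(** ** Coordinates on the free basis *)

Definition coord (x : R) : 'I_s -> A := sval (cid (e_span x)).

Lemma coordP x : x = \sum_l evA (coord x l) * e l.
Proof. by rewrite /coord; case: (cid _). Qed.

Lemma coord_eq x (a : 'I_s -> A) :
  x = \sum_l evA (a l) * e l -> forall l, coord x l = a l.
Proof.
move=> h l; apply: subr0_eq.
apply: (e_free (a := fun l => coord x l - a l)).
transitivity (\sum_i evA (coord x i) * e i - \sum_i evA (a i) * e i).
  by rewrite -sumrB; apply: eq_bigr => i _; rewrite raddfB mulrBl.
by rewrite -coordP -h subrr.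
Qed.

Lemma coordB x x' l : coord (x - x') l = coord x l - coord x' l.
Proof.
apply: (@coord_eq _ (fun l => coord x l - coord x' l)).
transitivity (\sum_i evA (coord x i) * e i - \sum_i evA (coord x' i) * e i).
  by rewrite -!coordP.
by rewrite -sumrB; apply: eq_bigr => i _; rewrite raddfB mulrBl.
Qed.

Lemma coordM a x l : coord (evA a * x) l = a * coord x l.
Proof.
apply: (@coord_eq _ (fun l => a * coord x l)).
transitivity (evA a * \sum_i evA (coord x i) * e i); first by rewrite -coordP.
by rewrite mulr_sumr; apply: eq_bigr => i _; rewrite rmorphM mulrA.
Qed.

Lemma coord_e l' l : coord (e l') l = (l' == l)%:R.
Proof.
apply: (@coord_eq _ (fun l => (l' == l)%:R)).
rewrite (bigD1 l') //= eqxx rmorph1 mul1r big1 ?addr0 // => i.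
by rewrite eq_sym => /negbTE ->; rewrite raddf0 mul0r.
Qed.

(** ** The augmentation *)

Definition aug (v : 'rV[S]_(r 0)) : R := \sum_a P (v 0 a) * @res_aug k R gR n z F a.

Lemma augB : {morph aug : u v / u - v}.
Proof.
move=> u v; rewrite /aug -sumrB; apply: eq_bigr => a _.
by rewrite !mxE raddfB mulrBl.
Qed.
HB.instance Definition _ := GRing.isZmodMorphism.Build 'rV[S]_(r 0) R aug augB.

Lemma augZ p v : aug (p *: v) = P p * aug v.
Proof.
rewrite /aug mulr_sumr; apply: eq_bigr => a _.
by rewrite mxE rmorphM mulrA.
Qed.

Lemma aug_ker v : aug v = 0 <-> exists w, v = w *m dif 0.
Proof. exact: res_exact0. Qed.

Lemma aug_lift x t : gR t x -> exists v : 'rV[S]_(r 0),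
  (forall a, mpoly_deg (t - dg a) (v 0 a)) /\ aug v = x.
Proof.
move=> hx; have hg : is_grading gR by case: hR.
have [v hv] := res_aug_surj F x.
exists (\row_a mhom (t - dg a) (v 0 a)); split=> [a|].
  by rewrite mxE; apply: mhom_deg.
rewrite -(gproj_id hg hx) hv raddf_sum; apply: eq_bigr => a _ /=.
rewrite mxE -(gproj_pres hR hz.1 hg).
have hM : forall j u, gR j u -> gR (dg a + j) (@res_aug k R gR n z F a * u).
  by case: hR => _ hM _ _ _ j u; apply: hM; apply: res_aug_deg.
have := @gproj_act R R gR gR hg hg (dg a) _ (t - dg a) (P (v 0 a)) (fun _ _ => mulrDr _ _ _) hM.
by rewrite addrC subrK [P _ * _]mulrC => ->; rewrite mulrC.
Qed.

Lemma lifts_exist : exists v : 'I_s -> 'rV[S]_(r 0),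
  (forall l a, mpoly_deg (b l - dg a) (v l 0 a)) /\ forall l, aug (v l) = e l.
Proof.
have [v hv] := choice (fun l => aug_lift (e_deg l)).
by exists v; split=> l; case: (hv l).
Qed.

Variable vl : 'I_s -> 'rV[S]_(r 0).
Hypothesis vl_deg : forall l a, mpoly_deg (b l - dg a) (vl l 0 a).
Hypothesis vl_aug : forall l, aug (vl l) = e l.

Definition free_section (x : R) : 'rV[S]_(r 0) := \sum_l iota m (coord x l) *: vl l.

Lemma free_sectionB : {morph free_section : u v / u - v}.
Proof.
move=> u v; rewrite /free_section -sumrB; apply: eq_bigr => l _.
by rewrite coordB raddfB scalerBl.
Qed.

Lemma free_section_evA a x : free_section (evA a * x) = iota m a *: free_section x.
Proof.
rewrite /free_section scaler_sumr; apply: eq_bigr => l _.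
by rewrite coordM rmorphM scalerA.
Qed.

Lemma aug_free_section x : aug (free_section x) = x.
Proof.
rewrite raddf_sum [RHS]coordP; apply: eq_bigr => l _ /=.
by rewrite augZ pres_iota vl_aug.
Qed.

(** ** Splitting of the resolution over the parameters *)

(** The ring and every term of the resolution are free over the parameters, so the
    images of the differentials are direct summands; the retractions are chosen
    one position after the other. *)
Lemma resolution_split i : exists t : 'rV[S]_(r i) -> 'rV[S]_(r i.+1),
  [/\ {morph t : u v / u - v}, forall a v, t (iota m a *: v) = iota m a *: t v
    & forall w, t (w *m dif i) *m dif i = w *m dif i].
Proof.
elim: i => [|i [t [tB tA tE]]].
  have [|||t [tB tA tE]] := @projective_lift k d m _ _ _ (dif 0)
      (fun x => x - free_section (aug x)).
  - by move=> u v /=; rewrite augB free_sectionB opprD addrACA -opprD.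
  - by move=> a v /=; rewrite augZ pres_iota free_section_evA scalerBr.
  - move=> x; have [|w hw] := (aug_ker (x - free_section (aug x))).1; last by exists w.
    by rewrite augB aug_free_section subrr.
  exists t; split=> // w; rewrite tE.
  have -> : aug (w *m dif 0) = 0 by apply/aug_ker; exists w.
  by have := free_sectionB 0 0; rewrite !subrr => ->; rewrite subr0.
have t0 : t 0 = 0 by have := tB 0 0; rewrite !subrr.
have [|||t' [tB' tA' tE']] := @projective_lift k d m _ _ _ (dif i.+1)
    (fun x => x - t (x *m dif i)).
- by move=> u v /=; rewrite mulmxBl tB opprD addrACA -opprD.
- by move=> a v /=; rewrite -scalemxAl tA scalerBr.
- move=> x; have [|w hw] := (dif_exact (x - t (x *m dif i))).1; last by exists w.
  by rewrite mulmxBl tE subrr.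
exists t'; split=> // w; rewrite tE'.
have -> : w *m dif i.+1 *m dif i = 0 by apply/dif_exact; exists w.
by rewrite t0 subr0.
Qed.

(** The coinduced coefficients have no higher cohomology, because the
    resolution is split over the parameters. *)
Lemma coinduced_vanish i (c : {ffun 'I_(r i.+1) -> D}) :
  cocycle (fun i => dif i) c -> coboundary (fun i => dif i) c.
Proof.
move=> hc /=; have [t [tB tA tE]] := resolution_split i.
have [||c' hc'] := @pairing_complete k d m _ (fun v => pairing c (t v)).
- by move=> u v /=; rewrite tB raddfB.
- by move=> a v /=; rewrite tA pairing_iota.
exists c'; apply/esym/subr0_eq/pairing_faithful => v.
have -> : pairing (mact (dif i) c' - c) v = pairing (mact (dif i) c') v - pairing c v.
  rewrite /pairing -raddfB -sumrB; congr ev; apply: eq_bigr => a _.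
  by rewrite !ffunE scalerBr.
rewrite pairing_mact hc' -raddfB /=.
have [|w ->] := (dif_exact (t (v *m dif i) - v)).1.
  by rewrite mulmxBl tE subrr.
by rewrite -pairing_mact hc pairing0l.
Qed.

(** ** Degree zero cocycles as linear maps on the ring *)

Section Cocycles0.
Variable c : {ffun 'I_(r 0) -> D}.
Hypothesis hc : cocycle (fun i => dif i) c.

Lemma cocycle0_aug v : aug v = 0 -> pairing c v = 0.
Proof.
move=> /aug_ker [w ->].
by rewrite -pairing_mact hc pairing0l.
Qed.

(** A cocycle is a linear map on the ring, hence given by its values on [e]. *)
Lemma cocycle0_coord v :
  pairing c v = \sum_l coord (aug v) l *: pairing c (vl l).
Proof.
have -> : pairing c v = pairing c (free_section (aug v)).
  by apply: subr0_eq; rewrite -raddfB; apply: cocycle0_aug; rewrite augB aug_free_section subrr.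
by rewrite raddf_sum; apply: eq_bigr => l _ /=; rewrite pairing_iota.
Qed.

Lemma cocycle0_eq0 : (forall l, pairing c (vl l) = 0) -> c = 0.
Proof.
move=> h; apply: pairing_faithful => v; rewrite cocycle0_coord big1 // => l _.
by rewrite h scaler0.
Qed.

End Cocycles0.

(** The [m] residues lower the degree by [m] against the twist by [d + m], which
    leaves a twist by [d]. *)
Lemma pairing_cproj t l (c : {ffun 'I_(r 0) -> D}) :
  pairing (cproj dg (@rproj k n _) t c) (vl l) =
  rproj (b l + t - d%:Z) (pairing c (vl l)).
Proof.
have hp := @rproj_graded k n (box (@tower_side d m m)).
have -> : b l + t - d%:Z = (b l + t - n%:Z) + m%:Z by lia.
rewrite -ev_rproj /pairing (gp_sum hp); congr ev; apply: eq_bigr => a _.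
have [_ _ hZ] := hp; rewrite ffunE (hZ _ _ _ _ (vl_deg l a)); congr rproj.
by rewrite !addrA subrK.
Qed.

(** Values on the basis can be prescribed; projecting to degree [t] does not change
    values of the right degrees. *)
Lemma cocycle0_exists t (g : 'I_s -> Ah) :
  (forall l, rproj (b l + t - d%:Z) (g l) = g l) ->
  exists c : {ffun 'I_(r 0) -> D}, [/\ cocycle (fun i => dif i) c,
    chom dg (@rproj k n _) t c & forall l, pairing c (vl l) = g l].
Proof.
move=> hg; pose phi v := \sum_l coord (aug v) l *: g l.
have [||c hc] := @pairing_complete k d m _ phi.
- move=> u v; rewrite /phi -sumrB; apply: eq_bigr => l _.
  by rewrite augB coordB scalerBl.
- move=> a v; rewrite /phi scaler_sumr; apply: eq_bigr => l _.
  by rewrite augZ pres_iota coordM scalerA.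
have hp := @rproj_graded k n (box (@tower_side d m m)).
exists (cproj dg (@rproj k n _) t c); split.
- rewrite /cocycle -(cproj_mact dif_deg hp).
  suff -> : mact (dif 0) c = 0.
    apply/ffunP => a; rewrite !ffunE.
    by apply: rfunP => x _; rewrite ext0_rproj ext00; case: ifP.
  apply: pairing_faithful => v; rewrite pairing_mact hc /phi.
  have -> : aug (v *m dif 0) = 0 by apply/aug_ker; exists v.
  by rewrite big1 // => l _; have := coordB 0 0 l; rewrite !subrr => ->; rewrite scale0r.
- exact: chom_proj.
- move=> l; rewrite pairing_cproj hc /phi vl_aug (bigD1 l) //= coord_e eqxx scale1r.
  rewrite big1 ?addr0 // => i; rewrite coord_e eq_sym => /negbTE ->.
  by rewrite scale0r.
Qed.

(** ** Polynomial cochains among power series cochains *)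

Local Notation N0 := (rfun k (box (@tower_side d m 0))).
Local Notation one0 := (@rone k n (box (@tower_side d m 0))).

Let box0 x : box (@tower_side d m 0) x = nonneg n x.
Proof.
have E i : @tower_side d m 0 i = Some true by rewrite /tower_side; congr Some; lia.
by apply/boxP/nonnegP => h i; have := h i; rewrite E.
Qed.

(** The degree [t] part of a complex of power series consists of polynomials, so
    polynomials and power series give the same graded cohomology. *)
Definition as_series q (u : 'cV[S]_q) : {ffun 'I_q -> N0} := [ffun a => u a 0 *: one0].

Lemma ser_mact p q (M : 'M[S]_(p, q)) u : mact M (as_series u) = as_series (M *m u).
Proof.
apply/ffunP => a; rewrite !ffunE mxE scaler_suml; apply: eq_bigr => c _.
by rewrite ffunE scalerA.
Qed.

Lemma serZ p q (u : 'cV[S]_q) : as_series (p *: u) = p *: as_series u.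
Proof. by apply/ffunP => a; rewrite !ffunE mxE scalerA. Qed.

Lemma ser_inj q (u v : 'cV[S]_q) : as_series u = as_series v -> u = v.
Proof.
move=> /ffunP h; apply/matrixP => a j; rewrite ord1.
apply/subr0_eq/(scale_one_inj box0); rewrite scalerBl.
by have := h a; rewrite !ffunE => ->; rewrite subrr.
Qed.

Lemma ser0 q : as_series (0 : 'cV[S]_q) = 0.
Proof. by apply/ffunP => a; rewrite !ffunE mxE scale0r. Qed.

Lemma ser_cocycle i (u : 'cV[S]_(r i)) :
  cocycle (fun i => dif i) (as_series u) <-> ext_cocycle u.
Proof.
rewrite /cocycle /ext_cocycle ser_mact; split=> [|->]; last exact: ser0.
by rewrite -(ser0 (r i.+1)) => /ser_inj.
Qed.

Lemma ser_hom i t (u : 'cV[S]_(r i)) :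
  chom dg (@rproj k n _) t (as_series u) <-> ext_deg t u.
Proof.
split=> h.
  move=> a; have /ffunP/(_ a) := h; rewrite !ffunE (rproj_one box0) => E.
  suff <- : mhom (dg a + t - n%:Z) (u a 0) = u a 0 by apply: mhom_deg.
  by apply/subr0_eq/(scale_one_inj box0); rewrite scalerBl E subrr.
by apply/ffunP => a; rewrite !ffunE (rproj_one box0) mhom_id.
Qed.

Lemma ser_hom_surj i t (c : {ffun 'I_(r i) -> N0}) :
  chom dg (@rproj k n _) t c -> exists u : 'cV[S]_(r i), c = as_series u.
Proof.
move=> /ffunP h.
have H a : exists p : S, c a = p *: one0.
  have [|p _ hp] := @homogeneous_poly k n _ box0 (dg a + t - n%:Z) (c a).
    by have := h a; rewrite ffunE.
  by exists p.
have [p hp] := choice H; exists (\col_a p a).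
by apply/ffunP => a; rewrite !ffunE mxE.
Qed.

Lemma ser_coboundary i t (u : 'cV[S]_(r i)) : ext_deg t u ->
  (coboundary (fun i => dif i) (as_series u) <-> ext_coboundary u).
Proof.
move=> /ser_hom hu; case: i u hu => [|i] u hu /=; split.
- by rewrite -(ser0 (r 0)) => /ser_inj.
- by move=> ->; apply: ser0.
- case=> c hc; have hp := @rproj_graded k n (box (@tower_side d m 0)).
  have [|w hw] := @ser_hom_surj i t (cproj dg (@rproj k n _) t c).
    exact: chom_proj.
  exists w; apply: ser_inj; rewrite -ser_mact -hw -(cproj_mact dif_deg hp) -hc.
  by rewrite hu.
- by case=> w ->; exists (as_series w); rewrite ser_mact.
Qed.

(** ** The comparison with the canonical module *)

Lemma annihilator_null (f : S) : P f = 0 ->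
  exists h : 'M_(r 0, r 1), f%:M = h *m dif 0.
Proof.
move=> hf; have H a : exists w, row a f%:M = w *m dif 0.
  apply/aug_ker; have -> : row a f%:M = f *: delta_mx 0 a :> 'rV[S]_(r 0).
    by rewrite rowE mul_mx_scalar.
  by rewrite augZ hf mul0r.
have [w hw] := choice H; exists (\matrix_a w a).
by apply/row_matrixP => a; rewrite row_mul rowK.
Qed.

(** The nilpotence of the generators modulo the parameters, lifted to the
    polynomial ring: the input of the tower. *)
Lemma integral_relation (j : 'I_m) : exists (M : nat) (p : 'I_n -> S),
  P ('X_(rshift d j) ^+ M - \sum_(i : 'I_n | (i < d)%N) 'X_i * p i) = 0.
Proof.
have [M /gen_by_sum [c hc]] := hnil (rshift d j).
have H i : exists p, P p = c i by apply: hz.2.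
have [p hp] := choice H.
exists M, (fun i => oapp p 0 (insub (i : nat))).
rewrite raddfB /= rmorphXn /= pres_mapU hc (raddf_sum P) /=.
rewrite [X in _ - X]big_mkcond big_split_ord /=.
rewrite [X in _ - (_ + X)]big1 ?addr0 => [|i _]; last first.
  by case: ifP => //; lia.
apply/eqP; rewrite subr_eq0; apply/eqP; apply: eq_bigr => i _.
by rewrite ltn_ord rmorphM /= pres_mapU zy valK /= hp.
Qed.

Let tower l i (lem : (l <= m)%N) : exists T,
  ext_corr (fun i => dif i) dg (i := i) (j := shift_pos l i)
    (@rproj k n (box (@tower_side d m l))) (@rproj k n (box (@tower_side d m 0))) T.
Proof.
have [Mj h] := choice integral_relation; have [pj hp] := choice h.
by apply: (tower_corr dif_exact dif_deg (M := Mj) (p := pj)) => // j; apply: annihilator_null.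
Qed.

Let cocycle0_low l (c : {ffun 'I_(r 0) -> rfun k (box (@tower_side d m l))}) :
  (l < m)%N -> cocycle (fun i => dif i) c -> c = 0.
Proof.
move=> ltl; have [Mj h] := choice integral_relation; have [pj hp] := choice h.
by apply: (tower_cocycle0 dif_exact (M := Mj) (p := pj)) => // j; apply: annihilator_null.
Qed.

(** The dual resolution has cohomology in one position only: below it the tower
    ends with a cocycle in position zero, which vanishes, and above it
    [coinduced_vanish] applies.  A nonzero class thus determines its position. *)
Lemma ext_concentrated g t (u : {ffun 'I_(r g) -> N0}) :
  cocycle (fun i => dif i) u -> chom dg (@rproj k n _) t u ->
  ~ coboundary (fun i => dif i) u -> g = shift_pos m 0.
Proof.
move=> zu du ncob; case: (ltnP g m) => [ltg|leg].
  have [l [ltl eg]] : exists l, (l < m)%N /\ g = shift_pos l 0.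
    by exists g; rewrite shift_posE addn0.
  subst g; have [T [h1 _ _ h4 h5]] := tower 0 (ltnW ltl).
  have [c hc] := h4 _ _ zu du; case: ncob; apply/(h5 _ _ _ hc) => /=.
  by apply: cocycle0_low => //; case: (h1 _ _ _ hc).
have [i eg] : exists i, g = shift_pos m i.
  by exists (g - m)%N; rewrite shift_posE subnKC.
case: i eg => [//|i] eg; subst g; have [T [h1 _ _ h4 h5]] := tower i.+1 (leqnn m).
have [c hc] := h4 _ _ zu du; case: ncob; apply/(h5 _ _ _ hc).
by apply: coinduced_vanish; case: (h1 _ _ _ hc).
Qed.

Lemma Theta0 (M : lmodType R) (gM : int -> M -> Prop) g (Theta : 'cV[S]_(r g) -> M) :
  ext_iso gM Theta -> Theta 0 = 0.
Proof.
case=> _ h _ _; apply/h; first by rewrite /ext_cocycle mulmx0.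
by case: (g) => [|g'] //=; exists 0; rewrite mulmx0.
Qed.

(** Graded duality: the canonical module is the module of linear maps from the
    ring to the polynomial ring of the parameters, here presented by cocycles of
    degree zero with coinduced coefficients. *)
Lemma canonical_duality (M : lmodType R) (gM : int -> M -> Prop) (g : nat)
    (Theta : 'cV[S]_(r g) -> M) :
  ext_iso gM Theta -> (exists t w, gM t w /\ w <> 0) ->
  exists Rel : int -> M -> {ffun 'I_(r 0) -> D} -> Prop,
  [/\ forall t w c, Rel t w c ->
        cocycle (fun i => dif i) c /\ chom dg (@rproj k n _) t c,
      forall t w, gM t w -> exists c, Rel t w c,
      forall t c, cocycle (fun i => dif i) c -> chom dg (@rproj k n _) t c ->
        exists2 w, gM t w & Rel t w c,
      forall t w c, Rel t w c -> (w = 0 <-> c = 0)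
    & forall t q p w c, mpoly_deg q p -> Rel t w c ->
        Rel (q + t) (P p *: w) (p *: c)].
Proof.
move=> hT [tz [wz [hwz nwz]]].
have eg : g = shift_pos m 0.
  have [_ hcob _ hdeg] := hT; have [uz [zuz duz Euz]] := (hdeg tz wz).1 hwz.
  apply: (@ext_concentrated g tz (as_series uz)); first exact/ser_cocycle.
    exact/ser_hom.
  by move=> /(ser_coboundary duz) /(hcob _ zuz); rewrite Euz.
subst g; have T0 := Theta0 hT; have [hlin hcob _ hdeg] := hT.
have [T [h1 h2 h3 h4 h5]] := tower 0 (leqnn m).
exists (fun t w c => exists u : 'cV[S]_(r (shift_pos m 0)),
  [/\ ext_cocycle u, ext_deg t u, Theta u = w & T t c (as_series u)]); split.
- by move=> t w c [u [_ _ _ /h1[]]].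
- move=> t w /hdeg [u [zu du Eu]].
  have [||c hc] := h4 t (as_series u); [exact/ser_cocycle | exact/ser_hom |].
  by exists c, u.
- move=> t c zc hc; have [u0 hu0] := h3 t c zc hc.
  have [_ _ zu du] := h1 _ _ _ hu0; have [u Eu] := ser_hom_surj du.
  rewrite {}Eu in hu0 zu du; exists (Theta u).
    by apply/hdeg; exists u; split=> //; [apply/ser_cocycle | apply/ser_hom].
  by exists u; split=> //; [apply/ser_cocycle | apply/ser_hom].
- move=> t w c [u [zu du <- hu]]; rewrite hcob // -(ser_coboundary du).
  by rewrite -(h5 _ _ _ hu).
- move=> t q p w c hp [u [zu du <- hu]]; exists (p *: u).
  have E : p *: u = p *: u + 0 by rewrite addr0.
  split.
  + by rewrite /ext_cocycle -scalemxAr zu scaler0.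
  + move=> a; rewrite mxE; have := mpoly_degM hp (du a).
    by congr (mpoly_deg _ _); lia.
  + by rewrite E hlin ?T0 ?addr0 // /ext_cocycle mulmx0.
  + by rewrite serZ; apply: h2.
Qed.

(** ** Annihilators of graded components of the canonical module *)

Lemma rproj_neg t (u : Ah) : t < 0 -> rproj t u = 0.
Proof.
move=> lt; apply: rfunP => x /nonneg_is_mexpo [mu ->].
rewrite ext0_rproj weight_mexpo ext00; case: eqP => // E; move: lt.
by rewrite -E.
Qed.

Let hone x : nonneg d x = nonneg d x. Proof. by []. Qed.
Local Notation oneA := (@rone k d (nonneg d)).

Lemma cocycle0_single t l (p : A) : mpoly_deg (b l + t - d%:Z) p ->
  exists c : {ffun 'I_(r 0) -> D}, [/\ cocycle (fun i => dif i) c,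
    chom dg (@rproj k n _) t c &
    forall l', pairing c (vl l') = if l' == l then p *: oneA else 0].
Proof.
move=> hp; apply: cocycle0_exists => l'; case: eqP => [->|_].
  by rewrite (rproj_one hone) mhom_id.
by apply: rfunP => x _; rewrite ext0_rproj ext00; case: ifP.
Qed.

Section Annihilators.
Variables (M : lmodType R) (gM : int -> M -> Prop) (g : nat).
Variable Theta : 'cV[S]_(r g) -> M.
Hypothesis hT : ext_iso gM Theta.
Hypothesis hnz : exists t w, gM t w /\ w <> 0.

(** The map dual to [e l] has degree [d - b l]; this bounds the degrees [b l] in
    terms of the least degree of the canonical module. *)
Lemma dual_basis_deg l : exists w, gM (d%:Z - b l) w /\ w <> 0.
Proof.
have [Rel [R0 R1 R2 R3 _]] := canonical_duality hT hnz.
have [|c [zc hc cl]] := @cocycle0_single (d%:Z - b l) l 1.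
  have -> : b l + (d%:Z - b l) - d%:Z = 0%N by lia.
  exact: dhomog1.
have [w hw hr] := R2 _ _ zc hc; exists w; split=> // /(R3 _ _ _ hr) c0.
have := cl l; rewrite eqxx c0 => /esym E.
have /(scale_one_inj hone) /eqP : (1 : A) *: oneA = 0.
  by rewrite E pairing0l.
by rewrite oner_eq0.
Qed.

(** The maps of degree [t] are combinations of the dual basis with coefficients in
    the polynomial ring, and the dual of [e l] contributes exactly when its degree
    [d - b l] is at most [t]; a power of one parameter then gives a coefficient
    that is not a zero divisor. *)
Lemma annihilator_coord (d_gt0 : (0 < d)%N) i t x : gR i x ->
  (forall w, gM t w -> x *: w = 0) <->
  (forall l l', 0 <= b l + t - d%:Z -> coord (x * e l') l = 0).
Proof.
move=> hx; have [Rel [R0 R1 R2 R3 R4]] := canonical_duality hT hnz.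
have [p hp px] := gr_lift hR hz.1 hz hx.
have pair c l' : cocycle (fun i => dif i) c -> pairing (p *: c) (vl l') =
    \sum_l coord (x * e l') l *: pairing c (vl l).
  by move=> zc; rewrite pairingZ cocycle0_coord // augZ px vl_aug.
have kill w c : Rel t w c -> (x *: w = 0 <-> p *: c = 0).
  by move=> h; rewrite -px; apply: (R3 _ _ _ (R4 _ _ _ _ _ hp h)).
split=> [h l l' lel | h w hw].
  have [q eq_q] : exists q : nat, b l + t - d%:Z = q.
    by exists (absz (b l + t - d%:Z)%R); lia.
  pose mu := (U_(Ordinal d_gt0) *+ q)%MM.
  have [|c [zc hc cl]] := @cocycle0_single t l 'X_[mu].
    by rewrite eq_q /= dhomogX /= mdegMn mdeg1 mul1n.
  have [w hw hr] := R2 _ _ zc hc.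
  have /(kill _ _ hr) c0 := h w hw.
  have := pair c l' zc; rewrite c0 pairing0l (bigD1 l) //= big1 ?addr0 => [|l1 ne].
    rewrite cl eqxx scalerA => /esym /(scale_one_inj hone) E.
    by apply/mpolyP => mu'; rewrite mcoeff0 -(mcoeffMX _ mu) E mcoeff0.
  by rewrite cl (negbTE ne) scaler0.
have [c hr] := R1 t w hw; have [zc hc] := R0 _ _ _ hr.
apply/(kill _ _ hr); have [zpc _] := R0 _ _ _ (R4 _ _ _ _ _ hp hr).
apply: (cocycle0_eq0 zpc) => l'; rewrite pair // big1 // => l _.
case: (lerP 0 (b l + t - d%:Z)) => lel; first by rewrite h // scale0r.
by rewrite -hc pairing_cproj rproj_neg // scaler0.
Qed.

End Annihilators.

Lemma coord_deg i x l : gR i x -> mpoly_deg (i - b l) (coord x l).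
Proof.
move=> hx; have hg : is_grading gR by case: hR.
have y1 j : gR 1 (y j) by rewrite -zy; case: hz.
suff -> : coord x l = mhom (i - b l) (coord x l) by apply: mhom_deg.
apply: (@coord_eq _ (fun l => mhom (i - b l) (coord x l))).
rewrite -[LHS](gproj_id hg hx) {1}(coordP x) raddf_sum.
apply: eq_bigr => l' _ /=; rewrite -(gproj_pres hR y1 hg).
have hM : forall j u, gR j u -> gR (b l' + j) (e l' * u).
  by case: hR => _ hM _ _ _ j u; apply: hM.
have := @gproj_act R R gR gR hg hg (b l') _ (i - b l') (evA (coord x l'))
  (fun _ _ => mulrDr _ _ _) hM.
by rewrite addrC subrK [_ * e l']mulrC => ->; rewrite mulrC.
Qed.

Lemma coord_mul x v l : coord (x * v) l = \sum_l' coord v l' * coord (x * e l') l.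
Proof.
apply: (@coord_eq _ (fun l => \sum_l' coord v l' * coord (x * e l') l)).
rewrite {1}(coordP v) mulr_sumr.
under [RHS]eq_bigr => i _ do rewrite raddf_sum mulr_suml.
rewrite exchange_big; apply: eq_bigr => l' _ /=.
rewrite mulrCA {1}(coordP (x * e l')) mulr_sumr.
by apply: eq_bigr => i _; rewrite rmorphM mulrA.
Qed.

Lemma basis_neq0 l : e l <> 0.
Proof.
move=> h; have H : \sum_l' evA ((l' == l)%:R : A) * e l' = 0.
  rewrite (bigD1 l) //= h mulr0 big1 ?addr0 // => i /negbTE ->.
  by rewrite raddf0 mul0r.
by have /eqP := e_free H l; rewrite eqxx oner_eq0.
Qed.

End Duality.
(** * Powers of the parameter ideal and of the maximal ideal *)

Section IdealPowers.
Variables (k : fieldType) (R : comAlgType k).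

Lemma ideal_pow_ideal (I : R -> Prop) q : is_ideal (ideal_pow I q).
Proof. by case: q => [|q]; [split | apply: gen_submodule]. Qed.

Section Order.
Variables (d : nat) (y : 'I_d -> R) (s : nat) (e : 'I_s -> R).
Hypothesis e_span : forall r, exists a : 'I_s -> {mpoly k[d]},
  r = \sum_l pres_map y (a l) * e l.
Hypothesis e_free : forall a : 'I_s -> {mpoly k[d]},
  \sum_l pres_map y (a l) * e l = 0 -> forall l, a l = 0.
Local Notation A := {mpoly k[d]}.
Local Notation coord := (coord e_span).

Definition order_ge q (a : A) : Prop := forall mu, (mdeg mu < q)%N -> a@_mu = 0.

Lemma order_geM q a c : order_ge q a -> order_ge q (c * a).
Proof.
move=> h mu lt; rewrite mcoeffM big1 // => -[m1 m2] /= /eqP E.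
have := congr1 (@mdeg d) E; rewrite mdegD => Em.
by rewrite [X in _ * X]h ?mulr0 //; apply: leq_ltn_trans lt; rewrite [X in (_ <= X)%N]Em leq_addl.
Qed.

Lemma order_geX q a i : order_ge q a -> order_ge q.+1 ('X_i * a).
Proof.
move=> h mu lt; rewrite mcoeffM big1 // => -[m1 m2] /= /eqP E.
rewrite mcoeffX; case: eqP => [e1|_]; last by rewrite mul0r.
have := congr1 (@mdeg d) E; rewrite mdegD -e1 mdeg1 => Em.
rewrite [X in _ * X]h ?mulr0 //; have := lt; rewrite [X in (X < _)%N]Em.
by rewrite add1n ltnS.
Qed.

Lemma order_ge_sum q (I : Type) (r : seq I) (F : I -> A) :
  (forall i, order_ge q (F i)) -> order_ge q (\sum_(i <- r) F i).
Proof.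
by move=> h mu lt; rewrite raddf_sum big1 // => i _; apply: h.
Qed.

Definition coord_order q (x : R) : Prop := forall l, order_ge q (coord x l).

Lemma coord0 l : coord 0 l = 0.
Proof. by have := coordB e_span e_free 0 0 l; rewrite !subrr. Qed.

Lemma coordD u v l : coord (u + v) l = coord u l + coord v l.
Proof.
have := coordB e_span e_free u (- v) l; rewrite opprK => ->; congr (_ + _).
by have := coordB e_span e_free 0 v l; rewrite sub0r coord0 sub0r => ->; rewrite opprK.
Qed.

Lemma coord_order_ideal q : is_ideal (coord_order q).
Proof.
split=> [l mu _|u v hu hv l mu lt|c u hu l].
- by rewrite coord0 mcoeff0.
- by rewrite coordD mcoeffD hu // hv // addr0.
rewrite /GRing.scale /= (coord_mul e_span e_free); apply: order_ge_sum => l'.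
by rewrite mulrC; apply: order_geM; apply: hu.
Qed.

Lemma pow_monomial q (mu : 'X_{1..d}) : (q <= mdeg mu)%N ->
  ideal_pow (gen_by y) q (pres_map y 'X_[mu]).
Proof.
elim: q mu => [//|q IH] mu lt.
have [i hi] : exists i, mu i != 0%N.
  apply/existsP; rewrite -negb_forall; apply/negP => /forallP h.
  by move: lt; rewrite mdegE big1 // => i _; apply/eqP.
rewrite (pres_mapXU _ hi); apply: gen_incl; exists (y i), (pres_map y 'X_[mu - U_(i)]).
split=> //; first by apply: gen_incl; exists i.
apply: IH; move: lt; have := hi; rewrite -lep1mP => /submK {1}<-.
by rewrite mdegD mdeg1 addn1.
Qed.

(** The parameters act on the coordinates as variables, so the power [q] of their
    ideal is cut out by the order of vanishing of each coordinate. *)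
Lemma param_pow q x : ideal_pow (gen_by y) q x <-> coord_order q x.
Proof.
split=> [|h].
  elim: q x => [|q IH] x; first by move=> _ l mu.
  have hq1 := coord_order_ideal q.+1.
  move=> /(_ (coord_order q.+1)); apply; first exact: hq1.
  move=> _ [u [v [/gen_by_sum [c ->] /IH hv ->]]].
  rewrite mulr_suml; apply: (@submodule_sum R R^o _ _ _ _ _ hq1) => i _.
  have hcv : coord_order q (c i * v).
    by have [_ _ h] := coord_order_ideal q; apply: (h (c i) v hv).
  move=> l; rewrite -mulrA -pres_mapU (coordM e_span e_free).
  by apply: order_geX; apply: hcv.
have [_ _ hZ] := ideal_pow_ideal (gen_by y) q.
rewrite (coordP e_span x).
apply: (@submodule_sum R R^o _ _ _ _ _ (ideal_pow_ideal (gen_by y) q)) => l _.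
rewrite mulrC; apply: (hZ (e l)).
rewrite (mpolyE (coord x l)) raddf_sum big_seq.
apply: (@submodule_sum R R^o _ _ _ _ _ (ideal_pow_ideal (gen_by y) q)) => mu hmu.
rewrite /= -mul_mpolyC rmorphM; apply: (hZ (pres_map y _%:MP)); apply: pow_monomial.
rewrite leqNgt; apply/negP => lt; move: hmu; rewrite mcoeff_msupp.
by rewrite (h l) // eqxx.
Qed.

End Order.

Variable gR : int -> R -> Prop.
Hypothesis hR : standard_graded gR.
Variable hg : is_grading gR.

Let gRM : forall i j x z, gR i x -> gR j z -> gR (i + j) (x * z).
Proof. by case: hR. Qed.
Let gR_neg : forall (i : int) x, i < 0 -> gR i x -> x = 0.
Proof. by case: hR. Qed.

Definition vanish_below (q : nat) (x : R) : Prop :=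
  forall i : int, i < q%:Z -> gproj hg i x = 0.

Lemma gproj_mul i j (x v : R) : gR i x -> gproj hg (i + j) (x * v) = x * gproj hg j v.
Proof.
move=> hx; apply: (@gproj_act R R gR gR hg hg i (fun v => x * v)) => [a b|l u].
  exact: mulrDr.
exact: gRM.
Qed.

Lemma vanish_below_mul q q' x v :
  vanish_below q x -> vanish_below q' v -> vanish_below (q + q') (x * v).
Proof.
move=> hx hv i lt; have [S _ ->] := gproj_sum hg x.
rewrite mulr_suml raddf_sum big1 // => j _ /=.
have -> : i = j + (i - j) by rewrite addrC subrK.
rewrite (gproj_mul _ _ (gproj_mem hg j x)).
case: (ltrP j q%:Z) => hj; first by rewrite hx // mul0r.
by rewrite [X in _ * X]hv ?mulr0 //; move: lt; rewrite PoszD; lia.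
Qed.

Lemma vanish_below_ideal q : is_ideal (vanish_below q).
Proof.
split=> [i _|u v hu hv i lt|c u hu].
- exact: raddf0.
- by rewrite raddfD /= hu // hv // addr0.
rewrite /GRing.scale /=; apply: (@vanish_below_mul 0%N q c u _ hu) => i lt.
by apply: (gR_neg lt); apply: gproj_mem.
Qed.

Lemma max_pow_vanish_below q x : ideal_pow (max_ideal gR) q x -> vanish_below q x.
Proof.
elim: q x => [|q IH] x.
  by move=> _ i lt; apply: (gR_neg lt); apply: gproj_mem.
move=> /(_ (vanish_below q.+1)); apply; first exact: vanish_below_ideal.
move=> _ [u [v [hu /IH hv ->]]]; rewrite -add1n; apply: vanish_below_mul => //.
move: hu => /(_ (vanish_below 1)); apply; first exact: vanish_below_ideal.
move=> w [i [i0 hw]] j lt; apply: (gproj_neq hg hw); lia.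
Qed.

(** This is where generation in degree one enters. *)
Lemma gr_max_pow q x : gR (q%:Z) x -> ideal_pow (max_ideal gR) q x.
Proof.
move=> hx; have [_ _ _ _ [n [z hz]]] := hR.
have [p hp <-] := gr_lift hR hz.1 hz hx.
have hI := ideal_pow_ideal (max_ideal gR) q; have [_ _ hZ] := hI.
rewrite (mpolyE p) raddf_sum big_seq.
apply: (@submodule_sum R R^o _ _ _ _ _ hI) => mu hmu.
rewrite /= -mul_mpolyC rmorphM; apply: (hZ (pres_map z _%:MP)) => /=.
have : mdeg mu = q by apply: (dhomog_mf hp).
move: {hx hp hmu hI hZ p x} mu; elim: q => [//|q IH] mu emu.
have [i hi] : exists i, mu i != 0%N.
  apply/existsP; rewrite -negb_forall; apply/negP => /forallP h.
  by move: emu; rewrite mdegE big1 // => i _; apply/eqP.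
rewrite (pres_mapXU _ hi); apply: gen_incl; exists (z i), (pres_map z 'X_[mu - U_(i)]).
split=> //; first by apply: gen_incl; exists 1; split=> //; apply: hz.1.
apply: IH; apply/eqP; rewrite -eqSS -emu -[in X in _ == X](submK (m := U_(i)) (m' := mu)).
  by rewrite mdegD mdeg1 addn1.
by rewrite lep1mP.
Qed.

End IdealPowers.

(** * The annihilator formula *)

Lemma annihilator_gen (R : comNzRingType) (M : lmodType R) (X : M -> Prop) r :
  annihilator (submod_gen X) r <-> forall w, X w -> r *: w = 0.
Proof.
split=> [h w Xw|h w]; first by apply: h; apply: gen_incl.
move=> /(_ (fun w => r *: w = 0)); apply=> //.
split=> [|u v hu hv|c u hu]; first exact: scaler0.
  by rewrite scalerDr hu hv addr0.
by rewrite scalerA mulrC -scalerA hu scaler0.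
Qed.

Lemma annihilator_homogeneous (k : fieldType) (R : comAlgType k)
    (gR : int -> R -> Prop) (hg : is_grading gR) (M : lmodType R)
    (gM : int -> M -> Prop) (t : int) r :
  is_graded_module gR gM ->
  (forall w, gM t w -> r *: w = 0) <->
  (forall i w, gM t w -> gproj hg i r *: w = 0).
Proof.
move=> [hM hRM]; split=> [h i w hw|h w hw].
  have := @gproj_act R M gR gM hg hM t (fun x => x *: w) i r.
  rewrite h // raddf0 => <- //; first by move=> a b; rewrite scalerDl.
  by move=> j x hx; rewrite addrC; apply: hRM.
by have [S _ ->] := gproj_sum hg r; rewrite scaler_suml big1 // => i _; apply: h.
Qed.

Theorem theorem2p7 (k : fieldType) (R : comAlgType k) (gR : int -> R -> Prop)
  (hR : standard_graded gR) (hCM : cohen_macaulay gR)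
  (d : nat) (hd : (1 <= d)%N) (hdim : krull_dim R d)
  (omega : lmodType R) (gO : int -> omega -> Prop)
  (hO : is_canonical_module gR gO)
  (a : int) (ha : is_a_invariant gO a)
  (y : 'I_d -> R) (hy : linear_sop gR y)
  (t j : int) (hj : a + d%:Z <= j) :
  (forall r : R,
     annihilator (deg_le_sub gO t) r <-> annihilator (deg_sub gO t) r) /\
  (forall r : R,
     annihilator (deg_sub gO t) r <->
     dsum (fun i x =>
             gR i x /\
             ideal_colon (ideal_powz (gen_by y) (i + j - d%:Z + t + 1))
                         (ideal_powz (max_ideal gR) j) x) r).
Proof.
have hg : is_grading gR by case: hR.
have gRM : forall i j x z, gR i x -> gR j z -> gR (i + j) (x * z) by case: hR.
have [_ y1 hrad] := hy.
have nil1 (n : nat) (z : 'I_n -> R) : is_presentation gR z ->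
    forall i, exists M : nat, gen_by y (z i ^+ M).
  by move=> hz i; apply/hrad; apply: gen_incl; exists 1; split=> //; apply: hz.1.
have [s [e [b [e_deg e_span e_free]]]] : exists (s : nat) (e : 'I_s -> R) (b : 'I_s -> int),
    [/\ forall l, gR (b l) (e l),
        forall r, exists a : 'I_s -> {mpoly k[d]}, r = \sum_l pres_map y (a l) * e l
      & forall a : 'I_s -> {mpoly k[d]}, \sum_l pres_map y (a l) * e l = 0 ->
          forall l, a l = 0].
  have [_ _ _ _ [n [z hz]]] := hR.
  exact: (free_basis hR y1 hz (nil1 n z hz) (sop_regular hR hCM hy)).
have y_free (c : 'I_d -> k) : \sum_i c i *: y i = 0 -> forall i, c i = 0.
  move=> hc i; pose f : {mpoly k[d]} := \sum_i c i *: 'X_i.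
  have f0 : pres_map y f = 0.
    by rewrite -hc raddf_sum; apply: eq_bigr => l _ /=; rewrite pres_mapZ pres_mapU.
  have [l hl] : exists l, coord e_span 1 l != 0.
    apply: contrapT => /forallNP h; have /eqP := coordP e_span 1.
    rewrite big1 ?oner_eq0 // => l _; have /negP := h l; rewrite negbK => /eqP ->.
    by rewrite raddf0 mul0r.
  have : coord e_span (pres_map y f * 1) l = 0.
    by rewrite f0 mul0r coord0.
  rewrite (coordM e_span e_free) => /eqP; rewrite mulf_eq0 (negbTE hl) orbF => /eqP f00.
  have := congr1 (mcoeff U_(i)) f00; rewrite mcoeff0 raddf_sum (bigD1 i) //=.
  rewrite mcoeffZ mcoeffX eqxx mulr1 big1 ?addr0 // => l' ne.
  by rewrite mcoeffZ mcoeffX eq_mnm1 (negbTE ne) mulr0.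
have [m [z [g [F [Theta [hz zy hT]]]]]] := canonical_coordinates hR y1 y_free hO.
have hnil := nil1 _ z hz.
have [vl [vl_deg vl_aug]] := lifts_exist hR hz e_deg F.
have hnz : exists t w, gO t w /\ w <> 0 by case: ha => -[w hw] _; exists (- a), w.
have [hgO _] := hO.
(* Degrees of basis elements; with a + d <= j, none of them exceeds j. *)
have nb l : 0 <= b l <= a + d%:Z.
  apply/andP; split.
    rewrite leNgt; apply/negP => lt; apply: (@basis_neq0 k R d y s e e_free l).
    by case: hR => _ _ h _ _; apply: h lt (e_deg l).
  have [w [hw nw]] := dual_basis_deg zy hz hnil e_span e_free vl_deg vl_aug hT hnz l.
  by have := ha.2 (d%:Z - b l) (ex_intro _ w (conj hw nw)); lia.
have key i t' x : gR i x -> (forall w, gO t' w -> x *: w = 0) <->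
    (forall l l', 0 <= b l + t' - d%:Z -> coord e_span (x * e l') l = 0).
  exact: (annihilator_coord hR zy hz hnil e_span e_free vl_deg vl_aug hT hnz hd).
have killH t' r := annihilator_homogeneous hg t' r hgO.
have killE t' r : annihilator (deg_sub gO t') r <-> forall w, gO t' w -> r *: w = 0.
  exact: annihilator_gen.
split=> r.
  rewrite killE; split=> [/annihilator_gen h w hw | /killH h].
    by apply: h; exists t.
  apply/annihilator_gen => w [i [lei hw]]; move: w hw; apply/killH => q w hw.
  have hq := gproj_mem hg q r.
  apply: (key q i _ hq).2 w hw => l l' ge0; apply: ((key q t _ hq).1 _ l l'); last by lia.
  exact: h.
have [q jq] : exists q : nat, j = q.
  have s_gt0 : (0 < s)%N.
    rewrite lt0n; apply/eqP => s0; have [c] := e_span 1.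
    rewrite big1 => [|l _]; first by move/eqP; rewrite oner_eq0.
    by have := ltn_ord l; rewrite [X in (_ < X)%N]s0.
  by have := nb (Ordinal s_gt0); case: (j) hj => [q _ _|q]; [exists q | lia].
subst j; have coordX x v l (N : nat) : coord e_span (x * (y (Ordinal hd) ^+ N * v)) l =
    'X_(Ordinal hd) ^+ N * coord e_span (x * v) l.
  by rewrite mulrCA -pres_mapU -rmorphXn (coordM e_span e_free).
have Xinj (N : nat) (c : {mpoly k[d]}) : 'X_(Ordinal hd) ^+ N * c = 0 -> c = 0.
  rewrite mpolyXn mulrC => h; apply/mpolyP => mu.
  by rewrite -(mcoeffMX _ (U_(Ordinal hd) *+ N)%MM) h !mcoeff0.
(* The colon ideal, in coordinates: membership only has to be tested on basis
   elements, pushed up to degree j by a power of one parameter, and there the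
   order of a homogeneous coordinate is its degree i + j - b l. *)
have colon i x : gR i x ->
    ideal_colon (ideal_powz (gen_by y) (i + q%:Z - d%:Z + t + 1))
      (ideal_powz (max_ideal gR) q) x <->
    (forall l l', 0 <= b l + t - d%:Z -> coord e_span (x * e l') l = 0).
  move=> hx; split=> [h l l' ge0|h v hv].
    have [N hN] : exists N : nat, q%:Z - b l' = N.
      have := nb l'; case E : (q%:Z - b l') => [N|N]; first by exists N.
      by move: E; lia.
    pose v := y (Ordinal hd) ^+ N * e l'.
    have hv : gR q v.
      have -> : q%:Z = N%:Z + b l' by lia.
      apply: (gRM) => //; elim: (N) => [|N' IH].
        by rewrite expr0 -[1]scale1r; apply: gr_alg.
      by rewrite exprS -add1n PoszD; apply: gRM.
    have hc := coord_deg hR zy hz e_deg e_span e_free l (gRM _ _ _ _ hx hv).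
    apply: (Xinj N); rewrite -coordX; apply/mpolyP => mu; rewrite mcoeff0.
    apply/eqP; apply: contrapT => /negP ne; have := mpoly_deg_coef hc ne.
    have := h v (gr_max_pow hR hv).
    case E : (i + q%:Z - d%:Z + t + 1) => [p|p] /= hp; last by move: E; lia.
    have := (param_pow e_span e_free p (x * v)).1 hp l mu.
    case: (ltnP (mdeg mu) p) => [_ /(_ isT) c0|]; last by move: E; lia.
    by rewrite c0 eqxx in ne.
  case E : (i + q%:Z - d%:Z + t + 1) => [p|p] //=.
  apply/(param_pow e_span e_free); have hI := coord_order_ideal e_span e_free p.
  have [S _ ->] := gproj_sum hg v; rewrite mulr_sumr.
  apply: (@submodule_sum R R^o _ _ _ _ _ hI) => i' _.
  case: (ltrP i' q%:Z) => lti.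
    by rewrite (max_pow_vanish_below hR hg hv lti) mulr0; case: hI.
  move=> l mu lt; case: (lerP 0 (b l + t - d%:Z)) => ge0.
    rewrite (coord_mul e_span e_free) big1 ?mcoeff0 // => l' _.
    by rewrite h // mulr0.
  have hc := coord_deg hR zy hz e_deg e_span e_free l (gRM _ _ _ _ hx (gproj_mem hg i' v)).
  apply/eqP; apply: contrapT => /negP ne; have := mpoly_deg_coef hc ne.
  by move: E lt; lia.
rewrite killE; split=> [/killH h|[S [f [_ hf ->]]] w hw].
  have [S uS {1}->] := gproj_sum hg r; exists S, (gproj hg ^~ r); split=> // i _.
  have gi := gproj_mem hg i r; split=> //; apply/(colon _ _ gi).
  by apply: (key i t _ gi).1 => w; apply: h.
rewrite scaler_suml big_seq big1 // => i /hf [gi /(colon _ _ gi) hi].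
exact: (key i t _ gi).2.
Qed.
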